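(* Let $f=1.6$ and $d=0.1$. For each pair $(q,p)\in\{(7,1),(6,3),(6,2),(4,2)\}$ there exist a solution $(a,\zeta)$ of the stationary Lugiato–Lefever equation $$d\,a''+(i-\zeta)a+|a|^2a-if=0,\qquad a:\mathbb{R}\to\mathbb{C}\ \text{ is } 2\pi\text{-periodic},$$ such that $a$ is nonconstant and $2\pi/q$-periodic, and a sequence $(a_n,\zeta_n)$ of solutions of this equation such that each $a_n$ is $2\pi/p$-periodic but not $2\pi/q$-periodic and $(a_n,\zeta_n)\to(a,\zeta)$ in $H^1_{per}([0,2\pi];\mathbb{C})\times\mathbb{R}$ as $n\to\infty$.
   Context: The parameters $d,f\in\mathbb{R}$ are fixed, and $\zeta\in\mathbb{R}$ is the bifurcation parameter, so a solution is a pair $(a,\zeta)$ consisting of a $2\pi$-periodic function $a$ and a real number $\zeta$ satisfying the equation (with $\zeta_n$ in place of $\zeta$ for $(a_n,\zeta_n)$). $H^1_{per}([0,2\pi];\mathbb{C})$ is the Sobolev space of $2\pi$-periodic complex-valued functions that are locally $H^1$. *)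

(* Defs.v *)
From Stdlib Require Import Reals Lra.
From Coquelicot Require Import Coquelicot.
Open Scope R_scope.

Definition periodic (T : R) (a : R -> C) : Prop :=
  forall t : R, a (t + T) = a t.

Definition nonconstant (a : R -> C) : Prop :=
  exists s t : R, a s <> a t.

(* C is viewed as a real normed space: these are derivatives with respect to
   the real variable t, not complex derivatives. *)
Definition differentiable (a : R -> C) : Prop :=
  forall t : R, @ex_derive R_AbsRing C_R_NormedModule a t.

(* Meaningful when [a] is differentiable, see [derivative_correct]. *)
Definition derivative (a : R -> C) (t : R) : C :=
  (Derive (fun s => Re (a s)) t, Derive (fun s => Im (a s)) t).

(* Classical solutions.  Nothing is lost: in one dimension H^1 functions are
   continuous, so a weak solution has a continuous second derivative. *)
Definition lle_solution (d f : R) (a : R -> C) (zeta : R) : Prop :=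
  periodic (2 * PI) a /\
  differentiable a /\ differentiable (derivative a) /\
  forall t : R,
    (RtoC d * derivative (derivative a) t + (Ci - RtoC zeta) * a t
     + RtoC (Cmod (a t) ^ 2) * a t - Ci * RtoC f = 0)%C.

(* The norm of H^1_per([0,2 PI]; C), on functions whose weak derivative is the
   classical one.  Solutions are C^1, so the Riemann integral below exists for
   the difference of two solutions, see [H1_norm_integrable]. *)
Definition H1_norm (u : R -> C) : R :=
  sqrt (RInt (fun t => Cmod (u t) ^ 2 + Cmod (derivative u t) ^ 2) 0 (2 * PI)).

Definition H1_converges (a_ : nat -> R -> C) (a : R -> C) : Prop :=
  is_lim_seq (fun n => H1_norm (fun t => (a_ n t - a t)%C)) 0.

Lemma norm_C_R (z : C) : @norm R_AbsRing C_R_NormedModule z = Cmod z.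
Proof.
change (sqrt (Rabs (fst z) ^ 2 + Rabs (snd z) ^ 2) = Cmod z).
rewrite !pow2_abs. reflexivity.
Qed.

Lemma is_derive_C_components (a : R -> C) (t : R) (l : C) :
  @is_derive R_AbsRing C_R_NormedModule a t l <->
  is_derive (fun s => Re (a s)) t (Re l) /\ is_derive (fun s => Im (a s)) t (Im l).
Proof.
split.
- intros [_ H]. split; (split; [apply is_linear_scal_l|]);
    intros x Hx eps; specialize (H x Hx eps); revert H; apply filter_imp;
    intros y Hy;
    set (z := minus (minus (a y) (a x)) (@scal R_AbsRing C_R_NormedModule (minus y x) l));
    fold z in Hy; rewrite norm_C_R in Hy;
    pose proof (Rmax_Cmod z) as Hz.
  + change (Rabs (Re z) <= eps * norm (minus y x)).
    exact (Rle_trans _ _ _ (Rle_trans _ _ _ (Rmax_l _ _) Hz) Hy).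
  + change (Rabs (Im z) <= eps * norm (minus y x)).
    exact (Rle_trans _ _ _ (Rle_trans _ _ _ (Rmax_r _ _) Hz) Hy).
- intros [[_ H1] [_ H2]]. split; [apply is_linear_scal_l|].
  intros x Hx eps.
  assert (He : 0 < eps / 2) by (destruct eps; simpl; lra).
  specialize (H1 x Hx (mkposreal _ He)). specialize (H2 x Hx (mkposreal _ He)).
  generalize (filter_and _ _ H1 H2); apply filter_imp.
  intros y [Hy1 Hy2]; simpl in Hy1, Hy2.
  set (z := minus (minus (a y) (a x)) (@scal R_AbsRing C_R_NormedModule (minus y x) l)).
  change (Rabs (Re z) <= eps / 2 * norm (minus y x)) in Hy1.
  change (Rabs (Im z) <= eps / 2 * norm (minus y x)) in Hy2.
  rewrite norm_C_R.
  assert (Hz : Cmod z <= Rabs (Re z) + Rabs (Im z)).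
  { replace z with (RtoC (Re z) + Ci * RtoC (Im z))%C at 1.
    - eapply Rle_trans; [apply Cmod_triangle|].
      rewrite Cmod_mult, Cmod_Ci, !Cmod_R. lra.
    - destruct z; unfold Ci, RtoC, Cplus, Cmult; simpl; f_equal; ring. }
  eapply Rle_trans; [exact Hz|].
  eapply Rle_trans; [exact (Rplus_le_compat _ _ _ _ Hy1 Hy2)|].
  assert (G : forall e r : R, e / 2 * r + e / 2 * r <= e * r) by (intros; lra).
  apply G.
Qed.

Lemma derivative_correct (a : R -> C) :
  differentiable a ->
  forall t : R, @is_derive R_AbsRing C_R_NormedModule a t (derivative a t).
Proof.
intros Ha t. destruct (Ha t) as [l Hl].
destruct (proj1 (is_derive_C_components a t l) Hl) as [H1 H2].
apply is_derive_C_components. split; apply Derive_correct; eexists; eassumption.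
Qed.

Lemma H1_norm_integrable (d f zeta zeta' : R) (a b : R -> C) :
  lle_solution d f a zeta -> lle_solution d f b zeta' ->
  let u := fun t => (a t - b t)%C in
  ex_RInt (fun t => Cmod (u t) ^ 2 + Cmod (derivative u t) ^ 2) 0 (2 * PI).
Proof.
intros [_ [Ha [Ha' _]]] [_ [Hb [Hb' _]]] u.
assert (E : forall c, differentiable c -> forall t,
  is_derive (fun s => Re (c s)) t (Re (derivative c t)) /\
  is_derive (fun s => Im (c s)) t (Im (derivative c t))).
{ intros c Hc t. apply is_derive_C_components, derivative_correct, Hc. }
assert (N : forall z, Cmod z ^ 2 = Re z * Re z + Im z * Im z).
{ intros z. unfold Cmod. rewrite pow2_sqrt; unfold Re, Im; nra. }
assert (D : forall t, derivative u t = (derivative a t - derivative b t)%C).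
{ intros t. unfold derivative, Cminus, Cplus, Copp. simpl.
  f_equal; apply is_derive_unique.
  - apply @is_derive_plus; [|apply @is_derive_opp]; apply E; assumption.
  - apply @is_derive_plus; [|apply @is_derive_opp]; apply E; assumption. }
assert (K : forall c, differentiable c -> forall t,
  continuous (fun s => Re (c s)) t /\ continuous (fun s => Im (c s)) t).
{ intros c Hc t. destruct (E c Hc t).
  split; apply @ex_derive_continuous; eexists; eassumption. }
apply @ex_RInt_continuous. intros t _.
apply continuous_ext with
  (fun s => (Re (a s) - Re (b s)) * (Re (a s) - Re (b s))
          + (Im (a s) - Im (b s)) * (Im (a s) - Im (b s))
          + ((Re (derivative a s) - Re (derivative b s)) *
             (Re (derivative a s) - Re (derivative b s))
           + (Im (derivative a s) - Im (derivative b s)) *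
             (Im (derivative a s) - Im (derivative b s)))).
{ intros s. rewrite D, !N. reflexivity. }
destruct (K a Ha t), (K b Hb t), (K _ Ha' t), (K _ Hb' t).
repeat (apply @continuous_plus || apply @continuous_mult || apply @continuous_opp);
  assumption.
Qed.

(* Main.v *)
Require Import Defs.
From Stdlib Require Import Reals Lra Lia ZArith List Bool FunctionalExtensionality.
From Coquelicot Require Import Coquelicot.
Import ListNotations.
Open Scope R_scope.

(** Write a 2 pi / p - periodic even function as a cosine series in p t, put m = q / p, and split
    it as b + s w, where b collects the frequencies divisible by m (so b is 2 pi / q - periodic)
    and w the others.  The equation for b + s w, with its off-class part divided by s, is
    polynomial in s and makes sense at s = 0, where it says that b solves the equation and w solves
    the equation linearised at b.  Normalising one coefficient of w and taking zeta as an unknown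
    in exchange, the system at s = 0 has an isolated nondegenerate zero when b is a simple bifurcation
    point crossed transversally; that zero then persists for small s > 0 and depends continuously on
    s.  The functions b_s + s w_s are the bifurcating solutions, and b_0 is the solution they
    bifurcate from.

    All this takes place in the space l^1 of coefficient sequences.  The division by s is built into
    the multiplication: [dprod m s] multiplies cosines with structure constants weighted by 1, s or
    s^2, in such a way that evaluating the sequence at [amp m s n * cos (n p t)] is multiplicative
    for every s ([eval_dprod]).  Hence a zero of one and the same polynomial [residual] gives a
    solution for each s ([eval_residual], [profile_solution]).

    The zeros come from the contraction principle ([fixpt_spec], [zeros]) applied to Newton's
    method with an approximate zero [xbar] and an approximate inverse of the derivative, acting on
    the right: the unknown is the right-hand side y, and x = xbar + xop y.  On high frequencies the
    inverse is that of the second derivative, so y - residual is a bounded map, and the operator norm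
    of its derivative is the supremum of the norms of its columns ([bounded_op_columns]): finitely
    many are computed exactly, the others are small because of the division by the squared
    frequency ([defect_tail]).

    What remains is numerical.  A [certificate] contains integer approximations of the zero and of
    the inverse; [certificate_bounds] turns a boolean computation on them into the hypotheses of
    the contraction argument, and [certified_bifurcation] into the bifurcation.  The four certificates
    were found by continuation of the branches of 2 pi / q - periodic solutions in zeta, up to a sign
    change of the determinant of the linearisation on off-class functions, and Newton's method. *)

(** * Absolutely summable sequences *)

Fixpoint psum (f : nat -> R) (N : nat) : R :=
  match N with O => 0 | S n => psum f n + f n end.

Lemma psum_ext f g N : (forall n, (n < N)%nat -> f n = g n) -> psum f N = psum g N.
Proof.
induction N as [|N IH]; intros H; simpl; auto.
rewrite IH, H; auto.
Qed.

Lemma psum_plus f g N : psum (fun n => f n + g n) N = psum f N + psum g N.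
Proof. induction N as [|N IH]; simpl; [|rewrite IH]; ring. Qed.

Lemma psum_scal k f N : psum (fun n => k * f n) N = k * psum f N.
Proof. induction N as [|N IH]; simpl; [|rewrite IH]; ring. Qed.

Lemma psum_zero f N : (forall n, (n < N)%nat -> f n = 0) -> psum f N = 0.
Proof.
intros H. rewrite (psum_ext f (fun n => 0 * f n)).
- rewrite psum_scal; ring.
- intros n Hn; rewrite H; auto; ring.
Qed.

Lemma psum_le f g N : (forall n, (n < N)%nat -> f n <= g n) -> psum f N <= psum g N.
Proof.
induction N as [|N IH]; intros H; simpl; [lra|].
pose proof (H N (Nat.lt_succ_diag_r N)).
assert (psum f N <= psum g N) by (apply IH; auto). lra.
Qed.

Lemma psum_abs f N : Rabs (psum f N) <= psum (fun n => Rabs (f n)) N.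
Proof.
induction N as [|N IH]; simpl; [rewrite Rabs_R0; lra|].
pose proof (Rabs_triang (psum f N) (f N)). lra.
Qed.

Lemma psum_exchange (a : nat -> nat -> R) N K :
  psum (fun n => psum (fun k => a k n) K) N = psum (fun k => psum (fun n => a k n) N) K.
Proof.
induction N as [|N IH]; simpl.
- symmetry; apply psum_zero; auto.
- rewrite IH, <- psum_plus. reflexivity.
Qed.

Lemma psum_mono f N K : (forall n, 0 <= f n) -> (N <= K)%nat -> psum f N <= psum f K.
Proof. intros H; induction 1; simpl; [lra|]. specialize (H m). lra. Qed.

Lemma psum_term f N n : (forall n, 0 <= f n) -> (n < N)%nat -> f n <= psum f N.
Proof.
intros H Hn. apply Rle_trans with (psum f (S n)); [|apply psum_mono; auto; lia].
simpl. assert (0 <= psum f n) by (apply (psum_mono f 0); auto; lia). lra.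
Qed.

Lemma psum_lim (u : nat -> nat -> R) (c : nat -> R) N :
  (forall n, is_lim_seq (fun K => u K n) (c n)) ->
  is_lim_seq (fun K => psum (u K) N) (psum c N).
Proof.
intros H; induction N as [|N IH]; simpl.
- apply is_lim_seq_const.
- apply (is_lim_seq_plus' _ _ _ _ IH (H N)).
Qed.

(** The bound on the partial sums replaces the l^1 norm: it can be stated before summability is known
    and passes to coordinatewise limits ([l1_le_lim]). *)
Definition l1_le (c : nat -> R) (M : R) : Prop :=
  forall N, psum (fun n => Rabs (c n)) N <= M.
Definition l1 (c : nat -> R) : Prop := exists M, l1_le c M.

Definition sadd (a b : nat -> R) (n : nat) : R := a n + b n.
Definition ssub (a b : nat -> R) (n : nat) : R := a n - b n.
Definition sscal (k : R) (a : nat -> R) (n : nat) : R := k * a n.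
Definition delta (k n : nat) : R := if Nat.eqb k n then 1 else 0.

Lemma l1_le_pos c M : l1_le c M -> 0 <= M.
Proof. intros H; exact (H 0%nat). Qed.

Lemma l1_le_le c M M' : l1_le c M -> M <= M' -> l1_le c M'.
Proof. intros H HM N; specialize (H N); lra. Qed.

Lemma l1_le_term c M n : l1_le c M -> Rabs (c n) <= M.
Proof.
intros H. eapply Rle_trans; [|apply (H (S n))].
apply (psum_term (fun n => Rabs (c n))); [intros; apply Rabs_pos|lia].
Qed.

Lemma l1_le_mono a b B : (forall n, Rabs (a n) <= Rabs (b n)) -> l1_le b B -> l1_le a B.
Proof. intros H Hb N. eapply Rle_trans; [apply psum_le; intros; apply H|apply Hb]. Qed.

Lemma l1_le_ext a b B : (forall n, a n = b n) -> l1_le b B -> l1_le a B.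
Proof. intros H. apply l1_le_mono. intros n; rewrite H; lra. Qed.

Lemma l1_le_zero : l1_le (fun _ => 0) 0.
Proof. intros N. rewrite psum_zero; [lra|]. intros; apply Rabs_R0. Qed.

Lemma l1_le_add a b A B : l1_le a A -> l1_le b B -> l1_le (sadd a b) (A + B).
Proof.
intros Ha Hb N. eapply Rle_trans.
- apply psum_le. intros n _. apply (Rabs_triang (a n) (b n)).
- rewrite psum_plus. specialize (Ha N); specialize (Hb N); lra.
Qed.

Lemma l1_le_scal k a A : l1_le a A -> l1_le (sscal k a) (Rabs k * A).
Proof.
intros Ha N. unfold sscal. rewrite (psum_ext _ (fun n => Rabs k * Rabs (a n))).
- rewrite psum_scal. apply Rmult_le_compat_l; [apply Rabs_pos|apply Ha].
- intros; apply Rabs_mult.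
Qed.

Lemma l1_le_opp a A : l1_le a A -> l1_le (sscal (-1) a) A.
Proof.
apply l1_le_mono. intros n; unfold sscal. rewrite Rabs_mult, Rabs_left; lra.
Qed.

Lemma l1_le_sub a b A B : l1_le a A -> l1_le b B -> l1_le (ssub a b) (A + B).
Proof.
intros Ha Hb. apply (l1_le_ext _ (sadd a (sscal (-1) b))).
- intros n; unfold ssub, sadd, sscal; ring.
- apply l1_le_add; auto. apply l1_le_opp; auto.
Qed.

Lemma l1_le_lim (u : nat -> nat -> R) (c : nat -> R) M :
  (forall n, is_lim_seq (fun K => u K n) (c n)) -> (forall K, l1_le (u K) M) -> l1_le c M.
Proof.
intros Hu HM N.
apply (is_lim_seq_le (fun K => psum (fun n => Rabs (u K n)) N) (fun _ => M)
         (psum (fun n => Rabs (c n)) N) M).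
- intros K; apply HM.
- apply (psum_lim (fun K n => Rabs (u K n))). intros n.
  apply (is_lim_seq_abs _ (c n) (Hu n)).
- apply is_lim_seq_const.
Qed.

Lemma delta_same k : delta k k = 1.
Proof. unfold delta; rewrite Nat.eqb_refl; auto. Qed.

Lemma delta_neq k n : k <> n -> delta k n = 0.
Proof. intros H; unfold delta; rewrite (proj2 (Nat.eqb_neq _ _) H); auto. Qed.

Lemma psum_delta k (f : nat -> R) N :
  psum (fun n => delta k n * f n) N = if Nat.ltb k N then f k else 0.
Proof.
induction N as [|N IH]; simpl; auto.
rewrite IH. destruct (Nat.eq_dec k N) as [<-|Hk].
- rewrite delta_same, Nat.ltb_irrefl, (proj2 (Nat.ltb_lt k (S k))); [ring|lia].
- rewrite delta_neq by auto. destruct (Nat.ltb_spec k N), (Nat.ltb_spec k (S N)); try lia; ring.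
Qed.

Lemma l1_le_delta k : l1_le (delta k) 1.
Proof.
intros N. rewrite (psum_ext _ (fun n => delta k n * 1)).
- rewrite (psum_delta k (fun _ => 1)). destruct (Nat.ltb k N); lra.
- intros n _. unfold delta; destruct (Nat.eqb k n); rewrite ?Rabs_R1, ?Rabs_R0; ring.
Qed.

Lemma l1_delta k : l1 (delta k).
Proof. eexists; apply l1_le_delta. Qed.

Lemma l1_add a b : l1 a -> l1 b -> l1 (sadd a b).
Proof. intros [A Ha] [B Hb]; eexists; apply l1_le_add; eauto. Qed.

Lemma l1_sub a b : l1 a -> l1 b -> l1 (ssub a b).
Proof. intros [A Ha] [B Hb]; eexists; apply l1_le_sub; eauto. Qed.

Lemma l1_scal k a : l1 a -> l1 (sscal k a).
Proof. intros [A Ha]; eexists; apply l1_le_scal; eauto. Qed.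

Definition total (f : nat -> R) : R := real (Lim_seq (psum f)).

(** f = (f + |f|) - |f|, and both terms have increasing bounded partial sums. *)
Lemma total_lim f : l1 f -> is_lim_seq (psum f) (total f).
Proof.
intros [M HM].
assert (H : forall g, (forall n, 0 <= g n <= 2 * Rabs (f n)) -> ex_finite_lim_seq (psum g)).
{ intros g Hg. apply ex_finite_lim_seq_incr with (2 * M).
  - intros n; simpl. specialize (Hg n). lra.
  - intros n. eapply Rle_trans; [apply psum_le; intros k _; apply Hg|].
    rewrite psum_scal. specialize (HM n). lra. }
apply Lim_seq_correct'.
destruct (H (fun n => f n + Rabs (f n))) as [u H1].
{ intros n. unfold Rabs; destruct (Rcase_abs (f n)); lra. }
destruct (H (fun n => Rabs (f n))) as [v H2].
{ intros n. pose proof (Rabs_pos (f n)); lra. }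
exists (u - v). eapply is_lim_seq_ext; [|apply (is_lim_seq_minus' _ _ _ _ H1 H2)].
intros n; simpl. rewrite psum_plus; ring.
Qed.

Lemma total_unique f (l : R) : is_lim_seq (psum f) l -> total f = l.
Proof. intros H; unfold total; rewrite (is_lim_seq_unique _ _ H); auto. Qed.

Lemma total_add f g : l1 f -> l1 g -> total (sadd f g) = total f + total g.
Proof.
intros Hf Hg. apply total_unique.
eapply is_lim_seq_ext; [|apply (is_lim_seq_plus' _ _ _ _ (total_lim f Hf) (total_lim g Hg))].
intros n; symmetry; apply psum_plus.
Qed.

Lemma total_scal k f : l1 f -> total (sscal k f) = k * total f.
Proof.
intros Hf. apply total_unique.
eapply is_lim_seq_ext; [|apply (is_lim_seq_scal_l _ k _ (total_lim f Hf))].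
intros n; symmetry; apply psum_scal.
Qed.

Lemma total_abs f M : l1_le f M -> Rabs (total f) <= M.
Proof.
intros H.
apply (is_lim_seq_le (fun K => Rabs (psum f K)) (fun _ => M) (Rabs (total f)) M).
- intros n. eapply Rle_trans; [apply psum_abs|apply H].
- apply (is_lim_seq_abs _ (total f)). apply total_lim; eexists; eauto.
- apply is_lim_seq_const.
Qed.

Lemma total_delta k f : total (fun n => delta k n * f n) = f k.
Proof.
apply total_unique.
apply (is_lim_seq_ext_loc (fun _ => f k)); [|apply is_lim_seq_const].
exists (S k). intros n Hn. rewrite psum_delta, (proj2 (Nat.ltb_lt k n)); auto; lia.
Qed.

Lemma l1_le_mult c C psi B :
  l1_le c C -> (forall n, Rabs (psi n) <= B) -> l1_le (fun n => c n * psi n) (B * C).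
Proof.
intros Hc Hp N. apply Rle_trans with (psum (fun n => B * Rabs (c n)) N).
- apply psum_le. intros n _. rewrite Rabs_mult, Rmult_comm.
  apply Rmult_le_compat_r; [apply Rabs_pos|apply Hp].
- rewrite psum_scal. apply Rmult_le_compat_l; [|apply Hc].
  eapply Rle_trans; [apply Rabs_pos|apply (Hp 0%nat)].
Qed.

(** * Bounded linear forms and operators *)

Definition bounded_form (F : (nat -> R) -> R) : Prop :=
  (forall a b, l1 a -> l1 b -> F (sadd a b) = F a + F b) /\
  (forall k a, l1 a -> F (sscal k a) = k * F a) /\
  exists M, forall a A, l1_le a A -> Rabs (F a) <= M * A.

Definition bounded_op (L : (nat -> R) -> nat -> R) : Prop :=
  (forall a b, l1 a -> l1 b -> L (sadd a b) = sadd (L a) (L b)) /\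
  (forall k a, l1 a -> L (sscal k a) = sscal k (L a)) /\
  exists M, forall a A, l1_le a A -> l1_le (L a) (M * A).

Lemma bounded_op_coord L n : bounded_op L -> bounded_form (fun a => L a n).
Proof.
intros [H1 [H2 [M HM]]]. split; [|split].
- intros; rewrite H1; auto.
- intros; rewrite H2; auto.
- exists M; intros; apply l1_le_term; auto.
Qed.

Lemma bounded_form_tot psi B : (forall n, Rabs (psi n) <= B) -> bounded_form (fun c => total (fun n => c n * psi n)).
Proof.
intros Hp.
assert (P : forall a, l1 a -> l1 (fun n => a n * psi n)).
{ intros a [A Ha]; eexists; eapply l1_le_mult; eauto. }
split; [|split].
- intros a b Ha Hb. rewrite <- total_add; auto. f_equal. extensionality n; unfold sadd; ring.
- intros k a Ha. rewrite <- total_scal; auto. f_equal. extensionality n; unfold sscal; ring.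
- exists B. intros a A Ha. apply total_abs. apply l1_le_mult; auto.
Qed.

Definition trunc (N : nat) (c : nat -> R) (n : nat) : R := if Nat.ltb n N then c n else 0.

Lemma l1_le_tail c N C : l1_le c C ->
  l1_le (ssub c (trunc N c)) (total (fun n => Rabs (c n)) - psum (fun n => Rabs (c n)) N).
Proof.
intros Hc K.
assert (H : forall K, psum (fun n => Rabs (ssub c (trunc N c) n)) K
   + psum (fun n => Rabs (c n)) N <= psum (fun n => Rabs (c n)) (N + K)).
{ clear K. induction K as [|K IH]; simpl.
  - rewrite Nat.add_0_r; lra.
  - rewrite Nat.add_succ_r; simpl.
    destruct (Nat.ltb_spec K N) as [L|L].
    + unfold ssub at 2, trunc at 2. rewrite (proj2 (Nat.ltb_lt K N)), Rminus_diag, Rabs_R0 by auto.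
      pose proof (Rabs_pos (c (N + K)%nat)); lra.
    + assert (HN : psum (fun n => Rabs (ssub c (trunc N c) n)) K
         + psum (fun n => Rabs (c n)) N <= psum (fun n => Rabs (c n)) K).
      { clear - L. induction L as [|K L IH]; simpl.
        - rewrite psum_zero; [lra|]. intros n Hn. unfold ssub, trunc.
          rewrite (proj2 (Nat.ltb_lt n N)), Rminus_diag, Rabs_R0; auto.
        - unfold ssub at 2, trunc at 2. rewrite (proj2 (Nat.ltb_ge K N)), Rminus_0_r by auto. lra. }
      unfold ssub at 2, trunc at 2. rewrite (proj2 (Nat.ltb_ge K N)), Rminus_0_r by auto.
      assert (psum (fun n => Rabs (c n)) (S K) <= psum (fun n => Rabs (c n)) (S (N + K))).
      { apply psum_mono; [intros; apply Rabs_pos|lia]. }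
      simpl in *. lra. }
specialize (H K).
assert (psum (fun n => Rabs (c n)) (N + K) <= total (fun n => Rabs (c n))); [|lra].
apply (is_lim_seq_incr_compare (psum (fun n => Rabs (c n)))).
- apply total_lim. exists C. intros J. rewrite (psum_ext _ (fun n => Rabs (c n))); auto.
  intros; apply Rabs_Rabsolu.
- intros n; simpl. pose proof (Rabs_pos (c n)); lra.
Qed.

Lemma l1_le_trunc c N C : l1_le c C -> l1_le (trunc N c) C.
Proof.
apply l1_le_mono. intros n; unfold trunc; destruct (Nat.ltb n N); [lra|].
rewrite Rabs_R0; apply Rabs_pos.
Qed.

(** A bounded form is determined by its values on the unit sequences, since the truncations of c
    converge to c in l^1. *)
Lemma bounded_form_rep F c : bounded_form F -> l1 c ->
  is_lim_seq (psum (fun k => c k * F (delta k))) (F c).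
Proof.
intros [HA [HS [M HM]]] [C HC].
assert (HT : forall N, F (trunc N c) = psum (fun k => c k * F (delta k)) N).
{ induction N as [|N IH]; simpl.
  - replace (trunc 0 c) with (sscal 0 c) by (extensionality n; unfold trunc, sscal; simpl; ring).
    rewrite HS; [ring|eexists; eauto].
  - rewrite <- IH, <- HS, <- HA; auto using l1_scal, l1_delta.
    + f_equal. extensionality n. unfold trunc, sadd, sscal, delta.
      destruct (Nat.eqb_spec N n), (Nat.ltb_spec n N), (Nat.ltb_spec n (S N)); subst; try lia; ring.
    + exists C; apply l1_le_trunc; auto. }
set (t := total (fun n => Rabs (c n))).
assert (Ht : is_lim_seq (psum (fun n => Rabs (c n))) t).
{ apply total_lim. exists C. intros J. rewrite (psum_ext _ (fun n => Rabs (c n))); auto.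
  intros; apply Rabs_Rabsolu. }
assert (HD : forall N, Rabs (F c - F (trunc N c)) <= M * (t - psum (fun n => Rabs (c n)) N)).
{ intros N. replace (F c - F (trunc N c)) with (F (ssub c (trunc N c))).
  - apply HM. apply l1_le_tail with C; auto.
  - assert (E : c = sadd (trunc N c) (ssub c (trunc N c))) by
      (extensionality n; unfold sadd, ssub; ring).
    apply (f_equal F) in E. rewrite E, HA; [ring| |].
    + exists C; apply l1_le_trunc; auto.
    + eexists; apply l1_le_tail with C; auto. }
eapply is_lim_seq_ext; [intros N; apply HT|].
replace (Finite (F c)) with (Finite (F c - 0)) by (f_equal; ring).
apply (is_lim_seq_ext (fun N => F c - (F c - F (trunc N c)))); [intros; ring|].
apply is_lim_seq_minus'; [apply is_lim_seq_const|].
apply is_lim_seq_abs_0.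
apply (is_lim_seq_le_le (fun _ => 0) _ (fun N => M * (t - psum (fun n => Rabs (c n)) N))).
- intros N; split; [apply Rabs_pos|apply HD].
- apply is_lim_seq_const.
- replace (Finite 0) with (Finite (M * (t - t))) by (f_equal; ring).
  apply (is_lim_seq_scal_l _ M (t - t)). apply is_lim_seq_minus'; auto. apply is_lim_seq_const.
Qed.

Lemma bounded_form_eq F G c : bounded_form F -> bounded_form G -> (forall k, F (delta k) = G (delta k)) -> l1 c -> F c = G c.
Proof.
intros HF HG H Hc.
pose proof (bounded_form_rep F c HF Hc) as L1. pose proof (bounded_form_rep G c HG Hc) as L2.
apply is_lim_seq_unique in L2.
rewrite (Lim_seq_ext _ (psum (fun k => c k * F (delta k)))) in L2.
- apply is_lim_seq_unique in L1. rewrite L1 in L2. injection L2; auto.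
- intros N; apply psum_ext; intros; rewrite H; auto.
Qed.

Lemma l1_le_comb (phi : nat -> nat -> R) M c C K :
  (forall k, l1_le (phi k) M) -> l1_le c C ->
  l1_le (fun n => psum (fun k => c k * phi k n) K) (M * C).
Proof.
intros Hp Hc N.
apply Rle_trans with (psum (fun n => psum (fun k => Rabs (c k) * Rabs (phi k n)) K) N).
- apply psum_le; intros n _. eapply Rle_trans; [apply psum_abs|].
  apply psum_le; intros; rewrite Rabs_mult; lra.
- rewrite (psum_exchange (fun k n => Rabs (c k) * Rabs (phi k n))).
  apply Rle_trans with (psum (fun k => M * Rabs (c k)) K).
  + apply psum_le; intros k _. rewrite psum_scal, Rmult_comm.
    apply Rmult_le_compat_r; [apply Rabs_pos|apply Hp].
  + rewrite psum_scal. apply Rmult_le_compat_l; [apply (l1_le_pos _ _ (Hp 0%nat))|apply Hc].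
Qed.

(** In l^1 the operator norm is the largest norm of a column. *)
Lemma bounded_op_columns L th c C :
  bounded_op L -> (forall k, l1_le (L (delta k)) th) -> l1_le c C -> l1_le (L c) (th * C).
Proof.
intros HL Hk Hc.
apply (l1_le_lim (fun K n => psum (fun k => c k * L (delta k) n) K)).
- intros n. apply (bounded_form_rep (fun a => L a n)); [apply bounded_op_coord; auto|eexists; eauto].
- intros K. apply l1_le_comb; auto.
Qed.

(** The linear map that sends the k-th unit sequence to [phi k]. *)
Definition lin_ext (phi : nat -> nat -> R) (c : nat -> R) (n : nat) : R :=
  total (fun k => c k * phi k n).

Lemma lin_ext_l1_le phi M c C : (forall k, l1_le (phi k) M) -> l1_le c C -> l1_le (lin_ext phi c) (M * C).
Proof.
intros Hp Hc.
apply (l1_le_lim (fun K n => psum (fun k => c k * phi k n) K)).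
- intros n. apply (total_lim (fun k => c k * phi k n)). eexists.
  apply l1_le_mult; [eauto|]. intros k. apply l1_le_term. apply Hp.
- intros K. apply l1_le_comb; auto.
Qed.

Lemma lin_ext_add phi M a b : (forall k, l1_le (phi k) M) -> l1 a -> l1 b ->
  lin_ext phi (sadd a b) = sadd (lin_ext phi a) (lin_ext phi b).
Proof.
intros Hp Ha Hb. extensionality n.
apply (bounded_form_tot (fun k => phi k n) M); auto. intros; apply l1_le_term; auto.
Qed.

Lemma lin_ext_scal phi M k a : (forall k, l1_le (phi k) M) -> l1 a ->
  lin_ext phi (sscal k a) = sscal k (lin_ext phi a).
Proof.
intros Hp Ha. extensionality n.
apply (bounded_form_tot (fun k => phi k n) M); auto. intros; apply l1_le_term; auto.
Qed.

Lemma lin_ext_delta phi k : lin_ext phi (delta k) = phi k.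
Proof. extensionality n. apply (total_delta k (fun k => phi k n)). Qed.

Lemma lin_ext_fam_add phi psi M c : (forall k, l1_le (phi k) M) -> (forall k, l1_le (psi k) M) -> l1 c ->
  lin_ext (fun k => sadd (phi k) (psi k)) c = sadd (lin_ext phi c) (lin_ext psi c).
Proof.
intros Hp Hq [C HC]. extensionality n. symmetry. etransitivity; [symmetry; apply total_add|].
- eexists; apply l1_le_mult; [eauto|]. intros k; apply l1_le_term; apply Hp.
- eexists; apply l1_le_mult; [eauto|]. intros k; apply l1_le_term; apply Hq.
- unfold lin_ext; f_equal; extensionality k; unfold sadd; ring.
Qed.

Lemma lin_ext_fam_scal phi M r c : (forall k, l1_le (phi k) M) -> l1 c ->
  lin_ext (fun k => sscal r (phi k)) c = sscal r (lin_ext phi c).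
Proof.
intros Hp [C HC]. extensionality n. symmetry. etransitivity; [symmetry; apply total_scal|].
- eexists; apply l1_le_mult; [eauto|]. intros k; apply l1_le_term; apply Hp.
- unfold lin_ext; f_equal; extensionality k; unfold sscal; ring.
Qed.

Definition bilin_ext (g : nat -> nat -> nat -> R) (a b : nat -> R) : nat -> R :=
  lin_ext (fun i => lin_ext (g i) b) a.
Definition bounded_fam (g : nat -> nat -> nat -> R) (G : R) : Prop := forall i j, l1_le (g i j) G.

Lemma bilin_ext_l1_le g G a b A B : bounded_fam g G -> l1_le a A -> l1_le b B -> l1_le (bilin_ext g a b) (G * B * A).
Proof. intros Hg Ha Hb. apply lin_ext_l1_le; auto. intros i. apply lin_ext_l1_le; auto. Qed.

Lemma bilin_ext_add_l g G a a' b : bounded_fam g G -> l1 a -> l1 a' -> l1 b ->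
  bilin_ext g (sadd a a') b = sadd (bilin_ext g a b) (bilin_ext g a' b).
Proof.
intros Hg Ha Ha' [B Hb]. apply lin_ext_add with (G * B); auto.
intros i; apply lin_ext_l1_le; auto.
Qed.

Lemma bilin_ext_scal_l g G k a b : bounded_fam g G -> l1 a -> l1 b -> bilin_ext g (sscal k a) b = sscal k (bilin_ext g a b).
Proof.
intros Hg Ha [B Hb]. apply lin_ext_scal with (G * B); auto.
intros i; apply lin_ext_l1_le; auto.
Qed.

Lemma bilin_ext_add_r g G a b b' : bounded_fam g G -> l1 a -> l1 b -> l1 b' ->
  bilin_ext g a (sadd b b') = sadd (bilin_ext g a b) (bilin_ext g a b').
Proof.
intros Hg Ha Hb Hb'. unfold bilin_ext.
replace (fun i => lin_ext (g i) (sadd b b')) with (fun i => sadd (lin_ext (g i) b) (lin_ext (g i) b')).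
- destruct Hb as [B Hb], Hb' as [B' Hb'].
  apply lin_ext_fam_add with (G * Rmax B B'); auto; intros i; apply lin_ext_l1_le; auto;
    eapply l1_le_le; eauto using Rmax_l, Rmax_r.
- extensionality i. symmetry. apply lin_ext_add with G; auto.
Qed.

Lemma bilin_ext_scal_r g G k a b : bounded_fam g G -> l1 a -> l1 b -> bilin_ext g a (sscal k b) = sscal k (bilin_ext g a b).
Proof.
intros Hg Ha Hb. unfold bilin_ext.
replace (fun i => lin_ext (g i) (sscal k b)) with (fun i => sscal k (lin_ext (g i) b)).
- destruct Hb as [B Hb].
  apply lin_ext_fam_scal with (G * B); auto; intros i; apply lin_ext_l1_le; auto.
- extensionality i. symmetry. apply lin_ext_scal with G; auto.
Qed.

Lemma bilin_ext_delta g i j : bilin_ext g (delta i) (delta j) = g i j.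
Proof. unfold bilin_ext. rewrite lin_ext_delta, lin_ext_delta. reflexivity. Qed.

Lemma bilin_ext_fam_sub g g' G a b : bounded_fam g G -> bounded_fam g' G -> l1 a -> l1 b ->
  bilin_ext (fun i j => ssub (g i j) (g' i j)) a b = ssub (bilin_ext g a b) (bilin_ext g' a b).
Proof.
intros Hg Hg' Ha Hb. pose proof Hb as [B HB].
assert (E : forall u v, ssub u v = sadd u (sscal (-1) v)).
{ intros; extensionality n; unfold ssub, sadd, sscal; ring. }
unfold bilin_ext.
replace (fun i => lin_ext (fun j => ssub (g i j) (g' i j)) b)
  with (fun i => sadd (lin_ext (g i) b) (sscal (-1) (lin_ext (g' i) b))).
- rewrite E. rewrite (lin_ext_fam_add _ _ (G * B)); auto.
  + f_equal. apply lin_ext_fam_scal with (G * B); auto. intros; apply lin_ext_l1_le; auto.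
  + intros; apply lin_ext_l1_le; auto.
  + intros; apply l1_le_opp, lin_ext_l1_le; auto.
- extensionality i. rewrite <- (lin_ext_fam_scal _ G) by auto.
  rewrite <- (lin_ext_fam_add _ _ G) by (intros; auto; apply l1_le_opp; auto).
  f_equal. extensionality j. symmetry; apply E.
Qed.

Lemma bounded_op_bil_l g G b : bounded_fam g G -> l1 b -> bounded_op (fun a => bilin_ext g a b).
Proof.
intros Hg Hb. split; [|split].
- intros; eapply bilin_ext_add_l; eauto.
- intros; eapply bilin_ext_scal_l; eauto.
- destruct Hb as [B Hb]. exists (G * B). intros; apply bilin_ext_l1_le; auto.
Qed.

Lemma bounded_op_bil_r g G a : bounded_fam g G -> l1 a -> bounded_op (bilin_ext g a).
Proof.
intros Hg Ha. split; [|split].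
- intros; eapply bilin_ext_add_r; eauto.
- intros; eapply bilin_ext_scal_r; eauto.
- destruct Ha as [A Ha]. exists (G * A). intros b B Hb.
  replace (G * A * B) with (G * B * A) by ring. apply bilin_ext_l1_le; auto.
Qed.

Lemma bounded_op_add L L' : bounded_op L -> bounded_op L' -> bounded_op (fun a => sadd (L a) (L' a)).
Proof.
intros [A1 [S1 [M1 N1]]] [A2 [S2 [M2 N2]]]. split; [|split].
- intros. rewrite A1, A2 by auto. extensionality n; unfold sadd; ring.
- intros. rewrite S1, S2 by auto. extensionality n; unfold sadd, sscal; ring.
- exists (M1 + M2). intros. rewrite Rmult_plus_distr_r. apply l1_le_add; auto.
Qed.

Lemma bounded_op_scal k L : bounded_op L -> bounded_op (fun a => sscal k (L a)).
Proof.
intros [A1 [S1 [M1 N1]]]. split; [|split].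
- intros. rewrite A1 by auto. extensionality n; unfold sadd, sscal; ring.
- intros. rewrite S1 by auto. extensionality n; unfold sscal; ring.
- exists (Rabs k * M1). intros. rewrite Rmult_assoc. apply l1_le_scal; auto.
Qed.

Lemma bounded_op_l1 L a : bounded_op L -> l1 a -> l1 (L a).
Proof. intros [_ [_ [M HM]]] [A Ha]. eexists; eauto. Qed.

Lemma bounded_op_comp L L' : bounded_op L -> bounded_op L' -> bounded_op (fun a => L (L' a)).
Proof.
intros HL HL'. pose proof (fun a => bounded_op_l1 L' a HL') as P.
destruct HL as [A1 [S1 [M1 N1]]]. destruct HL' as [A2 [S2 [M2 N2]]]. split; [|split].
- intros. rewrite A2, A1 by auto. auto.
- intros. rewrite S2, S1 by auto. auto.
- exists (M1 * M2). intros. rewrite Rmult_assoc. auto.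
Qed.

Lemma bounded_op_rank1 k w : l1 w -> bounded_op (fun a => sscal (a k) w).
Proof.
intros [W HW]. split; [|split].
- intros; extensionality n; unfold sadd, sscal; ring.
- intros; extensionality n; unfold sscal; ring.
- exists W. intros a A Ha. eapply l1_le_le; [apply l1_le_scal, HW|].
  rewrite Rmult_comm. apply Rmult_le_compat_l; [eapply l1_le_pos; eauto|]. apply l1_le_term; auto.
Qed.

Lemma bounded_op_diag g B : (forall n, Rabs (g n) <= B) -> bounded_op (fun a n => a n * g n).
Proof.
intros Hg. split; [|split].
- intros; extensionality n; unfold sadd; ring.
- intros; extensionality n; unfold sscal; ring.
- exists B. intros a A Ha. apply l1_le_mult; auto.
Qed.

Lemma bounded_op_sum (w : nat -> nat -> R) K : (forall k, (k < K)%nat -> l1 (w k)) ->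
  bounded_op (fun a n => psum (fun k => a k * w k n) K).
Proof.
induction K as [|K IH]; intros Hw.
- split; [|split].
  + intros; extensionality n; unfold sadd; simpl; ring.
  + intros; extensionality n; unfold sscal; simpl; ring.
  + exists 0. intros a A Ha. rewrite Rmult_0_l. apply l1_le_zero.
- apply (bounded_op_add _ _ (IH (fun k Hk => Hw k (Nat.lt_lt_succ_r _ _ Hk)))
           (bounded_op_rank1 K (w K) (Hw K (Nat.lt_succ_diag_r K)))).
Qed.

(** * Contractions *)

Lemma le_of_geom a b th c : 0 <= th < 1 -> (forall k, a <= b + c * th ^ k) -> a <= b.
Proof.
intros Ht H.
apply (is_lim_seq_le (fun _ => a) (fun k => b + c * th ^ k) a b); auto.
- apply is_lim_seq_const.
- replace (Finite b) with (Finite (b + c * 0)) by (f_equal; ring).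
  apply is_lim_seq_plus'; [apply is_lim_seq_const|].
  apply (is_lim_seq_scal_l _ c 0). apply is_lim_seq_geom.
  rewrite Rabs_pos_eq; lra.
Qed.

Definition seq0 (n : nat) : R := 0.

Fixpoint iterate (T : (nat -> R) -> nat -> R) (k : nat) : nat -> R :=
  match k with O => seq0 | S k => T (iterate T k) end.

(** The limit of the iterates is named explicitly so that the zeros form a function of the parameter
    without an appeal to choice. *)
Definition fixpt (T : (nat -> R) -> nat -> R) (n : nat) : R :=
  real (Lim_seq (fun k => iterate T k n)).

Definition contraction (T : (nat -> R) -> nat -> R) (th r : R) : Prop :=
  forall y y' C, l1_le y r -> l1_le y' r -> l1_le (ssub y y') C -> l1_le (ssub (T y) (T y')) (th * C).

Lemma fixpt_spec T th r : 0 <= th < 1 -> 0 <= r -> contraction T th r ->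
  l1_le (T seq0) ((1 - th) * r) -> l1_le (fixpt T) r /\ T (fixpt T) = fixpt T.
Proof.
intros Ht Hr HT H0.
assert (HZ : l1_le seq0 r) by (eapply l1_le_le; [apply l1_le_zero|lra]).
assert (HB : forall k, l1_le (iterate T k) r).
{ induction k as [|k IH]; simpl; auto.
  apply (l1_le_ext _ (sadd (ssub (T (iterate T k)) (T seq0)) (T seq0))).
  { intros n; unfold sadd, ssub; ring. }
  replace r with (th * r + (1 - th) * r) by ring.
  apply l1_le_add; auto. apply HT; auto.
  apply (l1_le_ext _ (iterate T k)); auto. intros n; unfold ssub, seq0; ring. }
assert (HC : forall k j, l1_le (ssub (iterate T (k + j)) (iterate T k)) (2 * r * th ^ k)).
{ induction k as [|k IH]; intros j; simpl.
  - replace (2 * r * 1) with (r + r) by ring. apply l1_le_sub; auto.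
  - replace (2 * r * (th * th ^ k)) with (th * (2 * r * th ^ k)) by ring. apply HT; auto. }
assert (HL : forall n, is_lim_seq (fun k => iterate T k n) (fixpt T n)).
{ intros n. apply Lim_seq_correct'. apply ex_lim_seq_cauchy_corr.
  intros eps.
  destruct (pow_lt_1_zero th (ltac:(rewrite Rabs_pos_eq; lra)) (eps / (2 * (2 * r + 1)))
    (ltac:(apply Rdiv_lt_0_compat; [apply cond_pos|lra]))) as [K HK].
  exists K.
  assert (HA : forall a, (K <= a)%nat -> Rabs (iterate T a n - iterate T K n) < eps / 2).
  { intros a Ha. replace a with (K + (a - K))%nat by lia.
    eapply Rle_lt_trans; [apply (l1_le_term _ _ n (HC K (a - K)%nat))|].
    specialize (HK K (le_n K)).
    assert (H1 : th ^ K < eps / (2 * (2 * r + 1))).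
    { eapply Rle_lt_trans; [apply Rle_abs|exact HK]. }
    assert (H2 : 0 <= th ^ K) by (apply pow_le; lra).
    apply (Rmult_lt_compat_l (2 * r + 1)) in H1; [|lra].
    replace ((2 * r + 1) * (eps / (2 * (2 * r + 1)))) with (eps / 2) in H1 by (field; lra).
    lra. }
  intros a b Ha Hb. pose proof (HA a Ha). pose proof (HA b Hb).
  replace (iterate T a n - iterate T b n) with
    ((iterate T a n - iterate T K n) - (iterate T b n - iterate T K n)) by ring.
  eapply Rle_lt_trans; [apply Rabs_triang|]. rewrite Rabs_Ropp. lra. }
assert (HF : l1_le (fixpt T) r) by (apply (l1_le_lim (iterate T)); auto).
split; auto.
assert (HD : forall k, l1_le (ssub (fixpt T) (iterate T k)) (2 * r * th ^ k)).
{ intros k. apply (l1_le_lim (fun j => ssub (iterate T (k + j)) (iterate T k))); auto.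
  intros n. unfold ssub. apply is_lim_seq_minus'; [|apply is_lim_seq_const].
  apply (is_lim_seq_ext (fun j => iterate T (j + k) n)).
  - intros j; rewrite Nat.add_comm; auto.
  - apply is_lim_seq_incr_n with (u := fun k => iterate T k n). apply HL. }
extensionality n. apply Rminus_diag_uniq.
assert (HE : Rabs (T (fixpt T) n - fixpt T n) <= 0); [|apply Rabs_le_between in HE; lra].
apply le_of_geom with th (4 * r); auto. intros k.
pose proof (l1_le_term _ _ n (HT _ _ _ HF (HB k) (HD k))) as H1.
pose proof (l1_le_term _ _ n (HD (S k))) as H2. unfold ssub in H1, H2. simpl in H2.
replace (T (fixpt T) n - fixpt T n) with
  ((T (fixpt T) n - T (iterate T k) n) - (fixpt T n - T (iterate T k) n)) by ring.
eapply Rle_trans; [apply Rabs_triang|]. rewrite Rabs_Ropp.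
assert (0 <= th ^ k) by (apply pow_le; lra). assert (th * th ^ k <= th ^ k) by nra.
nra.
Qed.

(** The distance M of the fixed points satisfies M <= th M + c; iterate this. *)
Lemma fixpt_close T T' th r c : 0 <= th < 1 -> 0 <= r -> contraction T th r ->
  l1_le (fixpt T) r -> T (fixpt T) = fixpt T ->
  l1_le (fixpt T') r -> T' (fixpt T') = fixpt T' ->
  (forall y, l1_le y r -> l1_le (ssub (T y) (T' y)) c) ->
  l1_le (ssub (fixpt T) (fixpt T')) (c / (1 - th)).
Proof.
intros Ht Hr HT B1 F1 B2 F2 Hc.
set (d := ssub (fixpt T) (fixpt T')).
assert (HS : forall M, l1_le d M -> l1_le d (th * M + c)).
{ intros M HM. unfold d. rewrite <- F1 at 1. rewrite <- F2 at 1.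
  apply (l1_le_ext _ (sadd (ssub (T (fixpt T)) (T (fixpt T'))) (ssub (T (fixpt T')) (T' (fixpt T'))))).
  - intros n; unfold sadd, ssub; ring.
  - apply l1_le_add; auto. }
assert (HK : forall k, l1_le d (c / (1 - th) + (2 * r - c / (1 - th)) * th ^ k)).
{ induction k as [|k IH].
  - eapply l1_le_le; [apply l1_le_sub; eauto|]. simpl; lra.
  - eapply l1_le_le; [apply HS, IH|]. simpl. right. field. lra. }
intros N. apply le_of_geom with th (2 * r - c / (1 - th)); auto. intros k. apply HK.
Qed.

(** * The deformed product of cosine series *)

Definition gap (a b : nat) : nat := (a - b) + (b - a).
(** Index 2k carries the real part and 2k+1 the imaginary part of the coefficient of the k-th
    cosine; this tests whether m divides k. *)
Definition in_class (m j : nat) : bool := Nat.eqb (Nat.modulo (Nat.div2 j) m) 0.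
(** With b + s w in mind: an off-class coefficient carries a factor s, so a product of modes i and j that
    lands in mode n has to be multiplied by amp i * amp j / amp n, see [rho_amp]. *)
Definition rho (m : nat) (s : R) (i j n : nat) : R :=
  if in_class m i || in_class m j then 1 else if in_class m n then s * s else s.
Definition parity (i j : nat) : nat := Nat.b2n (xorb (Nat.odd i) (Nat.odd j)).
Definition half_sign (i j : nat) : R := if Nat.odd i && Nat.odd j then - / 2 else / 2.
Definition mode_sum (i j : nat) : nat := 2 * (Nat.div2 i + Nat.div2 j) + parity i j.
Definition mode_gap (i j : nat) : nat := 2 * gap (Nat.div2 i) (Nat.div2 j) + parity i j.
(** cos a cos b = (cos (a+b) + cos (a-b)) / 2, times i * i = -1 for two imaginary indices.  At s = 0 this is
    the product of dual numbers b + w with w w = 0. *)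
Definition basis_prod (m : nat) (s : R) (i j : nat) : nat -> R :=
  sadd (sscal (half_sign i j * rho m s i j (mode_sum i j)) (delta (mode_sum i j)))
      (sscal (half_sign i j * rho m s i j (mode_gap i j)) (delta (mode_gap i j))).

Lemma half_sign_abs i j : Rabs (half_sign i j) = / 2.
Proof. unfold half_sign; destruct (_ && _); [rewrite Rabs_Ropp|]; apply Rabs_pos_eq; lra. Qed.

Lemma rho_abs m s i j n : 0 <= s <= 1 -> Rabs (rho m s i j n) <= 1.
Proof.
intros Hs. unfold rho. destruct (_ || _); [rewrite Rabs_R1; lra|].
destruct (in_class m n); rewrite Rabs_pos_eq; nra.
Qed.

Lemma rho_diff m s i j n : 0 <= s <= 1 -> Rabs (rho m s i j n - rho m 0 i j n) <= s.
Proof.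
intros Hs. unfold rho. destruct (_ || _); [rewrite Rminus_diag, Rabs_R0; lra|].
destruct (in_class m n); rewrite Rabs_pos_eq; nra.
Qed.

Lemma l1_le_two u v c d n k : Rabs u <= c -> Rabs v <= d ->
  l1_le (sadd (sscal u (delta n)) (sscal v (delta k))) (c + d).
Proof.
intros Hu Hv. apply l1_le_add; (eapply l1_le_le; [apply l1_le_scal, l1_le_delta|lra]).
Qed.

Lemma basis_prod_fam m s : 0 <= s <= 1 -> bounded_fam (basis_prod m s) 1.
Proof.
intros Hs i j. replace 1 with (/2 + /2) by lra.
apply l1_le_two; rewrite Rabs_mult, half_sign_abs;
  match goal with |- _ * Rabs (rho ?m ?s ?i ?j ?n) <= _ => pose proof (rho_abs m s i j n Hs) end; lra.
Qed.

(** The deformation is of first order in s, uniformly in the modes. *)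
Lemma basis_prod_diff m s : 0 <= s <= 1 -> bounded_fam (fun i j => ssub (basis_prod m s i j) (basis_prod m 0 i j)) s.
Proof.
intros Hs i j. set (n := mode_sum i j). set (k := mode_gap i j).
apply (l1_le_ext _ (sadd (sscal (half_sign i j * (rho m s i j n - rho m 0 i j n)) (delta n))
  (sscal (half_sign i j * (rho m s i j k - rho m 0 i j k)) (delta k)))).
{ intros l. unfold ssub, basis_prod, sadd, sscal. fold n k. ring. }
apply l1_le_le with (s / 2 + s / 2); [|lra].
apply l1_le_two; rewrite Rabs_mult, half_sign_abs;
  match goal with |- _ * Rabs (rho ?m ?s ?i ?j ?n - _) <= _ => pose proof (rho_diff m s i j n Hs) end; lra.
Qed.

Definition dprod (m : nat) (s : R) : (nat -> R) -> (nat -> R) -> nat -> R := bilin_ext (basis_prod m s).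
Definition sconj (a : nat -> R) (n : nat) : R := if Nat.odd n then - a n else a n.
(** For a = b = c these are the coefficients of |a|^2 a. *)
Definition cubic (m : nat) (s : R) (a b c : nat -> R) : nat -> R := dprod m s (dprod m s a b) (sconj c).

Lemma dprod_l1_le m s a b A B : 0 <= s <= 1 -> l1_le a A -> l1_le b B -> l1_le (dprod m s a b) (A * B).
Proof.
intros Hs Ha Hb. replace (A * B) with (1 * B * A) by ring.
apply bilin_ext_l1_le; auto. apply basis_prod_fam; auto.
Qed.

Lemma sconj_l1_le c C : l1_le c C -> l1_le (sconj c) C.
Proof.
apply l1_le_mono. intros n; unfold sconj; destruct (Nat.odd n); rewrite ?Rabs_Ropp; lra.
Qed.

Lemma sconj_add a b : sconj (sadd a b) = sadd (sconj a) (sconj b).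
Proof. extensionality n; unfold sconj, sadd; destruct (Nat.odd n); ring. Qed.

Lemma sconj_scal k a : sconj (sscal k a) = sscal k (sconj a).
Proof. extensionality n; unfold sconj, sscal; destruct (Nat.odd n); ring. Qed.

Lemma sconj_sub a b : sconj (ssub a b) = ssub (sconj a) (sconj b).
Proof. extensionality n; unfold sconj, ssub; destruct (Nat.odd n); ring. Qed.

Lemma sconj_l1 c : l1 c -> l1 (sconj c).
Proof. intros [C HC]; eexists; apply sconj_l1_le; eauto. Qed.

Lemma bounded_op_cj : bounded_op sconj.
Proof.
split; [|split]; intros; auto using sconj_add, sconj_scal.
exists 1; intros. rewrite Rmult_1_l. apply sconj_l1_le; auto.
Qed.

Lemma dprod_l1 m s a b : 0 <= s <= 1 -> l1 a -> l1 b -> l1 (dprod m s a b).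
Proof. intros Hs [A Ha] [B Hb]; eexists; apply dprod_l1_le; eauto. Qed.

Lemma dprod_add_l m s a a' b : 0 <= s <= 1 -> l1 a -> l1 a' -> l1 b ->
  dprod m s (sadd a a') b = sadd (dprod m s a b) (dprod m s a' b).
Proof. intros; apply bilin_ext_add_l with 1; auto using basis_prod_fam. Qed.

Lemma dprod_add_r m s a b b' : 0 <= s <= 1 -> l1 a -> l1 b -> l1 b' ->
  dprod m s a (sadd b b') = sadd (dprod m s a b) (dprod m s a b').
Proof. intros; apply bilin_ext_add_r with 1; auto using basis_prod_fam. Qed.

Lemma bounded_op_prd_l m s b : 0 <= s <= 1 -> l1 b -> bounded_op (fun a => dprod m s a b).
Proof. intros; apply bounded_op_bil_l with 1; auto using basis_prod_fam. Qed.

Lemma bounded_op_prd_r m s a : 0 <= s <= 1 -> l1 a -> bounded_op (dprod m s a).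
Proof. intros; apply bounded_op_bil_r with 1; auto using basis_prod_fam. Qed.

(** The terms come from changing the product, the first and the second factor one at a time. *)
Lemma dprod_diff m s a a' b b' A B al be : 0 <= s <= 1 ->
  l1_le a A -> l1_le a' A -> l1_le b B -> l1_le b' B -> l1_le (ssub a a') al -> l1_le (ssub b b') be ->
  l1_le (ssub (dprod m s a b) (dprod m 0 a' b')) (s * (A * B) + al * B + A * be).
Proof.
intros Hs Ha Ha' Hb Hb' Hal Hbe.
assert (H0 : 0 <= 0 <= 1) by lra.
apply (l1_le_ext _ (sadd (sadd (bilin_ext (fun i j => ssub (basis_prod m s i j) (basis_prod m 0 i j)) a b)
  (dprod m 0 (ssub a a') b)) (dprod m 0 a' (ssub b b')))).
- intros n. rewrite (bilin_ext_fam_sub _ _ 1); auto using basis_prod_fam; try (eexists; eauto; fail).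
  fold (dprod m s) (dprod m 0).
  assert (E1 : dprod m 0 a b = sadd (dprod m 0 (ssub a a') b) (dprod m 0 a' b)).
  { rewrite <- dprod_add_l; auto; try (eexists; eauto; fail). f_equal.
    extensionality k; unfold sadd, ssub; ring. }
  assert (E2 : dprod m 0 a' b = sadd (dprod m 0 a' (ssub b b')) (dprod m 0 a' b')).
  { rewrite <- dprod_add_r; auto; try (eexists; eauto; fail). f_equal.
    extensionality k; unfold sadd, ssub; ring. }
  rewrite E1, E2. unfold sadd, ssub. ring.
- apply l1_le_add; [apply l1_le_add|]; auto using dprod_l1_le.
  replace (s * (A * B)) with (s * B * A) by ring. apply bilin_ext_l1_le; auto using basis_prod_diff.
Qed.

Lemma cubic_l1_le m s a b c A B C : 0 <= s <= 1 -> l1_le a A -> l1_le b B -> l1_le c C ->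
  l1_le (cubic m s a b c) (A * B * C).
Proof. intros; apply dprod_l1_le; auto using dprod_l1_le, sconj_l1_le. Qed.

Lemma cubic_diff m s a a' b b' c c' A B C al be ga : 0 <= s <= 1 ->
  l1_le a A -> l1_le a' A -> l1_le b B -> l1_le b' B -> l1_le c C -> l1_le c' C ->
  l1_le (ssub a a') al -> l1_le (ssub b b') be -> l1_le (ssub c c') ga ->
  l1_le (ssub (cubic m s a b c) (cubic m 0 a' b' c'))
      (2 * s * (A * B * C) + al * B * C + A * be * C + A * B * ga).
Proof.
intros Hs Ha Ha' Hb Hb' Hc Hc' Hal Hbe Hga. assert (0 <= 0 <= 1) by lra.
eapply l1_le_le; [apply (dprod_diff m s _ _ _ _ (A * B) C); auto using dprod_l1_le, sconj_l1_le|].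
- apply dprod_diff; eauto.
- rewrite <- sconj_sub. apply sconj_l1_le; eauto.
- right; ring.
Qed.

Lemma cubic_add1 m s a a' b c : 0 <= s <= 1 -> l1 a -> l1 a' -> l1 b -> l1 c ->
  cubic m s (sadd a a') b c = sadd (cubic m s a b c) (cubic m s a' b c).
Proof. intros. unfold cubic. rewrite dprod_add_l, dprod_add_l; auto using dprod_l1, sconj_l1. Qed.

Lemma cubic_add2 m s a b b' c : 0 <= s <= 1 -> l1 a -> l1 b -> l1 b' -> l1 c ->
  cubic m s a (sadd b b') c = sadd (cubic m s a b c) (cubic m s a b' c).
Proof. intros. unfold cubic. rewrite dprod_add_r, dprod_add_l; auto using dprod_l1, sconj_l1. Qed.

Lemma cubic_add3 m s a b c c' : 0 <= s <= 1 -> l1 a -> l1 b -> l1 c -> l1 c' ->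
  cubic m s a b (sadd c c') = sadd (cubic m s a b c) (cubic m s a b c').
Proof. intros. unfold cubic. rewrite sconj_add, dprod_add_r; auto using dprod_l1, sconj_l1. Qed.

Lemma bounded_op_tri1 m s b c : 0 <= s <= 1 -> l1 b -> l1 c -> bounded_op (fun a => cubic m s a b c).
Proof.
intros. apply (bounded_op_comp (fun u => dprod m s u (sconj c)) (fun a => dprod m s a b));
  auto using bounded_op_prd_l, sconj_l1.
Qed.

Lemma bounded_op_tri2 m s a c : 0 <= s <= 1 -> l1 a -> l1 c -> bounded_op (fun b => cubic m s a b c).
Proof.
intros. apply (bounded_op_comp (fun u => dprod m s u (sconj c)) (dprod m s a));
  auto using bounded_op_prd_l, bounded_op_prd_r, sconj_l1.
Qed.

Lemma bounded_op_tri3 m s a b : 0 <= s <= 1 -> l1 a -> l1 b -> bounded_op (cubic m s a b).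
Proof.
intros. apply (bounded_op_comp (dprod m s (dprod m s a b)) sconj); auto using bounded_op_prd_r, dprod_l1, bounded_op_cj.
Qed.

(** * Newton's method *)

(** [ord] is m = q / p and [disp] is d p^2, the dispersion in the variable p t.  [zcol] and [xcol] are the
    columns of an approximate inverse of the derivative at (zbar, xbar) for s = 0, on the first [dim]
    indices; the answer to a right-hand side consists of a change of zeta and a change of x. *)
Record newton_data := Newton_data {
  ord : nat; disp : R;
  zbar : R; xbar : nat -> R;
  dim : nat; zcol : nat -> R; xcol : nat -> nat -> R }.

(** Both indices of a cosine have its frequency. *)
Definition freq (n : nat) : R := INR (Nat.div2 n).

(** The equation in terms of coefficients; [dprod m s (delta 1)] is multiplication by i. *)
Definition residual (P : newton_data) (s z : R) (x : nat -> R) (n : nat) : R :=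
  - disp P * freq n ^ 2 * x n + dprod (ord P) s (delta 1) x n - z * x n
  + cubic (ord P) s x x x n - 1.6 * delta 1 n.

(** The inverse of the second derivative, used beyond the first [dim] indices. *)
Definition xtail (P : newton_data) (n : nat) : R :=
  if Nat.ltb n (dim P) then 0 else - / (disp P * freq n ^ 2).
Definition xop (P : newton_data) (y : nat -> R) (n : nat) : R :=
  psum (fun k => y k * xcol P k n) (dim P) + y n * xtail P n.
Definition zop (P : newton_data) (y : nat -> R) : R :=
  psum (fun k => y k * zcol P k) (dim P).
Definition xof (P : newton_data) (y : nat -> R) : nat -> R := sadd (xbar P) (xop P y).
Definition zof (P : newton_data) (y : nat -> R) : R := zbar P + zop P y.

Definition newton_map (P : newton_data) (s : R) (y : nat -> R) : nat -> R :=
  ssub y (residual P s (zof P y) (xof P y)).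

Definition dcubic (P : newton_data) (h : nat -> R) : nat -> R :=
  let m := ord P in let x := xbar P in
  sadd (sadd (cubic m 0 h x x) (cubic m 0 x h x)) (cubic m 0 x x h).
(** For high frequencies the second derivative cancels its inverse, so this operator has finite rank
    although the second derivative is unbounded. *)
Definition lap_defect (P : newton_data) (h : nat -> R) (n : nat) : R :=
  h n + disp P * freq n ^ 2 * xop P h n.
(** The derivative of [newton_map] at y = 0 and s = 0: identity minus derivative of the residual
    times approximate inverse. *)
Definition defect (P : newton_data) (h : nat -> R) (n : nat) : R :=
  lap_defect P h n - dprod (ord P) 0 (delta 1) (xop P h) n
  + zbar P * xop P h n + zop P h * xbar P n - dcubic P (xop P h) n.

(** [th0] bounds the derivative of the Newton map at the centre, [th] is a Lipschitz constant on the
    ball of radius r at s = 0, and [e0] the residual of the approximate zero.  The inequalities [nb_th0] and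
    [nb_e0] are strict, which leaves room for small s > 0. *)
Record newton_bounds (P : newton_data) (X al th0 th e0 r : R) : Prop := {
  nb_ord : (1 <= ord P)%nat;
  nb_disp : 0 < disp P;
  nb_dim : (2 <= dim P)%nat;
  nb_supp : exists S, forall n, (S <= n)%nat -> xbar P n = 0 /\ forall k, xcol P k n = 0;
  nb_x : l1_le (xbar P) X;
  nb_col : forall k, (k < dim P)%nat -> l1_le (xcol P k) al /\ Rabs (zcol P k) <= al;
  nb_tail : forall n, Rabs (xtail P n) <= al;
  nb_defect : forall k, l1_le (defect P (delta k)) th0;
  nb_res : l1_le (residual P 0 (zbar P) (xbar P)) e0;
  nb_r : 0 < r;
  nb_th0 : th0 + 2 * al * (al * r) + 6 * (al * r) * (X + al * r) * al < th;
  nb_th : th < 1;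
  nb_e0 : e0 < (1 - th) * r }.

Lemma l1_le_finsupp c S : (forall n, (S <= n)%nat -> c n = 0) -> l1 c.
Proof.
intros H. exists (psum (fun n => Rabs (c n)) S). intros N.
destruct (Nat.le_ge_cases N S) as [L|L].
- apply psum_mono; auto; intros; apply Rabs_pos.
- right. induction L as [|N L IH]; auto. simpl. rewrite IH, H, Rabs_R0 by auto. ring.
Qed.

Lemma bounded_op_dtri P : l1 (xbar P) -> bounded_op (dcubic P).
Proof.
intros Hx. assert (H0 : 0 <= 0 <= 1) by lra.
apply (bounded_op_add (fun h => sadd (cubic (ord P) 0 h (xbar P) (xbar P)) (cubic (ord P) 0 (xbar P) h (xbar P))));
  [|apply bounded_op_tri3; auto].
apply (bounded_op_add (fun h => cubic (ord P) 0 h (xbar P) (xbar P))); auto using bounded_op_tri1, bounded_op_tri2.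
Qed.

Section Bounds.
Context (P : newton_data) (X al th0 th e0 r : R) (HP : newton_bounds P X al th0 th e0 r).

Lemma l1_xcol k : l1 (xcol P k).
Proof. destruct (nb_supp _ _ _ _ _ _ _ HP) as [S HS]. apply l1_le_finsupp with S. intros; apply HS; auto. Qed.

Lemma l1_xbar : l1 (xbar P).
Proof. eexists; apply HP. Qed.

Lemma bounded_op_xop : bounded_op (xop P).
Proof.
apply (bounded_op_add (fun y n => psum (fun k => y k * xcol P k n) (dim P))
  (fun y n => y n * xtail P n)).
- apply bounded_op_sum. intros; apply l1_xcol.
- apply bounded_op_diag with al. apply HP.
Qed.

Lemma xop_delta k n : xop P (delta k) n = if Nat.ltb k (dim P) then xcol P k n else xtail P k * delta k n.
Proof.
unfold xop. rewrite (psum_delta k (fun j => xcol P j n)).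
destruct (Nat.ltb_spec k (dim P)) as [L|L].
- destruct (Nat.eq_dec k n) as [<-|E]; [|rewrite (delta_neq k n E); ring].
  unfold xtail. rewrite (proj2 (Nat.ltb_lt k (dim P))) by auto; ring.
- destruct (Nat.eq_dec k n) as [<-|E]; [ring|]. rewrite (delta_neq k n E); ring.
Qed.

Lemma xop_l1_le h H : l1_le h H -> l1_le (xop P h) (al * H).
Proof.
apply bounded_op_columns; [apply bounded_op_xop|]. intros k.
destruct (Nat.ltb_spec k (dim P)) as [L|L].
- apply (l1_le_ext _ (xcol P k)); [|apply HP; auto].
  intros n; rewrite xop_delta, (proj2 (Nat.ltb_lt _ _)); auto.
- apply (l1_le_ext _ (sscal (xtail P k) (delta k))).
  + intros n; rewrite xop_delta, (proj2 (Nat.ltb_ge _ _)); auto.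
  + eapply l1_le_le; [apply l1_le_scal, l1_le_delta|]. rewrite Rmult_1_r. apply HP.
Qed.

Lemma zop_abs h H : l1_le h H -> Rabs (zop P h) <= al * H.
Proof.
intros Hh. eapply Rle_trans; [apply psum_abs|].
apply Rle_trans with (psum (fun k => al * Rabs (h k)) (dim P)).
- apply psum_le. intros k Hk. rewrite Rabs_mult, Rmult_comm.
  apply Rmult_le_compat_r; [apply Rabs_pos|]. apply HP; auto.
- rewrite psum_scal. apply Rmult_le_compat_l; [|apply Hh].
  eapply Rle_trans; [apply Rabs_pos|apply (nb_tail _ _ _ _ _ _ _ HP 0%nat)].
Qed.

Lemma zop_lin u v : zop P (ssub u v) = zop P u - zop P v.
Proof.
unfold zop. rewrite (psum_ext _ (fun k => u k * zcol P k + (-1) * (v k * zcol P k)))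
  by (intros; unfold ssub; ring).
rewrite psum_plus, psum_scal; ring.
Qed.

Lemma xop_lin u v : xop P (ssub u v) = ssub (xop P u) (xop P v).
Proof.
extensionality n. unfold xop, ssub.
rewrite (psum_ext _ (fun k => u k * xcol P k n + (-1) * (v k * xcol P k n)))
  by (intros; ring).
rewrite psum_plus, psum_scal; ring.
Qed.

Lemma bounded_op_lap_defect : bounded_op (lap_defect P).
Proof.
replace (lap_defect P) with (fun (h : nat -> R) => sadd
  (fun n => psum (fun k => h k * (disp P * freq n ^ 2 * xcol P k n)) (dim P))
  (fun n => h n * (if Nat.ltb n (dim P) then 1 else 0))).
- apply bounded_op_add.
  + apply (bounded_op_sum (fun k n => disp P * freq n ^ 2 * xcol P k n)). intros k _.
    destruct (nb_supp _ _ _ _ _ _ _ HP) as [S HS]. apply l1_le_finsupp with S.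
    intros n Hn. destruct (HS n Hn) as [_ E]. rewrite E; ring.
  + apply bounded_op_diag with 1. intros n. destruct (Nat.ltb n (dim P)); rewrite ?Rabs_R0, ?Rabs_R1; lra.
- extensionality h; extensionality n. unfold sadd, lap_defect, xop, xtail.
  rewrite (psum_ext _ (fun k => disp P * freq n ^ 2 * (h k * xcol P k n))) by (intros; ring).
  rewrite psum_scal. destruct (Nat.ltb_spec n (dim P)) as [L|L]; [ring|].
  pose proof (nb_disp _ _ _ _ _ _ _ HP). pose proof (nb_dim _ _ _ _ _ _ _ HP).
  assert (0 < freq n).
  { apply lt_0_INR. rewrite Nat.div2_div. apply Nat.div_str_pos; lia. }
  field. split; apply Rgt_not_eq; assumption.
Qed.

Lemma bounded_op_zop w : l1 w -> bounded_op (fun h => sscal (zop P h) w).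
Proof.
intros Hw. replace (fun h => sscal (zop P h) w) with
  (fun (h : nat -> R) n => psum (fun k => h k * (sscal (zcol P k) w) n) (dim P)).
- apply bounded_op_sum. intros; apply l1_scal; auto.
- extensionality h; extensionality n. unfold sscal at 2, zop.
  rewrite (psum_ext _ (fun k => w n * (h k * zcol P k))) by (intros; unfold sscal; ring).
  rewrite psum_scal; ring.
Qed.

Lemma bounded_op_ssub L L' : bounded_op L -> bounded_op L' -> bounded_op (fun a => ssub (L a) (L' a)).
Proof.
intros H H'. replace (fun a => ssub (L a) (L' a)) with (fun a => sadd (L a) (sscal (-1) (L' a))).
- apply (bounded_op_add L (fun a => sscal (-1) (L' a))); auto. apply bounded_op_scal; auto.
- extensionality a; extensionality n; unfold sadd, ssub, sscal; ring.
Qed.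

Lemma bounded_op_defect : bounded_op (defect P).
Proof.
assert (H0 : 0 <= 0 <= 1) by lra. pose proof l1_xbar as Hx.
apply (bounded_op_ssub (fun h => sadd (sadd (ssub (lap_defect P h) (dprod (ord P) 0 (delta 1) (xop P h)))
   (sscal (zbar P) (xop P h))) (sscal (zop P h) (xbar P))) (fun h => dcubic P (xop P h))).
- apply (bounded_op_add (fun h => sadd (ssub (lap_defect P h) (dprod (ord P) 0 (delta 1) (xop P h)))
   (sscal (zbar P) (xop P h)))); [|apply bounded_op_zop; auto].
  apply (bounded_op_add (fun h => ssub (lap_defect P h) (dprod (ord P) 0 (delta 1) (xop P h))));
    [|apply bounded_op_scal, bounded_op_xop].
  apply (bounded_op_ssub (lap_defect P)); [apply bounded_op_lap_defect|].
  apply bounded_op_comp; [|apply bounded_op_xop]. apply bounded_op_prd_r; auto using l1_delta.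
- apply (bounded_op_comp (dcubic P)); [|apply bounded_op_xop].
  apply bounded_op_dtri; auto.
Qed.

Lemma al_pos : 0 <= al.
Proof. eapply Rle_trans; [apply Rabs_pos|apply (nb_tail _ _ _ _ _ _ _ HP 0%nat)]. Qed.

Lemma X_pos : 0 <= X.
Proof. eapply l1_le_pos; apply HP. Qed.

Lemma xof_near y : l1_le y r -> l1_le (ssub (xof P y) (xbar P)) (al * r).
Proof.
intros Hy. apply (l1_le_ext _ (xop P y)); [intros n; unfold ssub, xof, sadd; ring|].
apply xop_l1_le; auto.
Qed.

Lemma xof_l1_le y : l1_le y r -> l1_le (xof P y) (X + al * r).
Proof. intros Hy. apply l1_le_add; [apply HP|]. apply xop_l1_le; auto. Qed.

(** Newton map = its linearisation at the centre + remainder.  The remainder collects the change of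
    the product with s, the bilinear term zeta x and the cubic term, whose derivative is compared at
    points of the ball and at the centre. *)
Lemma newton_map_lip s y y' C : 0 <= s <= 1 -> l1_le y r -> l1_le y' r -> l1_le (ssub y y') C ->
  l1_le (ssub (newton_map P s y) (newton_map P s y'))
    ((th0 + 2 * al * (al * r) + 6 * (al * r) * (X + al * r) * al
      + s * (al * (1 + 6 * (X + al * r) ^ 2))) * C).
Proof.
intros Hs Hy Hy' Hh. assert (H0 : 0 <= 0 <= 1) by lra.
set (m := ord P). set (h := ssub y y'). set (g := xop P h).
set (x := xof P y). set (x' := xof P y'). set (w := xbar P).
set (R := X + al * r).
pose proof al_pos as Hal. pose proof X_pos as HX. pose proof (nb_r _ _ _ _ _ _ _ HP) as Hr.
assert (HC : 0 <= C) by (eapply l1_le_pos; eauto).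
assert (Hg : l1_le g (al * C)) by (apply xop_l1_le; auto).
assert (Hx : l1_le x R) by (apply xof_l1_le; auto).
assert (Hx' : l1_le x' R) by (apply xof_l1_le; auto).
assert (Hw : l1_le w R) by (eapply l1_le_le; [apply HP|unfold R; nra]).
assert (Hxw : l1_le (ssub x w) (al * r)) by (apply xof_near; auto).
assert (Hxw' : l1_le (ssub x' w) (al * r)) by (apply xof_near; auto).
assert (Hgg : l1_le (ssub g g) 0).
{ apply (l1_le_ext _ (fun _ => 0)); [intros n; unfold ssub; ring|apply l1_le_zero]. }
assert (Lg : l1 g) by (eexists; eauto). assert (Lx : l1 x) by (eexists; eauto).
assert (Lx' : l1 x') by (eexists; eauto). assert (Lw : l1 w) by (eexists; eauto).
assert (Ex : x = sadd x' g).
{ extensionality n. unfold x, x', g, h. rewrite xop_lin. unfold xof, sadd, ssub. ring. }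
assert (R1 : l1_le (ssub (dprod m s (delta 1) g) (dprod m 0 (delta 1) g)) (s * (al * C))).
{ eapply l1_le_le; [apply (dprod_diff m s _ _ _ _ 1 (al * C) 0 0); auto using l1_le_delta|].
  - apply (l1_le_ext _ (fun _ => 0)); [intros n; unfold ssub; ring|apply l1_le_zero].
  - right; ring. }
assert (R2 : l1_le (sadd (sscal (zop P y) g) (sscal (zop P h) (ssub x' w))) (2 * al * (al * r) * C)).
{ eapply l1_le_le; [apply l1_le_add; apply l1_le_scal; eauto|].
  pose proof (zop_abs y r Hy). pose proof (zop_abs h C Hh).
  assert (Rabs (zop P y) * (al * C) <= al * r * (al * C)).
  { apply Rmult_le_compat_r; auto. nra. }
  assert (Rabs (zop P h) * (al * r) <= al * C * (al * r)).
  { apply Rmult_le_compat_r; auto. nra. }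
  lra. }
set (B := 2 * s * (al * C * R * R) + 2 * ((al * r) * R * (al * C))).
assert (T1 : l1_le (ssub (cubic m s g x x) (cubic m 0 g w w)) B).
{ eapply l1_le_le; [apply (cubic_diff m s g g x w x w (al * C) R R 0 (al * r) (al * r)); auto|].
  unfold B; right; ring. }
assert (T2 : l1_le (ssub (cubic m s x' g x) (cubic m 0 w g w)) B).
{ eapply l1_le_le; [apply (cubic_diff m s x' w g g x w R (al * C) R (al * r) 0 (al * r)); auto|].
  unfold B; right; ring. }
assert (T3 : l1_le (ssub (cubic m s x' x' g) (cubic m 0 w w g)) B).
{ eapply l1_le_le; [apply (cubic_diff m s x' w x' w g g R R (al * C) (al * r) (al * r) 0); auto|].
  unfold B; right; ring. }
assert (E1 : cubic m s x x x = sadd (sadd (sadd (cubic m s x' x' x') (cubic m s x' x' g))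
   (cubic m s x' g x)) (cubic m s g x x)).
{ rewrite Ex at 1. rewrite cubic_add1 by auto.
  replace (cubic m s x' x x) with (sadd (cubic m s x' x' x) (cubic m s x' g x))
    by (rewrite <- cubic_add2 by auto; rewrite <- Ex; auto).
  replace (cubic m s x' x' x) with (sadd (cubic m s x' x' x') (cubic m s x' x' g))
    by (rewrite <- cubic_add3 by auto; rewrite <- Ex; auto). auto. }
assert (E2 : dprod m s (delta 1) x = sadd (dprod m s (delta 1) x') (dprod m s (delta 1) g)).
{ rewrite <- dprod_add_r by auto using l1_delta. rewrite <- Ex; auto. }
apply l1_le_le with (th0 * C + (s * (al * C) + (2 * al * (al * r) * C + (B + B + B)))).
2: { unfold B. fold R. right; ring. }
apply (l1_le_ext _ (ssub (defect P h) (ssub (sadd (ssub (dprod m s (delta 1) g) (dprod m 0 (delta 1) g))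
   (sadd (sadd (ssub (cubic m s g x x) (cubic m 0 g w w)) (ssub (cubic m s x' g x) (cubic m 0 w g w)))
     (ssub (cubic m s x' x' g) (cubic m 0 w w g))))
   (sadd (sscal (zop P y) g) (sscal (zop P h) (ssub x' w)))))).
- intros n. unfold newton_map. fold x x'. unfold defect, lap_defect, dcubic, residual, zof.
  fold m g w. rewrite E1, E2.
  assert (Ez : zop P h = zop P y - zop P y') by apply zop_lin. rewrite Ez.
  unfold sadd, sscal, ssub.
  replace (x n) with (x' n + g n) by (rewrite Ex; auto).
  change (h n) with (y n - y' n). ring.
- apply l1_le_sub; [apply bounded_op_columns; auto; [apply bounded_op_defect|apply HP]|].
  replace (s * (al * C) + (2 * al * (al * r) * C + (B + B + B))) with
    (s * (al * C) + (B + B + B) + 2 * al * (al * r) * C) by ring.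
  apply l1_le_sub; auto. apply l1_le_add; auto. apply l1_le_add; auto. apply l1_le_add; auto.
Qed.

(** Only the two products depend on s. *)
Lemma residual_diff s y : 0 <= s <= 1 -> l1_le y r ->
  l1_le (ssub (residual P s (zof P y) (xof P y)) (residual P 0 (zof P y) (xof P y)))
    (s * (X + al * r + 2 * (X + al * r) ^ 3)).
Proof.
intros Hs Hy. set (m := ord P). set (x := xof P y). set (R := X + al * r).
assert (Hx : l1_le x R) by (apply xof_l1_le; auto).
assert (H0 : forall a, l1_le (ssub a a) 0).
{ intros a. apply (l1_le_ext _ (fun _ => 0)); [intros n; unfold ssub; ring|apply l1_le_zero]. }
apply l1_le_le with ((s * (1 * R) + 0 * R + 1 * 0)
  + (2 * s * (R * R * R) + 0 * R * R + R * 0 * R + R * R * 0)); [|right; ring].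
apply (l1_le_ext _ (sadd (ssub (dprod m s (delta 1) x) (dprod m 0 (delta 1) x))
  (ssub (cubic m s x x x) (cubic m 0 x x x)))).
- intros n. unfold residual, sadd, ssub. fold m. ring.
- apply l1_le_add; [apply dprod_diff|apply cubic_diff]; auto using l1_le_delta.
Qed.

Lemma l1_le_seq0 C : 0 <= C -> l1_le seq0 C.
Proof. intros; eapply l1_le_le; [apply l1_le_zero|auto]. Qed.

Lemma xof_0 : xof P seq0 = xbar P.
Proof.
extensionality n. unfold xof, sadd, xop, seq0.
rewrite psum_zero by (intros; ring). ring.
Qed.

Lemma zof_0 : zof P seq0 = zbar P.
Proof. unfold zof, zop, seq0. rewrite psum_zero by (intros; ring). ring. Qed.

(** The strict inequalities at s = 0 determine how large s may be.  The last estimate gives the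
    convergence of the bifurcating solutions as s tends to 0. *)
Lemma zeros : exists s0 Gam, 0 < s0 <= 1 /\ forall s, 0 <= s <= s0 ->
  let y := fixpt (newton_map P s) in
  l1_le y r /\ (forall n, residual P s (zof P y) (xof P y) n = 0) /\
  l1_le (ssub y (fixpt (newton_map P 0))) (Gam * s).
Proof.
pose proof al_pos as Hal. pose proof X_pos as HX.
pose proof (nb_r _ _ _ _ _ _ _ HP) as Hr. pose proof (nb_th0 _ _ _ _ _ _ _ HP) as Hth0.
pose proof (nb_th _ _ _ _ _ _ _ HP) as Hth. pose proof (nb_e0 _ _ _ _ _ _ _ HP) as He0.
assert (Hth00 : 0 <= th0) by (eapply l1_le_pos; apply (nb_defect _ _ _ _ _ _ _ HP 0%nat)).
set (R := X + al * r) in *.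
assert (HR : 0 <= R) by (unfold R; nra).
assert (Hthp : 0 <= th).
{ assert (0 <= 2 * al * (al * r)) by nra. assert (0 <= al * r) by nra.
  assert (0 <= (al * r) * R) by nra. nra. }
set (q := th0 + 2 * al * (al * r) + 6 * (al * r) * R * al) in *.
set (c1 := al * (1 + 6 * R ^ 2)). set (c2 := R + 2 * R ^ 3).
assert (Hc1 : 0 <= c1) by (unfold c1; apply Rmult_le_pos; nra).
assert (Hc2 : 0 <= c2) by (unfold c2; assert (0 <= R ^ 3) by (apply pow_le; auto); lra).
set (s1 := Rmin ((th - q) / (c1 + 1)) (((1 - th) * r - e0) / (c2 + 1))).
assert (Hs1 : 0 < s1).
{ apply Rmin_glb_lt; apply Rdiv_lt_0_compat; lra. }
exists (Rmin s1 1), (c2 / (1 - th)).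
split; [split; [apply Rmin_glb_lt; lra|apply Rmin_r]|].
assert (K : forall s, 0 <= s <= Rmin s1 1 ->
  0 <= s <= 1 /\ contraction (newton_map P s) th r /\ l1_le (newton_map P s seq0) ((1 - th) * r)).
{ intros s [Hs Hs']. pose proof (Rmin_l s1 1). pose proof (Rmin_r s1 1).
  assert (S1 : s * c1 <= th - q).
  { assert (s <= (th - q) / (c1 + 1)) by (unfold s1 in *; pose proof (Rmin_l ((th - q) / (c1 + 1)) (((1 - th) * r - e0) / (c2 + 1))); lra).
    apply Rle_trans with ((th - q) / (c1 + 1) * (c1 + 1)); [|right; field; lra]. nra. }
  assert (S2 : s * c2 <= (1 - th) * r - e0).
  { assert (s <= ((1 - th) * r - e0) / (c2 + 1)) by (unfold s1 in *; pose proof (Rmin_r ((th - q) / (c1 + 1)) (((1 - th) * r - e0) / (c2 + 1))); lra).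
    apply Rle_trans with (((1 - th) * r - e0) / (c2 + 1) * (c2 + 1)); [|right; field; lra]. nra. }
  split; [lra|]. split.
  - intros y y' C Hy Hy' HC. eapply l1_le_le; [apply newton_map_lip; eauto; lra|].
    fold R q c1. apply Rmult_le_compat_r; [eapply l1_le_pos; eauto|lra].
  - apply l1_le_le with (s * c2 + e0); [|lra].
    apply (l1_le_ext _ (sscal (-1) (sadd
      (ssub (residual P s (zof P seq0) (xof P seq0)) (residual P 0 (zof P seq0) (xof P seq0)))
      (residual P 0 (zbar P) (xbar P))))).
    + intros n. unfold newton_map. rewrite xof_0, zof_0. unfold sscal, sadd, ssub, seq0. ring.
    + apply l1_le_opp, l1_le_add; [|apply HP]. apply residual_diff; [lra|]. apply l1_le_seq0; lra. }
assert (F : forall s, 0 <= s <= Rmin s1 1 -> l1_le (fixpt (newton_map P s)) r /\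
   newton_map P s (fixpt (newton_map P s)) = fixpt (newton_map P s)).
{ intros s Hs. destruct (K s Hs) as [_ [K1 K2]]. apply fixpt_spec with th; auto; lra. }
intros s Hs y. destruct (F s Hs) as [F1 F2]. split; [exact F1|]. split.
- intros n. fold y in F2. pose proof (f_equal (fun u => u n) F2) as E.
  unfold newton_map, ssub in E. simpl in E. lra.
- assert (Hz : 0 <= 0 <= Rmin s1 1) by (split; [lra|apply Rmin_glb; lra]).
  destruct (F 0 Hz) as [G1 G2]. destruct (K s Hs) as [Hs1' [K1 _]].
  apply l1_le_le with (s * c2 / (1 - th)); [|right; field; lra].
  apply fixpt_close with r; auto; try lra. 
  intros u Hu. apply (l1_le_ext _ (sscal (-1) (ssub (residual P s (zof P u) (xof P u))
     (residual P 0 (zof P u) (xof P u))))).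
  + intros n; unfold newton_map, sscal, ssub; ring.
  + apply l1_le_opp, residual_diff; auto.
Qed.

End Bounds.

(** * Evaluation of coefficient sequences *)

Definition pairing (psi c : nat -> R) : R := total (fun n => c n * psi n).
Definition repart (psi : nat -> R) (n : nat) : R := if Nat.odd n then 0 else psi n.
Definition impart (psi : nat -> R) (n : nat) : R := if Nat.odd n then psi n else 0.

Lemma bounded_form_pair psi B : (forall n, Rabs (psi n) <= B) -> bounded_form (pairing psi).
Proof. apply bounded_form_tot. Qed.

Lemma pairing_delta psi k : pairing psi (delta k) = psi k.
Proof. apply total_delta. Qed.

Lemma bounded_form_comp F L : bounded_form F -> bounded_op L -> bounded_form (fun a => F (L a)).
Proof.
intros HF HL. pose proof (fun a => bounded_op_l1 L a HL) as P.
destruct HF as [A1 [S1 [M1 N1]]], HL as [A2 [S2 [M2 N2]]]. split; [|split].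
- intros. rewrite A2, A1; auto.
- intros. rewrite S2, S1; auto.
- exists (M1 * M2). intros. rewrite Rmult_assoc. auto.
Qed.

Lemma bounded_form_lin F G k l : bounded_form F -> bounded_form G -> bounded_form (fun a => k * F a + l * G a).
Proof.
intros [A1 [S1 [M1 N1]]] [A2 [S2 [M2 N2]]]. split; [|split].
- intros. rewrite A1, A2 by auto. ring.
- intros. rewrite S1, S2 by auto. ring.
- exists (Rabs k * M1 + Rabs l * M2). intros a A Ha.
  eapply Rle_trans; [apply Rabs_triang|]. rewrite !Rabs_mult.
  pose proof (N1 _ _ Ha). pose proof (N2 _ _ Ha).
  pose proof (Rmult_le_compat_l (Rabs k) _ _ (Rabs_pos _) H).
  pose proof (Rmult_le_compat_l (Rabs l) _ _ (Rabs_pos _) H0). lra.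
Qed.

Lemma inq_spec m j : (1 <= m)%nat -> in_class m j = true <-> Nat.divide m (Nat.div2 j).
Proof.
intros Hm. unfold in_class. rewrite Nat.eqb_eq. apply Nat.Lcm0.mod_divide.
Qed.

Lemma gap_spec a b : (gap a b = a - b /\ b <= a \/ gap a b = b - a /\ a <= b)%nat.
Proof. unfold gap; lia. Qed.

Definition amp (m : nat) (s : R) (j : nat) : R := if in_class m j then 1 else s.

Lemma divide_gap m a b : Nat.divide m a -> Nat.divide m (gap a b) <-> Nat.divide m b.
Proof.
intros [u Hu]. destruct (gap_spec a b) as [[-> L]|[-> L]]; split; intros [v Hv].
- exists (u - v)%nat. nia.
- exists (u - v)%nat. nia.
- exists (u + v)%nat. nia.
- exists (v - u)%nat. nia.
Qed.

Lemma divide_plus m a b : Nat.divide m a -> Nat.divide m (a + b) <-> Nat.divide m b.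
Proof.
intros Ha; split; intros H.
- apply Nat.divide_add_cancel_r with a; auto.
- apply Nat.divide_add_r; auto.
Qed.

Lemma div2_pack a r : (r < 2)%nat -> Nat.div2 (2 * a + r) = a.
Proof.
intros Hr. rewrite Nat.div2_div, Nat.mul_comm, Nat.div_add_l by lia.
rewrite Nat.div_small; lia.
Qed.

Lemma odd_pack a (b : bool) : Nat.odd (2 * a + Nat.b2n b) = b.
Proof. rewrite Nat.add_comm, Nat.odd_add_mul_2. destruct b; reflexivity. Qed.

Lemma par_lt i j : (parity i j < 2)%nat.
Proof. unfold parity; destruct (xorb _ _); simpl; lia. Qed.

(** If m divides one of i and j, then it divides i + j and |i - j| exactly when it divides the other. *)
Lemma rho_amp m s i j n : (1 <= m)%nat ->
  Nat.div2 n = (Nat.div2 i + Nat.div2 j)%nat \/ Nat.div2 n = gap (Nat.div2 i) (Nat.div2 j) ->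
  rho m s i j n * amp m s n = amp m s i * amp m s j.
Proof.
intros Hm Hn.
assert (S : forall a b, gap a b = gap b a) by (unfold gap; intros; lia).
assert (I : Nat.divide m (Nat.div2 i) -> Nat.divide m (Nat.div2 n) <-> Nat.divide m (Nat.div2 j)).
{ intros H. destruct Hn as [-> | ->]; [apply divide_plus|apply divide_gap]; auto. }
assert (J : Nat.divide m (Nat.div2 j) -> Nat.divide m (Nat.div2 n) <-> Nat.divide m (Nat.div2 i)).
{ intros H. destruct Hn as [-> | ->]; [rewrite Nat.add_comm; apply divide_plus|
    rewrite S; apply divide_gap]; auto. }
rewrite <- !inq_spec in I, J by auto.
unfold rho, amp. destruct (in_class m i), (in_class m j), (in_class m n); simpl; try ring;
  try (destruct (I eq_refl) as [? I']; discriminate (I' eq_refl) || (now (exfalso; intuition discriminate)));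
  try (exfalso; intuition discriminate).
Qed.

(** The values at time t of the functions that the coefficients stand for. *)
Definition wave (m p : nat) (s t : R) (j : nat) : R := amp m s j * cos (freq j * (INR p * t)).

Lemma wave_abs m p s t j : 0 <= s <= 1 -> Rabs (wave m p s t j) <= 1.
Proof.
intros Hs. unfold wave. rewrite Rabs_mult.
assert (Rabs (amp m s j) <= 1) by (unfold amp; destruct (in_class m j); rewrite Rabs_pos_eq; lra).
assert (Rabs (cos (freq j * (INR p * t))) <= 1) by (apply Rabs_le, COS_bound).
pose proof (Rabs_pos (amp m s j)). pose proof (Rabs_pos (cos (freq j * (INR p * t)))). nra.
Qed.

Lemma repart_abs psi B n : 0 <= B -> Rabs (psi n) <= B -> Rabs (repart psi n) <= B.
Proof. unfold repart; destruct (Nat.odd n); rewrite ?Rabs_R0; auto. Qed.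

Lemma impart_abs psi B n : 0 <= B -> Rabs (psi n) <= B -> Rabs (impart psi n) <= B.
Proof. unfold impart; destruct (Nat.odd n); rewrite ?Rabs_R0; auto. Qed.

Lemma wave_mult m p s t i j : (1 <= m)%nat ->
  rho m s i j (mode_sum i j) * wave m p s t (mode_sum i j)
  + rho m s i j (mode_gap i j) * wave m p s t (mode_gap i j)
  = 2 * (wave m p s t i * wave m p s t j).
Proof.
intros Hm.
assert (E1 : Nat.div2 (mode_sum i j) = (Nat.div2 i + Nat.div2 j)%nat) by apply div2_pack, par_lt.
assert (E2 : Nat.div2 (mode_gap i j) = gap (Nat.div2 i) (Nat.div2 j)) by apply div2_pack, par_lt.
assert (W : forall n, Nat.div2 n = (Nat.div2 i + Nat.div2 j)%nat
    \/ Nat.div2 n = gap (Nat.div2 i) (Nat.div2 j) ->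
  rho m s i j n * wave m p s t n = amp m s i * amp m s j * cos (freq n * (INR p * t))).
{ intros n Hn. unfold wave. rewrite <- Rmult_assoc, rho_amp; auto. }
rewrite !W by auto. unfold wave, freq. rewrite E1, E2.
set (u := Nat.div2 i). set (v := Nat.div2 j).
assert (EC : cos (INR (gap u v) * (INR p * t)) = cos (INR u * (INR p * t) - INR v * (INR p * t))).
{ destruct (gap_spec u v) as [[-> L]|[-> L]]; rewrite minus_INR by auto.
  - f_equal; ring.
  - rewrite <- cos_neg. f_equal; ring. }
rewrite EC, plus_INR, Rmult_plus_distr_r, cos_plus, cos_minus. ring.
Qed.

Lemma pairing_gam psi B m s i j : (forall n, Rabs (psi n) <= B) ->
  pairing psi (basis_prod m s i j) = half_sign i j * (rho m s i j (mode_sum i j) * psi (mode_sum i j)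
    + rho m s i j (mode_gap i j) * psi (mode_gap i j)).
Proof.
intros Hp. destruct (bounded_form_pair psi B Hp) as [A [S _]].
unfold basis_prod. rewrite A, !S, !pairing_delta; auto using l1_scal, l1_delta. ring.
Qed.

Section Eval.
Context (m p : nat) (s t : R) (Hm : (1 <= m)%nat) (Hs : 0 <= s <= 1).
Let U := pairing (repart (wave m p s t)).
Let V := pairing (impart (wave m p s t)).

Lemma re_abs n : Rabs (repart (wave m p s t) n) <= 1.
Proof. apply repart_abs; [lra|apply wave_abs; auto]. Qed.
Lemma im_abs n : Rabs (impart (wave m p s t) n) <= 1.
Proof. apply impart_abs; [lra|apply wave_abs; auto]. Qed.
Lemma bounded_form_U : bounded_form U. Proof. apply bounded_form_pair with 1, re_abs. Qed.
Lemma bounded_form_V : bounded_form V. Proof. apply bounded_form_pair with 1, im_abs. Qed.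

Lemma eval_basis_prod i j :
  U (basis_prod m s i j) = U (delta i) * U (delta j) - V (delta i) * V (delta j) /\
  V (basis_prod m s i j) = U (delta i) * V (delta j) + V (delta i) * U (delta j).
Proof.
unfold U, V. rewrite !(pairing_gam _ 1) by (apply re_abs || apply im_abs).
rewrite !pairing_delta.
pose proof (wave_mult m p s t i j Hm) as W.
assert (O1 : Nat.odd (mode_sum i j) = xorb (Nat.odd i) (Nat.odd j)) by apply odd_pack.
assert (O2 : Nat.odd (mode_gap i j) = xorb (Nat.odd i) (Nat.odd j)) by apply odd_pack.
unfold repart, impart, half_sign. rewrite O1, O2.
destruct (Nat.odd i), (Nat.odd j); simpl; split; try rewrite W; field.
Qed.

(** Both sides are bounded bilinear, so it suffices to look at products of cosines. *)
Lemma eval_dprod a b : l1 a -> l1 b ->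
  U (dprod m s a b) = U a * U b - V a * V b /\ V (dprod m s a b) = U a * V b + V a * U b.
Proof.
intros Ha Hb.
assert (D : forall F k l, bounded_form F ->
   (forall i j, F (basis_prod m s i j) = k * (U (delta i) * U (delta j) + (-1) * (V (delta i) * V (delta j)))
      + l * (U (delta i) * V (delta j) + V (delta i) * U (delta j))) ->
   F (dprod m s a b) = k * (U a * U b + (-1) * (V a * V b)) + l * (U a * V b + V a * U b)).
{ intros F k l HF HG.
  assert (Hi : forall i, F (dprod m s (delta i) b) =
    k * (U (delta i) * U b + (-1) * (V (delta i) * V b)) + l * (U (delta i) * V b + V (delta i) * U b)).
  { intros i.
    transitivity ((k * U (delta i) + l * V (delta i)) * U b
      + (l * U (delta i) - k * V (delta i)) * V b); [|ring].
    apply (bounded_form_eq (fun b => F (dprod m s (delta i) b)) (fun b => (k * U (delta i) + l * V (delta i)) * U b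
      + (l * U (delta i) - k * V (delta i)) * V b)); auto.
    - apply bounded_form_comp; auto using bounded_op_prd_r, l1_delta.
    - apply bounded_form_lin; [apply bounded_form_U|apply bounded_form_V].
    - intros j. unfold dprod. rewrite bilin_ext_delta, HG. ring. }
  transitivity ((k * U b + l * V b) * U a + (l * U b - k * V b) * V a); [|ring].
  apply (bounded_form_eq (fun a => F (dprod m s a b)) (fun a => (k * U b + l * V b) * U a
      + (l * U b - k * V b) * V a)); auto.
  - apply (bounded_form_comp F (fun a => dprod m s a b)); auto using bounded_op_prd_l.
  - apply bounded_form_lin; [apply bounded_form_U|apply bounded_form_V].
  - intros i. rewrite Hi. ring. }
split.
- rewrite (D U 1 0 bounded_form_U); [ring|]. intros i j. destruct (eval_basis_prod i j) as [-> _]. ring.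
- rewrite (D V 0 1 bounded_form_V); [ring|]. intros i j. destruct (eval_basis_prod i j) as [_ ->]. ring.
Qed.

Lemma eval_sconj c : l1 c -> U (sconj c) = U c /\ V (sconj c) = - V c.
Proof.
intros Hc. split.
- unfold U, pairing. f_equal. extensionality n. unfold sconj, repart. destruct (Nat.odd n); ring.
- replace (- V c) with (-1 * V c) by ring. destruct bounded_form_V as [_ [S _]]. rewrite <- S by auto.
  unfold V, pairing. f_equal. extensionality n. unfold sconj, impart, sscal. destruct (Nat.odd n); ring.
Qed.

Lemma eval_cubic x : l1 x ->
  U (cubic m s x x x) = (U x ^ 2 + V x ^ 2) * U x /\ V (cubic m s x x x) = (U x ^ 2 + V x ^ 2) * V x.
Proof.
intros Hx. unfold cubic.
destruct (eval_dprod (dprod m s x x) (sconj x)) as [-> ->]; auto using dprod_l1, sconj_l1.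
destruct (eval_dprod x x) as [-> ->]; auto. destruct (eval_sconj x) as [-> ->]; auto.
split; ring.
Qed.

Lemma eval_delta1 : U (delta 1) = 0 /\ V (delta 1) = 1.
Proof.
unfold U, V. rewrite !pairing_delta. unfold repart, impart, wave, amp, in_class, freq; simpl.
rewrite Nat.Div0.mod_0_l. simpl. rewrite !Rmult_0_l, cos_0. split; ring.
Qed.

(** Evaluation turns the products into products of functions, so a zero of the residual gives the
    real and the imaginary part of the equation at time t. *)
Lemma eval_residual P z x : ord P = m -> l1 x -> l1 (fun n => freq n ^ 2 * x n) ->
  (forall n, residual P s z x n = 0) ->
  - disp P * U (fun n => freq n ^ 2 * x n) - V x - z * U x + (U x ^ 2 + V x ^ 2) * U x = 0 /\
  - disp P * V (fun n => freq n ^ 2 * x n) + U x - z * V x + (U x ^ 2 + V x ^ 2) * V x - 1.6 = 0.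
Proof.
intros HO Hx Hx2 HR.
assert (E : forall F, bounded_form F -> - disp P * F (fun n => freq n ^ 2 * x n) + F (dprod m s (delta 1) x)
   - z * F x + F (cubic m s x x x) - 1.6 * F (delta 1) = 0).
{ intros F [A [S _]].
  assert (Z : (fun n => freq n ^ 2 * x n) = (fun n => freq n ^ 2 * x n)) by auto.
  assert (L1 : l1 (dprod m s (delta 1) x)) by auto using dprod_l1, l1_delta.
  assert (L2 : l1 (cubic m s x x x)) by (unfold cubic; auto using dprod_l1, sconj_l1).
  transitivity (F (sadd (sadd (sadd (sadd (sscal (- disp P) (fun n => freq n ^ 2 * x n))
    (dprod m s (delta 1) x)) (sscal (- z) x)) (cubic m s x x x)) (sscal (-1.6) (delta 1)))).
  - rewrite !A, !S; auto 10 using l1_add, l1_scal, l1_delta. lra.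
  - replace (sadd _ _) with (sscal 0 x); [rewrite S; auto; ring|].
    extensionality n. specialize (HR n). unfold residual in HR. rewrite HO in HR.
    unfold sadd, sscal. lra. }
pose proof (E U bounded_form_U) as EU. pose proof (E V bounded_form_V) as EV.
destruct (eval_dprod (delta 1) x (l1_delta 1) Hx) as [P1 P2].
destruct eval_delta1 as [D1 D2]. destruct (eval_cubic x Hx) as [T1 T2].
rewrite P1, T1, D1, D2 in EU. rewrite P2, T2, D1, D2 in EV. split; lra.
Qed.
End Eval.

(** * Derivatives of cosine series *)

Lemma total_trunc f N : total (trunc N f) = psum f N.
Proof.
apply total_unique. apply (is_lim_seq_ext_loc (fun _ => psum f N)); [|apply is_lim_seq_const].
exists N. intros K HK. induction HK as [|K HK IH].
- apply psum_ext. intros n Hn. unfold trunc. rewrite (proj2 (Nat.ltb_lt n N)); auto.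
- simpl. rewrite <- IH. unfold trunc. rewrite (proj2 (Nat.ltb_ge K N)); auto. ring.
Qed.

Lemma lipschitz_of_deriv (u u' : R -> R) B t h :
  (forall t, is_derive u t (u' t)) -> (forall t, Rabs (u' t) <= B) ->
  Rabs (u (t + h) - u t) <= B * Rabs h.
Proof.
intros Hu HB. destruct (MVT_gen u t (t + h) u') as [c [_ Hc]]; auto.
- intros x _. apply continuity_pt_filterlim. apply (ex_derive_continuous u). eexists; eauto.
- rewrite Hc, Rabs_mult. replace (t + h - t) with h by ring.
  apply Rmult_le_compat_r; [apply Rabs_pos|auto].
Qed.

Lemma psum_derive (u u' : nat -> R -> R) N t :
  (forall n t, is_derive (u n) t (u' n t)) ->
  is_derive (fun t => psum (fun n => u n t) N) t (psum (fun n => u' n t) N).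
Proof.
intros Hu. induction N as [|N IH]; simpl.
- apply @is_derive_const.
- apply @is_derive_plus; auto.
Qed.

(** Split the series of difference quotients: finitely many terms converge, and by the mean value
    theorem the rest is at most twice the tail of the summable majorant. *)
Lemma total_derive (c B : nat -> R) (u u' : nat -> R -> R) (t : R) :
  (forall n t, is_derive (u n) t (u' n t)) ->
  (forall n t, Rabs (u' n t) <= B n) ->
  (forall t, l1 (fun n => c n * u n t)) ->
  l1 (fun n => c n * B n) ->
  is_derive (fun t => total (fun n => c n * u n t)) t (total (fun n => c n * u' n t)).
Proof.
intros Hu HB Hl [M HM].
apply is_derive_Reals. intros eps Heps.
set (b := fun n => c n * B n) in *.
assert (Hb : is_lim_seq (psum (fun n => Rabs (b n))) (total (fun n => Rabs (b n)))).
{ apply total_lim. exists M. intros J. rewrite (psum_ext _ (fun n => Rabs (b n))); auto.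
  intros; apply Rabs_Rabsolu. }
assert (BP : forall n, 0 <= B n).
{ intros n; eapply Rle_trans; [apply Rabs_pos|apply (HB n 0)]. }
assert (He : 0 < eps / 4) by lra.
destruct (proj1 (is_lim_seq_Reals _ _) Hb (eps / 4) He) as [N HN].
specialize (HN N (le_n N)). unfold Rdist in HN.
set (tail := total (fun n => Rabs (b n)) - psum (fun n => Rabs (b n)) N) in *.
assert (Ht : tail < eps / 4).
{ unfold tail. rewrite Rabs_minus_sym in HN. eapply Rle_lt_trans; [apply Rle_abs|exact HN]. }
assert (Hfin : is_derive (fun t => psum (fun n => c n * u n t) N) t (psum (fun n => c n * u' n t) N)).
{ apply (psum_derive (fun n t => c n * u n t) (fun n t => c n * u' n t)).
  intros n x. apply @is_derive_scal; auto. }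
apply is_derive_Reals in Hfin. destruct (Hfin (eps / 4) He) as [dl Hd].
exists dl. intros h Hh Hhd. specialize (Hd h Hh Hhd).
set (Q := fun n => c n * ((u n (t + h) - u n t) / h - u' n t)).
assert (Lu' : l1 (fun n => c n * u' n t)).
{ exists M. apply (l1_le_mono _ b); auto. intros n. unfold b. rewrite !Rabs_mult.
  apply Rmult_le_compat_l; [apply Rabs_pos|]. rewrite (Rabs_pos_eq (B n)); auto. }
assert (EQ : (total (fun n => c n * u n (t + h)) - total (fun n => c n * u n t)) / h
   - total (fun n => c n * u' n t) = total Q).
{ transitivity (total (sadd (sadd (sscal (/ h) (fun n => c n * u n (t + h)))
     (sscal (- / h) (fun n => c n * u n t))) (sscal (-1) (fun n => c n * u' n t)))).
  - rewrite !total_add, !total_scal; auto using l1_add, l1_scal. field; auto.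
  - f_equal. extensionality n. unfold sadd, sscal, Q. field; auto. }
rewrite EQ.
assert (QB : forall n, Rabs (Q n) <= 2 * Rabs (b n)).
{ intros n. unfold Q, b. rewrite !Rabs_mult, (Rabs_pos_eq (B n)) by auto.
  rewrite <- Rmult_assoc, (Rmult_comm 2), Rmult_assoc.
  apply Rmult_le_compat_l; [apply Rabs_pos|].
  eapply Rle_trans; [apply Rabs_triang|]. rewrite Rabs_Ropp.
  assert (Rabs ((u n (t + h) - u n t) / h) <= B n).
  { unfold Rdiv. rewrite Rabs_mult, Rabs_inv.
    pose proof (lipschitz_of_deriv (u n) (u' n) (B n) t h (Hu n) (HB n)).
    apply (Rmult_le_reg_r (Rabs h)); [apply Rabs_pos_lt; auto|].
    rewrite Rmult_assoc, Rinv_l; [lra|]. apply Rabs_no_R0; auto. }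
  pose proof (HB n t). lra. }
assert (HT : l1_le (ssub Q (trunc N Q)) (2 * tail)).
{ apply (l1_le_mono _ (sscal 2 (ssub b (trunc N b)))).
  - intros n. unfold sscal, ssub, trunc. destruct (Nat.ltb n N).
    + rewrite !Rminus_diag, Rmult_0_r, Rabs_R0; lra.
    + rewrite !Rminus_0_r, Rabs_mult, (Rabs_pos_eq 2) by lra. apply QB.
  - replace 2 with (Rabs 2) at 2 by (apply Rabs_pos_eq; lra). apply l1_le_scal.
    apply l1_le_tail with M; auto. }
assert (LQ : l1 Q).
{ exists (Rabs 2 * M). apply (l1_le_mono _ (sscal 2 b)); [|apply l1_le_scal; auto].
  intros n. unfold sscal. rewrite Rabs_mult, (Rabs_pos_eq 2) by lra. apply QB. }
assert (LT : l1 (trunc N Q)) by (destruct LQ as [q Hq]; exists q; apply l1_le_trunc; auto).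
replace (total Q) with (psum Q N + total (ssub Q (trunc N Q))).
- pose proof (total_abs _ _ HT) as H1.
  assert (H2 : Rabs (psum Q N) < eps / 4).
  { replace (psum Q N) with ((psum (fun n => c n * u n (t + h)) N - psum (fun n => c n * u n t) N) / h
      - psum (fun n => c n * u' n t) N); auto.
    rewrite (psum_ext Q (fun n => / h * (c n * u n (t + h)) + ((- / h) * (c n * u n t)
      + (-1) * (c n * u' n t)))) by (intros; unfold Q; field; auto).
    rewrite !psum_plus, !psum_scal. field; auto. }
  eapply Rle_lt_trans; [apply Rabs_triang|]. lra.
- rewrite <- total_trunc, <- total_add; auto using l1_sub.
  f_equal. extensionality n; unfold sadd, ssub; ring.
Qed.

Definition cosum (p : nat) (c : nat -> R) (t : R) : R :=
  total (fun n => c n * cos (freq n * (INR p * t))).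
Definition cosum' (p : nat) (c : nat -> R) (t : R) : R :=
  total (fun n => c n * (- (freq n * INR p) * sin (freq n * (INR p * t)))).

Lemma freq_pos n : 0 <= freq n.
Proof. apply pos_INR. Qed.

Lemma freq_sqr n : freq n <= freq n ^ 2.
Proof.
unfold freq. destruct (Nat.div2 n) as [|k]; [simpl; lra|].
pose proof (pos_INR k). rewrite S_INR. nra.
Qed.

Lemma l1_le_freq c C : l1_le (fun n => freq n ^ 2 * c n) C -> l1_le (fun n => freq n * c n) C.
Proof.
apply l1_le_mono. intros n. rewrite !Rabs_mult.
apply Rmult_le_compat_r; [apply Rabs_pos|].
pose proof (freq_pos n). pose proof (freq_sqr n). rewrite !Rabs_pos_eq; lra.
Qed.

Lemma cos_le1 x : Rabs (cos x) <= 1. Proof. apply Rabs_le, COS_bound. Qed.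
Lemma sin_le1 x : Rabs (sin x) <= 1. Proof. apply Rabs_le, SIN_bound. Qed.

Lemma cosum_derive p c t : l1 c -> l1 (fun n => freq n ^ 2 * c n) ->
  is_derive (cosum p c) t (cosum' p c t).
Proof.
intros [C HC] [C2 HC2].
apply (total_derive c (fun n => freq n * INR p)
  (fun n t => cos (freq n * (INR p * t))) (fun n t => - (freq n * INR p) * sin (freq n * (INR p * t)))).
- intros n x. auto_derive; auto. ring.
- intros n x. rewrite Rabs_mult, Rabs_Ropp, Rabs_pos_eq.
  + pose proof (sin_le1 (freq n * (INR p * x))).
    assert (0 <= freq n * INR p) by (apply Rmult_le_pos; [apply freq_pos|apply pos_INR]). nra.
  + apply Rmult_le_pos; [apply freq_pos|apply pos_INR].
- intros x. exists (1 * C). apply l1_le_mult; auto. intros; apply cos_le1.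
- exists (Rabs (INR p) * C2). apply (l1_le_ext _ (sscal (INR p) (fun n => freq n * c n))).
  + intros n; unfold sscal; ring.
  + apply l1_le_scal, l1_le_freq; auto.
Qed.

Lemma cosum'_abs p c C t : l1_le (fun n => freq n ^ 2 * c n) C -> Rabs (cosum' p c t) <= INR p * C.
Proof.
intros H. apply total_abs.
apply (l1_le_ext _ (fun n => freq n * c n * (- INR p * sin (freq n * (INR p * t))))).
- intros n; ring.
- apply l1_le_mult; [apply l1_le_freq; auto|]. intros n.
  rewrite Rabs_mult, Rabs_Ropp, (Rabs_pos_eq (INR p)) by apply pos_INR.
  pose proof (sin_le1 (freq n * (INR p * t))). pose proof (pos_INR p). nra.
Qed.

Lemma cosum_abs p c C t : l1_le c C -> Rabs (cosum p c t) <= C.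
Proof.
intros H. apply total_abs. rewrite <- (Rmult_1_l C). apply l1_le_mult; auto. intros; apply cos_le1.
Qed.

Lemma cosum_derive2 p c t : l1 (fun n => freq n ^ 2 * c n) ->
  is_derive (cosum' p c) t (- INR p ^ 2 * cosum p (fun n => freq n ^ 2 * c n) t).
Proof.
intros [C2 HC2].
replace (- INR p ^ 2 * cosum p (fun n => freq n ^ 2 * c n) t) with
  (total (fun n => c n * (- (freq n * INR p) ^ 2 * cos (freq n * (INR p * t))))).
- apply (total_derive c (fun n => (freq n * INR p) ^ 2)
    (fun n t => - (freq n * INR p) * sin (freq n * (INR p * t)))
    (fun n t => - (freq n * INR p) ^ 2 * cos (freq n * (INR p * t)))).
  + intros n x. auto_derive; auto. ring.
  + intros n x. rewrite Rabs_mult, Rabs_Ropp, Rabs_pos_eq by apply pow2_ge_0.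
    pose proof (cos_le1 (freq n * (INR p * x))). pose proof (pow2_ge_0 (freq n * INR p)). nra.
  + intros x. exists (INR p * C2).
    apply (l1_le_ext _ (fun n => freq n * c n * (- INR p * sin (freq n * (INR p * x))))).
    * intros n; ring.
    * apply l1_le_mult; [apply l1_le_freq; auto|]. intros n.
      rewrite Rabs_mult, Rabs_Ropp, (Rabs_pos_eq (INR p)) by apply pos_INR.
      pose proof (sin_le1 (freq n * (INR p * x))). pose proof (pos_INR p). nra.
  + exists (Rabs (INR p ^ 2) * C2).
    apply (l1_le_ext _ (sscal (INR p ^ 2) (fun n => freq n ^ 2 * c n))).
    * intros n; unfold sscal; ring.
    * apply l1_le_scal; auto.
- unfold cosum. rewrite <- total_scal.
  + f_equal. extensionality n. unfold sscal. ring.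
  + exists (1 * C2). apply l1_le_mult; auto. intros; apply cos_le1.
Qed.

Lemma derive_components (u v u' v' : R -> R) :
  (forall t, is_derive u t (u' t)) -> (forall t, is_derive v t (v' t)) ->
  differentiable (fun t => (u t, v t)) /\
  derivative (fun t => (u t, v t)) = (fun t => (u' t, v' t)).
Proof.
intros Hu Hv. split.
- intros t. exists (u' t, v' t). apply is_derive_C_components. split; [apply Hu|apply Hv].
- extensionality t. unfold derivative. simpl. f_equal; apply is_derive_unique; auto.
Qed.

(** * From coefficients to solutions *)

Lemma Cmod_sq (a b : R) : Cmod (a, b) ^ 2 = a ^ 2 + b ^ 2.
Proof.
unfold Cmod. rewrite pow2_sqrt; auto.
pose proof (pow2_ge_0 a); pose proof (pow2_ge_0 b). simpl in *; lra.
Qed.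

Definition profile (m p : nat) (s : R) (x : nat -> R) (t : R) : C :=
  (pairing (repart (wave m p s t)) x, pairing (impart (wave m p s t)) x).

Definition umask (m : nat) (s : R) (x : nat -> R) (n : nat) : R := x n * repart (amp m s) n.
Definition vmask (m : nat) (s : R) (x : nat -> R) (n : nat) : R := x n * impart (amp m s) n.

Lemma profile_cosum m p s x :
  profile m p s x = (fun t => (cosum p (umask m s x) t, cosum p (vmask m s x) t)).
Proof.
extensionality t. unfold profile, pairing, cosum, umask, vmask.
f_equal; f_equal; extensionality n; unfold repart, impart, wave; destruct (Nat.odd n); ring.
Qed.

Lemma amp_abs m s n : 0 <= s <= 1 -> Rabs (amp m s n) <= 1.
Proof. intros Hs; unfold amp; destruct (in_class m n); rewrite Rabs_pos_eq; lra. Qed.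

Lemma umask_l1_le m s x X : 0 <= s <= 1 -> l1_le x X -> l1_le (umask m s x) X.
Proof.
intros Hs Hx. rewrite <- (Rmult_1_l X). apply l1_le_mult; auto.
intros n. apply repart_abs; [lra|apply amp_abs; auto].
Qed.

Lemma vmask_l1_le m s x X : 0 <= s <= 1 -> l1_le x X -> l1_le (vmask m s x) X.
Proof.
intros Hs Hx. rewrite <- (Rmult_1_l X). apply l1_le_mult; auto.
intros n. apply impart_abs; [lra|apply amp_abs; auto].
Qed.

Lemma umask_freq m s x : (fun n => freq n ^ 2 * umask m s x n) = umask m s (fun n => freq n ^ 2 * x n).
Proof. extensionality n; unfold umask; ring. Qed.
Lemma vmask_freq m s x : (fun n => freq n ^ 2 * vmask m s x n) = vmask m s (fun n => freq n ^ 2 * x n).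
Proof. extensionality n; unfold vmask; ring. Qed.

Lemma profile_periodic m p s x T : 
  (forall n, amp m s n = 0 \/ exists k, freq n * (INR p * T) = 2 * INR k * PI) ->
  periodic T (profile m p s x).
Proof.
intros H t. unfold profile.
assert (E : wave m p s (t + T) = wave m p s t).
{ extensionality n. unfold wave. destruct (H n) as [->|[k Hk]]; [ring|].
  f_equal. rewrite !Rmult_plus_distr_l, Hk. apply cos_period. }
rewrite E; auto.
Qed.

(** The coefficients of the residual vanish, hence so does the equation at every time. *)
Lemma profile_solution P p s z x : (1 <= ord P)%nat -> 0 <= s <= 1 ->
  disp P = 0.1 * INR p ^ 2 -> l1 x -> l1 (fun n => freq n ^ 2 * x n) ->
  (forall n, residual P s z x n = 0) ->
  lle_solution 0.1 1.6 (profile (ord P) p s x) z.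
Proof.
intros Hm Hs HD Hx Hx2 HR. set (m := ord P) in *.
assert (L : l1 (umask m s x) /\ l1 (vmask m s x)).
{ destruct Hx as [X HX]. split; exists X; auto using umask_l1_le, vmask_l1_le. }
assert (L2 : l1 (fun n => freq n ^ 2 * umask m s x n) /\ l1 (fun n => freq n ^ 2 * vmask m s x n)).
{ rewrite umask_freq, vmask_freq.
  destruct Hx2 as [X HX]. split; exists X; auto using umask_l1_le, vmask_l1_le. }
destruct L as [Lu Lv], L2 as [Lu2 Lv2].
split; [|rewrite profile_cosum].
- apply profile_periodic. intros n; right. exists (Nat.div2 n * p)%nat. unfold freq.
  rewrite mult_INR. ring.
- destruct (derive_components (cosum p (umask m s x)) (cosum p (vmask m s x)) (cosum' p (umask m s x))
    (cosum' p (vmask m s x))) as [D1 E1]; auto using cosum_derive.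
  destruct (derive_components (cosum' p (umask m s x)) (cosum' p (vmask m s x))
    (fun t => - INR p ^ 2 * cosum p (fun n => freq n ^ 2 * umask m s x n) t)
    (fun t => - INR p ^ 2 * cosum p (fun n => freq n ^ 2 * vmask m s x n) t)) as [D2 E2];
    auto using cosum_derive2.
  split; [exact D1|]. rewrite E1. split; [exact D2|]. rewrite E2. intros t.
  destruct (eval_residual m p s t Hm Hs P z x eq_refl Hx Hx2 HR) as [R1 R2].
  pose proof (f_equal (fun f => f t) (profile_cosum m p s x)) as F1.
  pose proof (f_equal (fun f => f t) (profile_cosum m p s (fun n => freq n ^ 2 * x n))) as F2.
  unfold profile in F1, F2. cbv beta in F1, F2.
  pose proof (f_equal fst F1) as U1. pose proof (f_equal snd F1) as V1.
  pose proof (f_equal fst F2) as U2. pose proof (f_equal snd F2) as V2.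
  cbn [fst snd] in U1, V1, U2, V2. rewrite U1, V1, U2 in R1. rewrite U1, V1, V2 in R2.
  rewrite umask_freq, vmask_freq.
  set (u := cosum p (umask m s x) t) in *. set (v := cosum p (vmask m s x) t) in *.
  set (u2 := cosum p (umask m s (fun n => freq n ^ 2 * x n)) t) in *.
  set (v2 := cosum p (vmask m s (fun n => freq n ^ 2 * x n)) t) in *.
  assert (N : Cmod (u, v) ^ 2 = u ^ 2 + v ^ 2).
  { apply Cmod_sq. }
  rewrite N. rewrite HD in R1, R2.
  apply injective_projections; simpl; lra.
Qed.

Lemma H1_norm_le u E : 0 <= E ->
  (forall t, Cmod (u t) ^ 2 + Cmod (derivative u t) ^ 2 <= E ^ 2) ->
  ex_RInt (fun t => Cmod (u t) ^ 2 + Cmod (derivative u t) ^ 2) 0 (2 * PI) ->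
  0 <= H1_norm u <= sqrt (2 * PI) * E.
Proof.
intros HE HB HI. pose proof PI_RGT_0. split; [apply sqrt_pos|].
unfold H1_norm. rewrite <- (sqrt_pow2 E) at 1 by auto. rewrite <- sqrt_mult; try lra; [|apply pow2_ge_0].
apply sqrt_le_1_alt.
replace (2 * PI * E ^ 2) with (RInt (fun _ => E ^ 2) 0 (2 * PI)).
- apply RInt_le; auto; [lra|apply ex_RInt_const].
- rewrite RInt_const. unfold scal; simpl; unfold mult; simpl. ring.
Qed.

(** The difference has two sources: the coefficients, and the amplitude s of the off-class part. *)
Lemma profile_diff m p s x x0 E (B : R) :
  l1 x -> l1 x0 -> l1 (fun n => freq n ^ 2 * x n) -> l1 (fun n => freq n ^ 2 * x0 n) ->
  0 <= s <= 1 ->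
  l1_le (ssub x x0) E -> l1_le (fun n => freq n ^ 2 * ssub x x0 n) E ->
  l1_le x0 B -> l1_le (fun n => freq n ^ 2 * x0 n) B ->
  let u := fun t => (profile m p s x t - profile m p 0 x0 t)%C in
  forall t, Cmod (u t) ^ 2 + Cmod (derivative u t) ^ 2 <= (2 * (1 + INR p) * (E + s * B)) ^ 2.
Proof.
intros Hx Hx0 Hx2 Hx02 Hs HE HE2 HB HB2 u t.
assert (H0 : 0 <= 0 <= 1) by lra.
set (G := E + s * B).
assert (SD : forall n, Rabs (amp m s n - amp m 0 n) <= s).
{ intros n. unfold amp. destruct (in_class m n); rewrite Rabs_pos_eq; lra. }
assert (MK : forall y y0, l1_le (ssub y y0) E -> l1_le y0 B ->
  l1_le (ssub (umask m s y) (umask m 0 y0)) G /\ l1_le (ssub (vmask m s y) (vmask m 0 y0)) G).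
{ intros y y0 H1 H2. split.
  - apply (l1_le_ext _ (sadd (umask m s (ssub y y0)) (fun n => y0 n * repart (fun n => amp m s n - amp m 0 n) n))).
    + intros n. unfold ssub, sadd, umask, repart. destruct (Nat.odd n); ring.
    + apply l1_le_add; [apply umask_l1_le; auto|]. apply l1_le_mult; auto.
      intros n; apply repart_abs; auto; lra.
  - apply (l1_le_ext _ (sadd (vmask m s (ssub y y0)) (fun n => y0 n * impart (fun n => amp m s n - amp m 0 n) n))).
    + intros n. unfold ssub, sadd, vmask, impart. destruct (Nat.odd n); ring.
    + apply l1_le_add; [apply vmask_l1_le; auto|]. apply l1_le_mult; auto.
      intros n; apply impart_abs; auto; lra. }
destruct (MK x x0 HE HB) as [Mu Mv].
destruct (MK (fun n => freq n ^ 2 * x n) (fun n => freq n ^ 2 * x0 n)) as [Mu2 Mv2]; auto.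
{ apply (l1_le_ext _ (fun n => freq n ^ 2 * ssub x x0 n)); auto. intros n; unfold ssub; ring. }
set (eu := ssub (umask m s x) (umask m 0 x0)) in *.
set (ev := ssub (vmask m s x) (vmask m 0 x0)) in *.
assert (Fu : l1_le (fun n => freq n ^ 2 * eu n) G).
{ revert Mu2. apply l1_le_ext. intros n. unfold eu, ssub, umask; ring. }
assert (Fv : l1_le (fun n => freq n ^ 2 * ev n) G).
{ revert Mv2. apply l1_le_ext. intros n. unfold ev, ssub, vmask; ring. }
assert (CS : forall c c0, l1 c -> l1 c0 -> forall t, cosum p c t - cosum p c0 t = cosum p (ssub c c0) t).
{ intros c c0 [C HC] [C0 HC0] t'. unfold cosum.
  replace (fun n => ssub c c0 n * cos (freq n * (INR p * t'))) with
    (sadd (fun n => c n * cos (freq n * (INR p * t'))) (sscal (-1) (fun n => c0 n * cos (freq n * (INR p * t')))))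
    by (extensionality n; unfold sadd, sscal, ssub; ring).
  assert (L : l1 (fun n => c n * cos (freq n * (INR p * t')))) by
    (eexists; apply l1_le_mult; [eauto|intros; apply cos_le1]).
  assert (L0 : l1 (fun n => c0 n * cos (freq n * (INR p * t')))) by
    (eexists; apply l1_le_mult; [eauto|intros; apply cos_le1]).
  rewrite total_add, total_scal; auto using l1_scal. ring. }
assert (UM : forall y s, 0 <= s <= 1 -> l1 y -> l1 (umask m s y) /\ l1 (vmask m s y)).
{ intros y s' Hs' [Y HY]. split; exists Y; auto using umask_l1_le, vmask_l1_le. }
assert (EU : u = (fun t => (cosum p eu t, cosum p ev t))).
{ extensionality t'. unfold u. rewrite !profile_cosum.
  destruct (UM x s Hs Hx), (UM x0 0 H0 Hx0).
  unfold eu, ev. rewrite <- !CS by auto. reflexivity. }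
destruct (derive_components (cosum p eu) (cosum p ev) (cosum' p eu) (cosum' p ev)) as [_ ED].
{ intros; apply cosum_derive; eexists; eauto. }
{ intros; apply cosum_derive; eexists; eauto. }
rewrite EU, ED.
pose proof (cosum_abs p eu G t Mu) as B1. pose proof (cosum_abs p ev G t Mv) as B2.
pose proof (cosum'_abs p eu G t Fu) as B3. pose proof (cosum'_abs p ev G t Fv) as B4.
rewrite !Cmod_sq.
assert (HG : 0 <= G) by (eapply l1_le_pos; eauto). pose proof (pos_INR p) as Hp.
assert (SQ : forall a b, Rabs a <= b -> a ^ 2 <= b ^ 2).
{ intros a b Hab. rewrite <- (pow2_abs a). apply pow_incr. split; [apply Rabs_pos|auto]. }
apply SQ in B1, B2, B3, B4. fold G. 
assert (0 <= INR p * G * G) by (repeat apply Rmult_le_pos; auto).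
replace ((2 * (1 + INR p) * G) ^ 2) with (4 * G ^ 2 + 8 * (INR p * G * G) + 4 * (INR p * G) ^ 2) by ring.
pose proof (pow2_ge_0 G). pose proof (pow2_ge_0 (INR p * G)). lra.
Qed.

Section Conclude.
Context (P : newton_data) (X al th0 th e0 r : R) (HP : newton_bounds P X al th0 th e0 r).

(** The finite rank of [lap_defect] makes the second derivative of [xop h] bounded by h; this upgrades
    convergence in l^1 to convergence of two derivatives. *)
Lemma xop_freq : exists M, 0 <= M /\ forall h H, l1_le h H -> l1_le (fun n => freq n ^ 2 * xop P h n) (M * H).
Proof.
destruct (bounded_op_lap_defect P _ _ _ _ _ _ HP) as [_ [_ [M HM]]].
pose proof (nb_disp _ _ _ _ _ _ _ HP) as HD.
assert (K : forall h H, l1_le h H -> l1_le (fun n => freq n ^ 2 * xop P h n) (Rabs (/ disp P) * (M + 1) * H)).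
{ intros h H Hh.
  apply (l1_le_ext _ (sscal (/ disp P) (ssub (lap_defect P h) h))).
  - intros n. unfold sscal, ssub, lap_defect. field. lra.
  - rewrite Rmult_assoc. apply l1_le_scal. rewrite Rmult_plus_distr_r, Rmult_1_l. apply l1_le_sub; auto. }
exists (Rabs (/ disp P) * (M + 1)). split; auto.
specialize (K (delta 0) 1 (l1_le_delta 0)). apply l1_le_pos in K. lra.
Qed.

Lemma xbar_freq : l1 (fun n => freq n ^ 2 * xbar P n).
Proof.
destruct (nb_supp _ _ _ _ _ _ _ HP) as [S HS]. apply l1_le_finsupp with S.
intros n Hn. destruct (HS n Hn) as [-> _]. ring.
Qed.

Lemma pairing_near psi B y : (forall n, Rabs (psi n) <= B) -> 0 <= B -> l1_le y r ->
  B * (al * r) < Rabs (pairing psi (xbar P)) -> pairing psi (xof P y) <> 0.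
Proof.
intros Hp HB Hy Hn E.
destruct (bounded_form_pair psi B Hp) as [A [_ _]].
unfold xof in E. pose proof (xop_l1_le P _ _ _ _ _ _ HP y r Hy) as HO.
rewrite A in E; [|eexists; apply HP|eexists; eauto].
assert (Rabs (pairing psi (xop P y)) <= B * (al * r)) by (apply total_abs, l1_le_mult; auto).
replace (pairing psi (xbar P)) with (- pairing psi (xop P y)) in Hn by lra.
rewrite Rabs_Ropp in Hn. lra.
Qed.
End Conclude.

(** Multiplied by 2 sin (pi k / m), which is nonzero, the sum telescopes. *)
Lemma cos_sum_zero m k : (1 <= m)%nat -> ~ Nat.divide m k ->
  psum (fun j => cos (2 * PI * INR (k * j) / INR m)) m = 0.
Proof.
intros Hm Hk.
assert (HM : 0 < INR m) by (apply lt_0_INR; lia).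
set (x := PI * INR k / INR m).
assert (Hx : sin x <> 0).
{ intros H. apply sin_eq_0_0 in H. destruct H as [z Hz]. unfold x in Hz. pose proof PI_RGT_0.
  assert (E : INR k = IZR z * INR m).
  { apply (Rmult_eq_reg_l (PI / INR m)); [|apply Rgt_not_eq, Rdiv_lt_0_compat; lra].
    transitivity (PI * INR k / INR m); [field; lra|]. rewrite Hz. field. lra. }
  rewrite !INR_IZR_INZ, <- mult_IZR in E. apply eq_IZR in E.
  apply Hk. exists (Z.to_nat z). nia. }
assert (T : forall n, 2 * sin x * psum (fun j => cos (2 * PI * INR (k * j) / INR m)) n
   = sin (INR (2 * n) * x - x) + sin x).
{ induction n as [|n IH].
  - simpl. rewrite Rmult_0_l, Rminus_0_l, sin_neg. ring.
  - simpl psum. rewrite Rmult_plus_distr_l, IH.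
    replace (INR (2 * S n) * x - x) with (INR (2 * n) * x + x)
      by (rewrite !mult_INR, (S_INR n); simpl (INR 2); ring).
    replace (2 * PI * INR (k * n) / INR m) with (INR (2 * n) * x)
      by (unfold x; rewrite !mult_INR; simpl (INR 2); field; lra).
    rewrite sin_plus, sin_minus. ring. }
specialize (T m).
assert (E : sin (INR (2 * m) * x - x) = - sin x).
{ replace (INR (2 * m) * x - x) with (- x + 2 * INR k * PI)
    by (unfold x; rewrite mult_INR; simpl (INR 2); field; lra).
  rewrite sin_period, sin_neg; auto. }
rewrite E in T. apply (Rmult_eq_reg_l (2 * sin x)); [lra|]. lra.
Qed.

(** * Bifurcation from bounds *)

(** Pairing with x gives the jump Re a(0) - Re a(pi / q) for s = 0. *)
Definition half_period_jump (m : nat) : nat -> R :=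
  repart (fun n => if in_class m n then (if Nat.odd (Nat.div2 n / m) then 2 else 0) else 0).
(** Pairing with x gives Re w(0). *)
Definition off_class (m : nat) : nat -> R := repart (fun n => if in_class m n then 0 else 1).

Lemma pairing_lin psi phi k l B x : (forall n, Rabs (psi n) <= B) -> (forall n, Rabs (phi n) <= B) ->
  l1 x -> pairing (fun n => k * psi n + l * phi n) x = k * pairing psi x + l * pairing phi x.
Proof.
intros H1 H2 [X HX]. unfold pairing.
rewrite <- !total_scal, <- total_add by (apply l1_scal || idtac; eexists; apply l1_le_mult; eauto).
f_equal. extensionality n; unfold sadd, sscal; ring.
Qed.

Lemma cos_odd_even l : 1 - cos (INR l * PI) = if Nat.odd l then 2 else 0.
Proof.
induction l as [|l IH].
- simpl. rewrite Rmult_0_l, cos_0. ring.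
- rewrite S_INR, Rmult_plus_distr_r, Rmult_1_l, neg_cos, Nat.odd_succ, <- Nat.negb_odd.
  destruct (Nat.odd l); simpl; lra.
Qed.

Section Bifurcation.
Context (P : newton_data) (X al th0 th e0 r : R) (p : nat).
Context (HP : newton_bounds P X al th0 th e0 r) (Hp : (1 <= p)%nat).
Context (HD : disp P = 0.1 * INR p ^ 2).
Let m := ord P.
Let q := (m * p)%nat.

Lemma m_pos : 0 < INR m. Proof. apply lt_0_INR. apply HP. Qed.
Lemma p_pos : 0 < INR p. Proof. apply lt_0_INR; lia. Qed.

Lemma wave_l1 x t s : 0 <= s <= 1 -> l1 x -> l1 (fun n => x n * repart (wave m p s t) n).
Proof.
intros Hs [C HC]. eexists; apply l1_le_mult; [eauto|]. intros n.
apply (repart_abs _ 1); [lra|]. apply wave_abs; auto.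
Qed.

Lemma profile_nonconstant y : l1_le y r ->
  2 * (al * r) < Rabs (pairing (half_period_jump m) (xbar P)) ->
  nonconstant (profile m p 0 (xof P y)).
Proof.
intros Hy Hb. exists 0, (PI / INR q). intros E.
assert (H0 : 0 <= 0 <= 1) by lra. pose proof m_pos. pose proof p_pos.
apply (pairing_near P _ _ _ _ _ _ HP (half_period_jump m) 2 y); auto; try lra.
- intros n. apply (repart_abs _ 2); [lra|].
  destruct (in_class m n), (Nat.odd (Nat.div2 n / m)); rewrite ?Rabs_R0, ?Rabs_pos_eq; lra.
- apply (f_equal fst) in E. unfold profile in E. simpl in E.
  assert (Hx : l1 (xof P y)) by (eexists; eapply xof_l1_le; eauto).
  replace (half_period_jump m) with
    (fun n => 1 * repart (wave m p 0 0) n + (-1) * repart (wave m p 0 (PI / INR q)) n).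
  + rewrite (pairing_lin _ _ _ _ 1); auto; try (intros; apply re_abs; auto).
    rewrite E; ring.
  + extensionality n. unfold half_period_jump, repart, wave, amp.
    destruct (Nat.odd n); [ring|]. destruct (in_class m n) eqn:I; [|ring].
    rewrite <- cos_odd_even. apply inq_spec in I; [|apply HP]. destruct I as [l Hl].
    unfold freq. rewrite Hl. rewrite Nat.div_mul by (pose proof (nb_ord _ _ _ _ _ _ _ HP); fold m in H1; lia).
    rewrite !Rmult_0_r, cos_0.
    replace (INR (l * m) * (INR p * (PI / INR q))) with (INR l * PI).
    * ring.
    * unfold q. rewrite !mult_INR. field. split; lra.
Qed.

Lemma wave_psum_abs s K (t : nat -> R) n : 0 <= s <= 1 ->
  Rabs (psum (fun j => repart (wave m p s (t j)) n) K) <= INR K.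
Proof.
intros Hs. induction K as [|K IH]; [simpl; rewrite Rabs_R0; lra|]. rewrite S_INR. simpl psum.
eapply Rle_trans; [apply Rabs_triang|]. pose proof (re_abs m p s (t K) Hs n). lra.
Qed.

Lemma profile_psum x s K (t : nat -> R) : 0 <= s <= 1 -> l1 x ->
  psum (fun j => Re (profile m p s x (t j))) K
  = total (fun n => x n * psum (fun j => repart (wave m p s (t j)) n) K).
Proof.
intros Hs Hx. induction K as [|K IH]; cbn [psum].
- symmetry. apply total_unique. apply (is_lim_seq_ext (fun _ => 0)); [|apply is_lim_seq_const].
  intros N. symmetry. apply psum_zero. intros; ring.
- rewrite IH. unfold Re at 1, profile, pairing; cbn [fst]. rewrite <- total_add.
  + f_equal. extensionality n. unfold sadd. ring.
  + destruct Hx as [C HC]. exists (INR K * C). apply l1_le_mult; auto. intros n. apply wave_psum_abs; auto.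
  + apply wave_l1; auto.
Qed.

(** Summing the value at 0 over the m translates by 2 pi / q kills the off-class part.  If the function
    were 2 pi / q - periodic, the sum would be m times the value at 0, and Re w(0) would vanish. *)
Lemma profile_not_periodic y s : l1_le y r -> 0 < s <= 1 ->
  al * r < Rabs (pairing (off_class m) (xbar P)) ->
  ~ periodic (2 * PI / INR q) (profile m p s (xof P y)).
Proof.
intros Hy Hs Hc Hper.
assert (Hs' : 0 <= s <= 1) by lra. pose proof m_pos as Hm. pose proof p_pos as Hpp.
assert (Hx : l1 (xof P y)) by (eexists; eapply xof_l1_le; eauto).
set (x := xof P y) in *. set (T := 2 * PI / INR q) in *.
assert (B : forall n, Rabs (off_class m n) <= 1).
{ intros n. apply (repart_abs _ 1); [lra|]. destruct (in_class m n); rewrite ?Rabs_R0, ?Rabs_R1; lra. }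
apply (pairing_near P _ _ _ _ _ _ HP (off_class m) 1 y); auto; try lra. fold x.
assert (E : forall j, profile m p s x (INR j * T) = profile m p s x 0).
{ induction j as [|j IH]; [f_equal; simpl; ring|].
  rewrite <- IH, <- (Hper (INR j * T)). f_equal. rewrite S_INR; ring. }
pose proof (profile_psum x s m (fun j => INR j * T) Hs' Hx) as S1.
rewrite (psum_ext _ (fun j => Re (profile m p s x ((fun _ => 0) j)))) in S1
  by (intros; rewrite E; auto).
rewrite (profile_psum x s m (fun _ => 0) Hs' Hx) in S1.
assert (W : forall n, psum (fun j => repart (wave m p s 0) n) m
   - psum (fun j => repart (wave m p s (INR j * T)) n) m = (INR m * s) * off_class m n).
{ intros n. unfold repart, off_class. destruct (Nat.odd n) eqn:O.
  - rewrite !psum_zero by auto. unfold repart. rewrite O. ring.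
  - unfold repart. rewrite O. unfold wave. rewrite !psum_scal.
    rewrite (psum_ext (fun _ => cos (freq n * (INR p * 0))) (fun _ => 1))
      by (intros; rewrite !Rmult_0_r; apply cos_0).
    assert (C1 : psum (fun _ => 1) m = INR m).
    { clear. induction m as [|k IH]; [reflexivity|]. rewrite S_INR; simpl; lra. }
    rewrite C1.
    rewrite (psum_ext _ (fun j => cos (2 * PI * INR (Nat.div2 n * j) / INR m))).
    2:{ intros j _. f_equal. unfold freq, T, q. rewrite !mult_INR. field. split; lra. }
    unfold amp. destruct (in_class m n) eqn:I.
    + apply inq_spec in I; [|apply HP]. destruct I as [l Hl].
      rewrite (psum_ext _ (fun _ => 1)); [rewrite C1; ring|].
      intros j _. rewrite Hl. rewrite <- cos_0, <- (cos_period 0 (l * j)). f_equal.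
      rewrite !mult_INR. field. lra.
    + rewrite cos_sum_zero; [ring|apply HP|]. intros Hd. apply inq_spec in Hd; [|apply HP].
      fold m in Hd. congruence. }
(* the sum of the translates, minus m times the value at 0 *)
assert (Z : INR m * s * pairing (off_class m) x = 0).
{ unfold pairing. rewrite <- total_scal.
  - assert (LL : forall t : nat -> R, l1 (fun n => x n * psum (fun j => repart (wave m p s (t j)) n) m)).
    { intros t. destruct Hx as [C HC]. exists (INR m * C). apply l1_le_mult; auto.
      intros n. apply wave_psum_abs; auto. }
    pose proof (LL (fun _ => 0)) as L1. pose proof (LL (fun j => INR j * T)) as L2. clear LL.
    replace (sscal (INR m * s) (fun n => x n * off_class m n)) with
      (sadd (fun n => x n * psum (fun j => repart (wave m p s 0) n) m)
        (sscal (-1) (fun n => x n * psum (fun j => repart (wave m p s (INR j * T)) n) m))).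
    + rewrite total_add, total_scal; auto using l1_scal. lra.
    + extensionality n. unfold sadd, sscal. specialize (W n). 
      transitivity (x n * (psum (fun _ : nat => repart (wave m p s 0) n) m -
        psum (fun j : nat => repart (wave m p s (INR j * T)) n) m)); [ring|]. rewrite W. ring.
  - destruct Hx as [C HC]. eexists. apply l1_le_mult; eauto. }
apply Rmult_integral in Z. destruct Z as [Z|Z]; auto.
apply Rmult_integral in Z. lra.
Qed.

(** Take s = s0 / (n + 1).  The two numerical hypotheses exclude that b is constant and that
    w(0) vanishes. *)
Theorem secondary_bifurcation :
  2 * (al * r) < Rabs (pairing (half_period_jump m) (xbar P)) ->
  al * r < Rabs (pairing (off_class m) (xbar P)) ->
  exists (a : R -> C) (zeta : R),
    lle_solution 0.1 1.6 a zeta /\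
    nonconstant a /\
    periodic (2 * PI / INR q) a /\
    exists (a_ : nat -> R -> C) (zeta_ : nat -> R),
      (forall n : nat,
        lle_solution 0.1 1.6 (a_ n) (zeta_ n) /\
        periodic (2 * PI / INR p) (a_ n) /\
        ~ periodic (2 * PI / INR q) (a_ n)) /\
      H1_converges a_ a /\
      is_lim_seq zeta_ zeta.
Proof.
intros Hb Hc. pose proof m_pos as Hm. pose proof p_pos as Hpp.
destruct (zeros P _ _ _ _ _ _ HP) as [s0 [G [Hs0 HZ]]].
pose proof (al_pos P _ _ _ _ _ _ HP) as Hal.
set (Y := fun s => fixpt (newton_map P s)).
assert (HY : forall s, 0 <= s <= s0 -> l1_le (Y s) r) by (intros s Hs; apply HZ; auto).
assert (H00 : 0 <= 0 <= s0) by lra.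
destruct (xop_freq P _ _ _ _ _ _ HP) as [M [HM0 HM]].
assert (LX : forall s, 0 <= s <= s0 -> l1 (xof P (Y s)) /\ l1 (fun n => freq n ^ 2 * xof P (Y s) n)).
{ intros s Hs. split; [eexists; eapply xof_l1_le; eauto|].
  destruct (xbar_freq P _ _ _ _ _ _ HP) as [W HW].
  exists (W + M * r). apply (l1_le_ext _ (sadd (fun n => freq n ^ 2 * xbar P n) (fun n => freq n ^ 2 * xop P (Y s) n))).
  - intros n; unfold xof, sadd; ring.
  - apply l1_le_add; auto. }
assert (SOL : forall s, 0 <= s <= s0 -> lle_solution 0.1 1.6 (profile m p s (xof P (Y s))) (zof P (Y s))).
{ intros s Hs. destruct (LX s Hs). apply profile_solution; auto; [apply HP|lra|apply HZ; auto]. }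
assert (XD : forall s, 0 <= s <= s0 -> ssub (xof P (Y s)) (xof P (Y 0)) = xop P (ssub (Y s) (Y 0))).
{ intros s Hs. rewrite xop_lin. extensionality n; unfold ssub, xof, sadd; ring. }
exists (profile m p 0 (xof P (Y 0))), (zof P (Y 0)).
split; [apply SOL; auto|]. split; [apply profile_nonconstant; auto|]. split.
{ apply profile_periodic. intros n. unfold amp. destruct (in_class m n) eqn:I; auto. right.
  apply inq_spec in I; [|apply HP]. destruct I as [l Hl]. exists l.
  unfold freq, q. rewrite Hl, !mult_INR. field. split; lra. }
set (sn := fun n : nat => s0 * / (INR n + 1)).
assert (Hsn : forall n, 0 < sn n <= s0).
{ intros n. unfold sn. pose proof (pos_INR n).
  assert (0 < / (INR n + 1)) by (apply Rinv_0_lt_compat; lra).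
  assert (/ (INR n + 1) <= 1) by (rewrite <- Rinv_1; apply Rinv_le_contravar; lra).
  split; nra. }
assert (Lsn : is_lim_seq sn 0).
{ replace (Finite 0) with (Finite (s0 * 0)) by (f_equal; ring).
  apply (is_lim_seq_scal_l _ s0 0).
  apply (is_lim_seq_ext (fun n => / INR (S n))); [intros; rewrite S_INR; auto|].
  apply (is_lim_seq_incr_1 (fun n => / INR n)).
  apply (is_lim_seq_inv INR p_infty); [apply is_lim_seq_INR|discriminate]. }
exists (fun n => profile m p (sn n) (xof P (Y (sn n)))), (fun n => zof P (Y (sn n))).
split; [|split].
- intros n. pose proof (Hsn n). split; [apply SOL; lra|]. split.
  + apply profile_periodic. intros k. right. exists (Nat.div2 k). unfold freq. field. lra.
  + apply profile_not_periodic; auto; [apply HY|]; lra.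
- destruct (LX 0 H00) as [[B1 HB1] [B2 HB2]].
  set (B := B1 + B2). assert (P1 := l1_le_pos _ _ HB1). assert (P2 := l1_le_pos _ _ HB2).
  assert (HB1' : l1_le (xof P (Y 0)) B) by (eapply l1_le_le; eauto; unfold B; lra).
  assert (HB2' : l1_le (fun n => freq n ^ 2 * xof P (Y 0) n) B) by (eapply l1_le_le; eauto; unfold B; lra).
  set (K := sqrt (2 * PI) * (2 * (1 + INR p) * ((al + M) * G + B))).
  unfold H1_converges.
  apply (is_lim_seq_le_le (fun _ => 0) _ (fun n => K * sn n)).
  + intros n. pose proof (Hsn n) as S. assert (Hn : 0 <= sn n <= s0) by lra.
    assert (HG : 0 <= G * sn n) by (eapply l1_le_pos; apply (HZ (sn n)); auto).
    replace (K * sn n) with (sqrt (2 * PI) * (2 * (1 + INR p) * ((al + M) * (G * sn n) + sn n * B)))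
      by (unfold K; ring).
    apply H1_norm_le.
    * assert (0 <= (al + M) * (G * sn n)) by (apply Rmult_le_pos; lra).
      assert (0 <= sn n * B) by (apply Rmult_le_pos; unfold B; lra).
      apply Rmult_le_pos; lra.
    * destruct (LX (sn n) Hn). destruct (LX 0 H00).
      destruct (HZ (sn n) Hn) as [_ [_ HD']]. fold (Y (sn n)) (Y 0) in HD'.
      apply profile_diff; auto; try lra.
      -- rewrite XD by auto. eapply l1_le_le; [apply (xop_l1_le P _ _ _ _ _ _ HP _ _ HD')|].
         assert (0 <= M * (G * sn n)) by (apply Rmult_le_pos; lra). lra.
      -- rewrite XD by auto. eapply l1_le_le; [apply (HM _ _ HD')|].
         assert (0 <= al * (G * sn n)) by (apply Rmult_le_pos; lra). lra.
    * apply (H1_norm_integrable 0.1 1.6 (zof P (Y (sn n))) (zof P (Y 0))); apply SOL; auto.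
  + apply is_lim_seq_const.
  + replace (Finite 0) with (Finite (K * 0)) by (f_equal; ring).
    apply (is_lim_seq_scal_l _ K 0). auto.
- apply (is_lim_seq_ext (fun n => zof P (Y 0) + (zof P (Y (sn n)) - zof P (Y 0)))); [intros; ring|].
  replace (Finite (zof P (Y 0))) with (Finite (zof P (Y 0) + 0)) by (f_equal; ring).
  apply is_lim_seq_plus'; [apply is_lim_seq_const|]. apply is_lim_seq_abs_0.
  apply (is_lim_seq_le_le (fun _ => 0) _ (fun n => al * G * sn n)).
  + intros n. pose proof (Hsn n). assert (Hn : 0 <= sn n <= s0) by lra. split; [apply Rabs_pos|].
    destruct (HZ (sn n) Hn) as [_ [_ HD']]. fold (Y (sn n)) (Y 0) in HD'.
    unfold zof. replace (zbar P + zop P (Y (sn n)) - (zbar P + zop P (Y 0)))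
      with (zop P (ssub (Y (sn n)) (Y 0))) by (rewrite zop_lin; ring).
    rewrite Rmult_assoc. apply (zop_abs P _ _ _ _ _ _ HP); auto.
  + apply is_lim_seq_const.
  + replace (Finite 0) with (Finite (al * G * 0)) by (f_equal; ring).
    apply (is_lim_seq_scal_l _ (al * G) 0). auto.
Qed.
End Bifurcation.

(** * Exact computation with integer coefficients *)

Section IntegerLists.
Local Open Scope Z_scope.
(** Coefficients are accumulated in a binary trie, so that an addition at an index costs logarithmic time. *)
Inductive tree : Type := Leaf | Node (l : tree) (v : Z) (r : tree).
Fixpoint tget (t : tree) (p : positive) : Z :=
  match t, p with
  | Leaf, _ => 0
  | Node _ v _, xH => v
  | Node l _ _, xO p => tget l p
  | Node _ _ r, xI p => tget r p
  end.
Fixpoint tadd (t : tree) (p : positive) (v : Z) : tree :=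
  match p, t with
  | xH, Leaf => Node Leaf v Leaf
  | xH, Node l x r => Node l (x + v) r
  | xO p, Leaf => Node (tadd Leaf p v) 0 Leaf
  | xO p, Node l x r => Node (tadd l p v) x r
  | xI p, Leaf => Node Leaf 0 (tadd Leaf p v)
  | xI p, Node l x r => Node l x (tadd r p v)
  end.
Fixpoint zadd (l1 l2 : list Z) : list Z :=
  match l1, l2 with
  | [], _ => l2
  | _, [] => l1
  | x :: t1, y :: t2 => (x + y) :: zadd t1 t2
  end.
Definition zscale (c : Z) (l : list Z) : list Z := map (Z.mul c) l.
Definition zterm (m : nat) (v : Z) (i j : nat) (acc : tree) : tree :=
  if v =? 0 then acc else
  if in_class m i || in_class m j then
    let w := if Nat.odd i && Nat.odd j then - v else v in
    tadd (tadd acc (Pos.of_succ_nat (mode_sum i j)) w) (Pos.of_succ_nat (mode_gap i j)) w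
  else acc.
Fixpoint zrow (m : nat) (c : Z) (i : nat) (l : list Z) (j : nat) (acc : tree) : tree :=
  match l with [] => acc | y :: t => zrow m c i t (S j) (zterm m (c * y) i j acc) end.
Fixpoint zmul_from (m : nat) (l1 : list Z) (i : nat) (l2 : list Z) (acc : tree) : tree :=
  match l1 with
  | [] => acc
  | x :: t => zmul_from m t (S i) l2 (if x =? 0 then acc else zrow m x i l2 0 acc)
  end.
(** Twice the product at s = 0, see [dprod_val]; the doubling avoids fractions. *)
Definition zmul (m : nat) (l1 l2 : list Z) : list Z :=
  let t := zmul_from m l1 0 l2 Leaf in
  map (fun n => tget t (Pos.of_succ_nat n)) (seq 0 (length l1 + length l2)).
Fixpoint zconj (l : list Z) : list Z :=
  match l with x :: y :: t => x :: - y :: zconj t | _ => l end.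
Fixpoint zlap (D : Z) (l : list Z) (i : nat) : list Z :=
  match l with [] => [] | x :: t => - D * Z.of_nat (Nat.div2 i) ^ 2 * x :: zlap D t (S i) end.
Fixpoint znorm (l : list Z) : Z := match l with [] => 0 | x :: t => Z.abs x + znorm t end.
Definition zunit (j : nat) : list Z := repeat 0 j ++ [1].
Fixpoint zcomb (l : list Z) (rows : list (list Z)) (acc : list Z) : list Z :=
  match l, rows with
  | x :: t, r :: rs => zcomb t rs (if x =? 0 then acc else zadd (zscale x r) acc)
  | _, _ => acc
  end.
End IntegerLists.

Definition val (l : list Z) (n : nat) : R := IZR (nth n l 0%Z).

Lemma val_nil n : val [] n = 0.
Proof. unfold val; destruct n; reflexivity. Qed.

Lemma val_out l n : (length l <= n)%nat -> val l n = 0.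
Proof. intros H. unfold val. rewrite nth_overflow; auto. Qed.

Definition tval (t : tree) (n : nat) : R := IZR (tget t (Pos.of_succ_nat n)).

Lemma tget_tadd t p v q : tget (tadd t p v) q = (tget t q + if Pos.eqb p q then v else 0)%Z.
Proof.
revert t q. induction p as [p IH|p IH|]; intros [|l x r] [q|q|]; simpl; rewrite ?IH; simpl; lia.
Qed.

Lemma tval_tadd t n v : tval (tadd t (Pos.of_succ_nat n) v) = sadd (tval t) (sscal (IZR v) (delta n)).
Proof.
extensionality k. unfold tval, sadd, sscal, delta. rewrite tget_tadd, plus_IZR. f_equal.
destruct (Nat.eqb_spec n k) as [<-|H].
- rewrite Pos.eqb_refl. ring.
- rewrite (proj2 (Pos.eqb_neq _ _)); [simpl; ring|]. intros E. apply H. apply SuccNat2Pos.inj. exact E.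
Qed.

Lemma val_zadd l1 l2 : val (zadd l1 l2) = sadd (val l1) (val l2).
Proof.
extensionality k. unfold sadd. revert l2 k. induction l1 as [|x t IH]; intros [|y u] [|k];
  unfold val in *; simpl; rewrite ?plus_IZR; try ring. apply IH.
Qed.

Lemma val_zscale c l : val (zscale c l) = sscal (IZR c) (val l).
Proof.
extensionality k. unfold sscal. revert k. induction l as [|x t IH]; intros [|k];
  unfold val in *; simpl; rewrite ?mult_IZR; try ring. apply IH.
Qed.

Lemma val_zconj l : val (zconj l) = sconj (val l).
Proof.
extensionality n.
assert (H : forall N l n, (length l < N)%nat -> val (zconj l) n = sconj (val l) n); [|apply (H (S (length l))); lia].
clear. induction N as [|N IH]; intros l n HN; [lia|].
destruct l as [|x [|y t]].
- unfold sconj. simpl. rewrite val_nil. destruct (Nat.odd n); ring.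
- unfold sconj. cbn [zconj]. destruct n as [|n]; [reflexivity|].
  rewrite val_out by (simpl; lia). destruct (Nat.odd (S n)); ring.
- destruct n as [|[|n]]; unfold val; cbn [zconj nth].
  + reflexivity.
  + unfold sconj; simpl. apply opp_IZR.
  + unfold sconj in *. simpl in HN. specialize (IH t n ltac:(lia)). unfold val in IH. exact IH.
Qed.

Lemma val_zlap D l n : val (zlap D l 0) n = - IZR D * freq n ^ 2 * val l n.
Proof.
assert (H : forall i n, val (zlap D l i) n = - IZR D * freq (i + n) ^ 2 * val l n); [|apply H].
clear n. induction l as [|x t IH]; intros i n; cbn [zlap].
- rewrite val_nil; ring.
- destruct n as [|n].
  + unfold val, freq. cbn [nth]. rewrite !mult_IZR, opp_IZR, Nat.add_0_r, INR_IZR_INZ, pow_IZR. reflexivity.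
  + change (val (zlap D t (S i)) n = - IZR D * freq (i + S n) ^ 2 * val t n).
    rewrite IH. replace (i + S n)%nat with (S i + n)%nat by lia. reflexivity.
Qed.

Lemma psum_shift f N : psum f (S N) = f 0%nat + psum (fun n => f (S n)) N.
Proof.
induction N as [|N IH]; simpl in *; [ring|]. rewrite IH. ring.
Qed.

Lemma l1_le_val l : l1_le (val l) (IZR (znorm l)).
Proof.
induction l as [|x t IH]; intros N.
- rewrite psum_zero; [simpl; lra|]. intros; rewrite val_nil; apply Rabs_R0.
- destruct N as [|N].
  + simpl. rewrite plus_IZR, abs_IZR. pose proof (Rabs_pos (IZR x)). pose proof (l1_le_pos _ _ IH). lra.
  + rewrite psum_shift. cbn [znorm]. rewrite plus_IZR, abs_IZR. apply Rplus_le_compat; [apply Rle_refl|apply IH].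
Qed.

Lemma l1_val l : l1 (val l).
Proof. eexists; apply l1_le_val. Qed.

Lemma tval_zterm m v i j acc n :
  tval (zterm m v i j acc) n = tval acc n + 2 * (IZR v * basis_prod m 0 i j n).
Proof.
unfold zterm. destruct (Z.eqb_spec v 0) as [->|_]; [simpl; ring|].
unfold basis_prod, rho. destruct (in_class m i || in_class m j).
- rewrite !tval_tadd. unfold sadd, sscal, half_sign.
  destruct (Nat.odd i && Nat.odd j); rewrite ?opp_IZR; field.
- unfold sadd, sscal. destruct (in_class m (mode_sum i j)), (in_class m (mode_gap i j)); ring.
Qed.

Lemma tval_zrow m c i l j acc n :
  tval (zrow m c i l j acc) n
  = tval acc n + 2 * (IZR c * psum (fun k => val l k * basis_prod m 0 i (j + k) n) (length l)).
Proof.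
revert j acc. induction l as [|y t IH]; intros j acc; cbn [zrow length].
- simpl; ring.
- rewrite IH, tval_zterm, psum_shift, mult_IZR, Nat.add_0_r.
  assert (E : psum (fun k => val (y :: t) (S k) * basis_prod m 0 i (j + S k) n) (length t)
    = psum (fun k => val t k * basis_prod m 0 i (S j + k) n) (length t)).
  { apply psum_ext. intros k _. rewrite Nat.add_succ_r. reflexivity. }
  rewrite E. change (val (y :: t) 0) with (IZR y). ring.
Qed.

Lemma tval_zmul_from m l1 i l2 acc n :
  tval (zmul_from m l1 i l2 acc) n = tval acc n + 2 * psum (fun k => val l1 k *
    psum (fun j => val l2 j * basis_prod m 0 (i + k) j n) (length l2)) (length l1).
Proof.
revert i acc. induction l1 as [|x t IH]; intros i acc; cbn [zmul_from length].
- simpl; ring.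
- rewrite IH, psum_shift, Nat.add_0_r.
  assert (E : psum (fun k => val (x :: t) (S k) *
      psum (fun j => val l2 j * basis_prod m 0 (i + S k) j n) (length l2)) (length t)
    = psum (fun k => val t k * psum (fun j => val l2 j * basis_prod m 0 (S i + k) j n) (length l2)) (length t)).
  { apply psum_ext. intros k _. rewrite Nat.add_succ_r. reflexivity. }
  rewrite E. change (val (x :: t) 0) with (IZR x).
  destruct (Z.eqb_spec x 0) as [->|_]; [simpl; ring|]. rewrite tval_zrow. simpl. ring.
Qed.

Lemma total_fin f N : (forall n, (N <= n)%nat -> f n = 0) -> total f = psum f N.
Proof.
intros H. rewrite <- total_trunc. f_equal. extensionality n. unfold trunc.
destruct (Nat.ltb_spec n N); auto.
Qed.

Lemma modes_le i j : (mode_sum i j <= i + j)%nat /\ (mode_gap i j <= i + j)%nat.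
Proof.
unfold mode_sum, mode_gap, gap, parity. pose proof (Nat.div2_odd i). pose proof (Nat.div2_odd j).
destruct (Nat.odd i), (Nat.odd j); simpl Nat.b2n in *; lia.
Qed.

Lemma dprod_val m l1 l2 : dprod m 0 (val l1) (val l2) = sscal (/ 2) (val (zmul m l1 l2)).
Proof.
assert (E : forall n, dprod m 0 (val l1) (val l2) n = psum (fun i => val l1 i *
   psum (fun j => val l2 j * basis_prod m 0 i j n) (length l2)) (length l1)).
{ intros n. unfold dprod, bilin_ext, lin_ext. rewrite (total_fin _ (length l1)).
  - apply psum_ext. intros i _. f_equal. apply total_fin. intros j Hj. rewrite val_out by auto. ring.
  - intros i Hi. rewrite val_out by auto. ring. }
extensionality n. rewrite E. unfold sscal.
destruct (Nat.lt_ge_cases n (length l1 + length l2)) as [L|L].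
- assert (EV : val (zmul m l1 l2) n = tval (zmul_from m l1 0 l2 Leaf) n).
  { unfold val, zmul.
    rewrite (nth_indep _ 0%Z (tget (zmul_from m l1 0 l2 Leaf) (Pos.of_succ_nat 0)))
      by (rewrite length_map, length_seq; auto).
    rewrite (map_nth (fun n => tget _ (Pos.of_succ_nat n))), seq_nth by auto. reflexivity. }
  rewrite EV, tval_zmul_from. change (tval Leaf n) with 0.
  rewrite Rplus_0_l, <- Rmult_assoc, Rinv_l, Rmult_1_l by lra. reflexivity.
- rewrite val_out by (unfold zmul; rewrite length_map, length_seq; auto).
  rewrite Rmult_0_r. apply psum_zero. intros i Hi. rewrite psum_zero; [ring|]. intros j Hj.
  destruct (modes_le i j). unfold basis_prod, sadd, sscal. rewrite !delta_neq by lia. ring.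
Qed.

Lemma val_zcomb l rows acc n : (length l <= length rows)%nat ->
  val (zcomb l rows acc) n = val acc n + psum (fun j => val l j * val (nth j rows []) n) (length l).
Proof.
revert rows acc. induction l as [|x t IH]; intros [|r rs] acc H; simpl in H; try lia; cbn [zcomb length].
- simpl; ring.
- simpl; ring.
- rewrite IH, psum_shift by lia. cbn [nth]. change (val (x :: t) 0) with (IZR x).
  destruct (Z.eqb_spec x 0) as [->|_].
  + change (fun j => val (0%Z :: t) (S j) * val (nth j rs []) n) with (fun j => val t j * val (nth j rs []) n). ring.
  + rewrite val_zadd, val_zscale. unfold sadd, sscal.
    change (fun j => val (x :: t) (S j) * val (nth j rs []) n) with (fun j => val t j * val (nth j rs []) n). ring.
Qed.

Lemma val_zunit j : val (zunit j) = delta j.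
Proof.
extensionality n. unfold val, delta. revert n.
induction j as [|j IH]; intros [|n]; try reflexivity.
- destruct n; reflexivity.
- apply IH.
Qed.

(** Boundedness is not assumed, so this applies to the second derivative. *)
Lemma lin_val (F : (nat -> R) -> R) l :
  (forall a b, l1 a -> l1 b -> F (sadd a b) = F a + F b) ->
  (forall k a, l1 a -> F (sscal k a) = k * F a) ->
  F (val l) = psum (fun j => val l j * F (delta j)) (length l).
Proof.
intros HA HS.
assert (HT : forall N, F (trunc N (val l)) = psum (fun k => val l k * F (delta k)) N).
{ induction N as [|N IH]; simpl.
  - replace (trunc 0 (val l)) with (sscal 0 (val l)) by (extensionality n; unfold trunc, sscal; simpl; ring).
    rewrite HS; [ring|apply l1_val].
  - rewrite <- IH, <- HS, <- HA; auto using l1_scal, l1_delta.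
    + f_equal. extensionality n. unfold trunc, sadd, sscal, delta.
      destruct (Nat.eqb_spec N n), (Nat.ltb_spec n N), (Nat.ltb_spec n (S N)); subst; try lia; ring.
    + eexists; apply l1_le_trunc, l1_le_val. }
rewrite <- HT. f_equal. extensionality n. unfold trunc.
destruct (Nat.ltb_spec n (length l)); auto. apply val_out; auto.
Qed.

(** * Certificates *)

(** [c_x] and [c_zeta] are in units of 1 / [c_unit], the columns in units of 1 / [c_cunit].  Bounds are
    integers too: [c_al], [c_th0], [c_th] in thousandths and [c_e0], [c_r] in units of 10^-9.  In each
    of the certificates below, all columns vanish at one off-class index; its coefficient keeps the value
    prescribed in [c_x], which normalises w, and zeta is the unknown that replaces it. *)
Record certificate := Certificate {
  c_ord : nat; c_wave : nat;
  c_unit : Z; c_zeta : Z; c_x : list Z;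
  c_cunit : Z; c_cols : list (Z * list Z);
  c_al : Z; c_th0 : Z; c_e0 : Z; c_r : Z; c_th : Z }.

Definition c_data (c : certificate) : newton_data := {|
  ord := c_ord c; disp := 0.1 * INR (c_wave c) ^ 2;
  zbar := IZR (c_zeta c) / IZR (c_unit c);
  xbar := sscal (/ IZR (c_unit c)) (val (c_x c));
  dim := length (c_cols c);
  zcol := fun k => IZR (fst (nth k (c_cols c) (0%Z, []))) / IZR (c_cunit c);
  xcol := fun k => sscal (/ IZR (c_cunit c)) (val (snd (nth k (c_cols c) (0%Z, [])))) |}.

Section Checks.
Local Open Scope Z_scope.
Context (c : certificate).
Let m := c_ord c.
Let S := c_unit c.
Let D := Z.of_nat (c_wave c) ^ 2.
Let x := c_x c.

(** The norm of 40 S^3 times the residual, where S is the unit of [c_x]. *)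
Definition res_num : Z :=
  let s2 := S * S in
  znorm (zadd (zscale (4 * s2) (zlap D x 0))
   (zadd (zscale (20 * s2) (zmul m [0; 1] x))
   (zadd (zscale (- 40 * S * c_zeta c) x)
   (zadd (zscale 10 (zmul m (zmul m x x) (zconj x))) [0; - 64 * s2 * S])))).

(** 20 S^2 times the derivative of the residual in the direction of the j-th unit sequence, zeta being fixed. *)
Definition lin_num (xx xc : list Z) (j : nat) : list Z :=
  let e := zunit j in
  zadd (zscale (2 * S * S) (zlap D e 0))
  (zadd (zscale (10 * S * S) (zmul m [0; 1] e))
  (zadd (zscale (- 20 * S * c_zeta c) e)
  (zscale 5 (zadd (zmul m (zadd (zmul m e x) (zmul m x e)) xc) (zmul m xx (zconj e)))))).

(** The k-th column of [defect], scaled by 20 S^2 times the unit of the columns.  The derivative of the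
    residual is applied by combining its columns [rows], which are computed once. *)
Definition defect_num (rows : list (list Z)) (k : nat) : list Z :=
  let (z, l) := nth k (c_cols c) (0, []) in
  zadd (zscale (20 * S * S * c_cunit c) (zunit k))
    (zadd (zscale (-1) (zcomb l rows [])) (zscale (20 * S * z) x)).

Definition weight_sum (w : nat -> Z) : Z :=
  fold_right Z.add 0 (map (fun n => nth n x 0 * w n) (seq 0 (length x))).

Definition jump_num : Z := weight_sum (fun n => if Nat.odd n then 0 else
  if in_class m n then (if Nat.odd (Nat.div2 n / m) then 2 else 0) else 0).
Definition off_num : Z := weight_sum (fun n => if Nat.odd n then 0 else
  if in_class m n then 0 else 1).

Definition check_linear : bool :=
  let n := length (c_cols c) in
  let xx := zmul m x x in let xc := zconj x in
  let rows := map (lin_num xx xc) (seq 0 n) in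
  forallb (fun k => znorm (defect_num rows k) * 1000 <=? c_th0 c * (20 * S * S * c_cunit c)) (seq 0 n).

Definition check_columns : bool :=
  forallb (fun zl => (length (snd zl) <=? length (c_cols c))%nat
      && (znorm (snd zl) * 1000 <=? c_al c * c_cunit c)
      && (Z.abs (fst zl) * 1000 <=? c_al c * c_cunit c)) (c_cols c).

(** The inequalities of [newton_bounds] and [secondary_bifurcation] after multiplication by common
    denominators; K is ten times the dispersion d p^2 k^2 at the frequency k = n / 2, from which on the inverse of the
    second derivative is used. *)
Definition check_constants : bool :=
  let n := length (c_cols c) in
  let X := znorm x in let A := c_al c in let r := c_r c in
  let K := D * Z.of_nat (Nat.div2 n) ^ 2 in
  (1 <=? m)%nat && (1 <=? c_wave c)%nat && (2 <=? n)%nat && (0 <? S) && (0 <? c_cunit c)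
  && (10000 <=? A * K)
  && ((S * S + Z.abs (c_zeta c) * S + 3 * (X * X)) * 10000 <=? c_th0 c * (K * (S * S)))
  && (res_num * 10 ^ 9 <=? c_e0 c * (40 * (S * S * S)))
  && (c_th0 c * 10 ^ 24 * S + 2 * (A * A * r) * 10 ^ 12 * S
      + 6 * (A * A * r) * (X * 10 ^ 12 + A * r * S) <? c_th c * 10 ^ 24 * S)
  && (c_th c <? 1000) && (0 <? r) && (c_e0 c * 1000 <? (1000 - c_th c) * r)
  && (2 * (A * r) * S <? Z.abs jump_num * 10 ^ 12)
  && (A * r * S <? Z.abs off_num * 10 ^ 12).
End Checks.

Section Soundness.
Context (c : certificate).
Context (HL : check_linear c = true) (HC : check_columns c = true) (HK : check_constants c = true).
Let P := c_data c.
Let m := c_ord c.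
Let S := IZR (c_unit c).
Let SA := IZR (c_cunit c).
Let x := c_x c.

Lemma const_split :
  let n := length (c_cols c) in
  let X := znorm (c_x c) in let A := c_al c in let r := c_r c in let S := c_unit c in
  let K := (Z.of_nat (c_wave c) ^ 2 * Z.of_nat (Nat.div2 n) ^ 2)%Z in
  ((1 <= c_ord c)%nat /\ (1 <= c_wave c)%nat /\ (2 <= n)%nat) /\ (0 < S /\ 0 < c_cunit c /\
  10000 <= A * K /\
  (S * S + Z.abs (c_zeta c) * S + 3 * (X * X)) * 10000 <= c_th0 c * (K * (S * S)) /\
  res_num c * 10 ^ 9 <= c_e0 c * (40 * (S * S * S)) /\
  c_th0 c * 10 ^ 24 * S + 2 * (A * A * r) * 10 ^ 12 * S
      + 6 * (A * A * r) * (X * 10 ^ 12 + A * r * S) < c_th c * 10 ^ 24 * S /\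
  c_th c < 1000 /\ 0 < r /\ c_e0 c * 1000 < (1000 - c_th c) * r /\
  2 * (A * r) * S < Z.abs (jump_num c) * 10 ^ 12 /\
  A * r * S < Z.abs (off_num c) * 10 ^ 12)%Z.
Proof.
unfold check_constants in HK. cbv zeta in *.
rewrite !andb_true_iff, !Nat.leb_le, !Z.leb_le, !Z.ltb_lt in HK.
intuition.
Qed.

Lemma S_pos : 0 < S. Proof. apply IZR_lt. apply const_split. Qed.
Lemma SA_pos : 0 < SA. Proof. apply IZR_lt. apply const_split. Qed.

Lemma xbar_val : xbar P = sscal (/ S) (val x).
Proof. reflexivity. Qed.

Lemma dprod_scal a b k l : l1 a -> l1 b ->
  dprod m 0 (sscal k a) (sscal l b) = sscal (k * l) (dprod m 0 a b).
Proof.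
intros Ha Hb. assert (H0 : 0 <= 0 <= 1) by lra.
unfold dprod. rewrite (bilin_ext_scal_l _ 1), (bilin_ext_scal_r _ 1); auto using basis_prod_fam, l1_scal.
extensionality n; unfold sscal; ring.
Qed.

Lemma val_01 : val [0; 1]%Z = delta 1.
Proof. extensionality n. unfold val, delta. destruct n as [|[|n]]; simpl; auto. destruct n; auto. Qed.

Lemma dprod_delta1 a : dprod m 0 (delta 1) (val a) = sscal (/ 2) (val (zmul m [0; 1]%Z a)).
Proof. rewrite <- val_01. apply dprod_val. Qed.

Lemma disp_num : disp P = IZR (Z.of_nat (c_wave c) ^ 2) / 10.
Proof. change (disp P) with (0.1 * INR (c_wave c) ^ 2).
rewrite INR_IZR_INZ, pow_IZR. change (Z.of_nat 2) with 2%Z. lra. Qed.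

Lemma residual_num : l1_le (residual P 0 (zbar P) (xbar P)) (IZR (res_num c) / (40 * S ^ 3)).
Proof.
pose proof S_pos as HS.
unfold res_num. cbv zeta.
match goal with |- context [znorm ?l] => set (L := l) end.
apply (l1_le_ext _ (sscal (/ (40 * S ^ 3)) (val L))).
2:{ eapply l1_le_le; [apply l1_le_scal, l1_le_val|]. rewrite Rabs_pos_eq; [right; field; lra|].
    left. apply Rinv_0_lt_compat. assert (0 < S ^ 3) by (apply pow_lt; auto). lra. }
intros n. unfold sscal at 1. unfold L. rewrite !val_zadd, !val_zscale. unfold sadd, sscal.
rewrite val_zlap.
unfold residual, cubic. rewrite xbar_val. change (ord P) with m.
rewrite dprod_scal by apply l1_val. rewrite dprod_val, sconj_scal, <- val_zconj.
assert (E : sscal (/ S * / S) (sscal (/ 2) (val (zmul m x x))) = sscal (/ S * / S * / 2) (val (zmul m x x))).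
{ extensionality k; unfold sscal; ring. }
rewrite E, dprod_scal by apply l1_val. rewrite dprod_val.
assert (E1 : dprod m 0 (delta 1) (sscal (/ S) (val x)) = sscal (/ S) (sscal (/ 2) (val (zmul m [0; 1]%Z x)))).
{ rewrite <- dprod_delta1. apply bilin_ext_scal_r with 1; auto using basis_prod_fam, l1_delta, l1_val.
  apply basis_prod_fam; lra. }
rewrite E1, disp_num. change (zbar P) with (IZR (c_zeta c) / S).
assert (E2 : val [0; - 64 * (c_unit c * c_unit c) * c_unit c]%Z n = - 64 * S * S * S * delta 1 n).
{ unfold val. destruct n as [|[|n]]; cbn [nth].
  - rewrite (delta_neq 1 0) by lia. ring.
  - rewrite delta_same, !mult_IZR. fold S. ring.
  - rewrite (delta_neq 1) by lia. destruct n; ring. }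
rewrite E2. unfold sscal. fold x m. rewrite !mult_IZR. fold S.
replace 1.6 with (16 / 10) by lra. field. lra.
Qed.

Lemma l1_xbar0 : l1 (xbar P).
Proof. rewrite xbar_val. apply l1_scal, l1_val. Qed.

Definition lin_op (h : nat -> R) (n : nat) : R :=
  - disp P * freq n ^ 2 * h n + dprod m 0 (delta 1) h n - zbar P * h n + dcubic P h n.

Lemma lin_op_add a b n : l1 a -> l1 b -> lin_op (sadd a b) n = lin_op a n + lin_op b n.
Proof.
intros Ha Hb. unfold lin_op. destruct (bounded_op_dtri P l1_xbar0) as [A [_ _]].
rewrite A, dprod_add_r by (auto using l1_delta; lra). unfold sadd. ring.
Qed.

Lemma lin_op_scal k a n : l1 a -> lin_op (sscal k a) n = k * lin_op a n.
Proof.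
intros Ha. unfold lin_op. destruct (bounded_op_dtri P l1_xbar0) as [_ [A _]].
destruct (bounded_op_prd_r m 0 (delta 1) ltac:(lra) (l1_delta 1)) as [_ [B _]].
rewrite A, B by auto. unfold sscal. ring.
Qed.

Lemma zmul_add_l a b l : val (zmul m (zadd a b) l) = sadd (val (zmul m a l)) (val (zmul m b l)).
Proof.
assert (E : forall u v, val (zmul m u v) = sscal 2 (dprod m 0 (val u) (val v))).
{ intros u v. rewrite dprod_val. extensionality n; unfold sscal. field. }
rewrite !E, val_zadd, dprod_add_l by (auto using l1_val; lra).
extensionality n; unfold sscal, sadd; ring.
Qed.

Lemma cubic_num e1 e2 e3 k1 k2 k3 n :
  cubic m 0 (sscal k1 (val e1)) (sscal k2 (val e2)) (sscal k3 (val e3)) n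
  = k1 * k2 * k3 / 4 * val (zmul m (zmul m e1 e2) (zconj e3)) n.
Proof.
unfold cubic. rewrite dprod_scal by apply l1_val. rewrite dprod_val, sconj_scal, <- val_zconj.
assert (E : sscal (k1 * k2) (sscal (/ 2) (val (zmul m e1 e2))) = sscal (k1 * k2 * / 2) (val (zmul m e1 e2))).
{ extensionality k; unfold sscal; ring. }
rewrite E, dprod_scal by apply l1_val. rewrite dprod_val. unfold sscal. field.
Qed.

Lemma lin_op_num j n : lin_op (delta j) n =
  / (20 * S ^ 2) * val (lin_num c (zmul m x x) (zconj x) j) n.
Proof.
pose proof S_pos as HS.
unfold lin_num. cbv zeta. fold m x. set (e := zunit j).
rewrite !val_zadd, !val_zscale. unfold sadd at 1 2 3, sscal at 1 2 3.
rewrite val_zlap. unfold sscal at 1. rewrite val_zadd, zmul_add_l. unfold sadd.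
unfold lin_op, dcubic. change (ord P) with m. rewrite xbar_val.
assert (E : delta j = sscal 1 (val e)).
{ unfold e. rewrite val_zunit. extensionality k; unfold sscal; ring. }
rewrite E. unfold sadd. rewrite !cubic_num. rewrite <- E.
assert (E1 : dprod m 0 (delta 1) (delta j) n = / 2 * val (zmul m [0; 1]%Z e) n).
{ rewrite <- (val_zunit j). fold e. rewrite dprod_delta1. reflexivity. }
rewrite E1, disp_num. change (zbar P) with (IZR (c_zeta c) / S).
assert (E2 : val e = delta j) by apply val_zunit.
rewrite E2, !mult_IZR. fold S. field. lra.
Qed.

Lemma defect_col k n : (k < length (c_cols c))%nat ->
  defect P (delta k) n = / (20 * S ^ 2 * SA) *
    val (defect_num c (map (lin_num c (zmul m x x) (zconj x)) (seq 0 (length (c_cols c)))) k) n.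
Proof.
intros Hk. pose proof S_pos as HS. pose proof SA_pos as HSA.
set (a := xcol P k).
assert (EX : xop P (delta k) = a).
{ extensionality i. rewrite xop_delta. change (dim P) with (length (c_cols c)).
  rewrite (proj2 (Nat.ltb_lt _ _) Hk). reflexivity. }
assert (EZ : zop P (delta k) = zcol P k).
{ unfold zop. rewrite (psum_delta k (zcol P)). change (dim P) with (length (c_cols c)).
  rewrite (proj2 (Nat.ltb_lt _ _) Hk). reflexivity. }
transitivity (delta k n - lin_op a n + zcol P k * xbar P n).
{ unfold defect, lap_defect, lin_op. rewrite EX, EZ. change (ord P) with m. ring. }
unfold defect_num. fold x.
assert (Ha : a = sscal (/ SA) (val (snd (nth k (c_cols c) (0%Z, []))))) by reflexivity.
assert (Hz : zcol P k = IZR (fst (nth k (c_cols c) (0%Z, []))) / SA) by reflexivity.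
rewrite Ha, Hz, lin_op_scal by apply l1_val.
assert (Hlen : (length (snd (nth k (c_cols c) (0%Z, []))) <= length (c_cols c))%nat).
{ unfold check_columns in HC. rewrite forallb_forall in HC.
  specialize (HC (nth k (c_cols c) (0%Z, [])) (nth_In _ _ Hk)).
  rewrite !andb_true_iff, Nat.leb_le in HC. apply HC. }
destruct (nth k (c_cols c) (0%Z, [])) as [z l]. cbn [fst snd] in *.
rewrite !val_zadd, !val_zscale, val_zunit. unfold sadd, sscal.
rewrite val_zcomb by (rewrite length_map, length_seq; auto).
rewrite val_nil, Rplus_0_l.
rewrite (lin_val (fun h => lin_op h n) l) by (intros; auto using lin_op_add, lin_op_scal).
rewrite (psum_ext (fun j => val l j * val (nth j (map _ _) []) n)
   (fun j => 20 * S ^ 2 * (val l j * lin_op (delta j) n))).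
- rewrite psum_scal, xbar_val. unfold sscal. rewrite !mult_IZR. fold S SA. field. lra.
- intros j Hj. rewrite lin_op_num.
  rewrite (nth_indep _ [] (lin_num c (zmul m x x) (zconj x) 0)) by (rewrite length_map, length_seq; lia).
  rewrite map_nth, seq_nth by lia. rewrite Nat.add_0_l. field. lra.
Qed.

Lemma IZR_sum (f : nat -> Z) i L :
  IZR (fold_right Z.add 0%Z (map f (seq i L))) = psum (fun n => IZR (f (i + n)%nat)) L.
Proof.
revert i. induction L as [|L IH]; intros i; [reflexivity|].
cbn [seq map fold_right]. rewrite plus_IZR, IH, psum_shift, Nat.add_0_r. f_equal.
apply psum_ext. intros n _. rewrite Nat.add_succ_r. reflexivity.
Qed.

Lemma pairing_num psi w : (forall n, psi n = IZR (w n)) ->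
  pairing psi (xbar P) = IZR (weight_sum c w) / S.
Proof.
intros Hw. rewrite xbar_val. unfold pairing, weight_sum. fold x.
rewrite (total_fin _ (length x)).
- rewrite IZR_sum. unfold Rdiv. rewrite Rmult_comm, <- psum_scal. apply psum_ext.
  intros n _. rewrite mult_IZR, Hw. unfold sscal, val. simpl. ring.
- intros n Hn. unfold sscal. rewrite val_out by auto. ring.
Qed.

Lemma jump_pairing : pairing (half_period_jump m) (xbar P) = IZR (jump_num c) / S.
Proof.
apply pairing_num. intros n. unfold half_period_jump, repart. fold m.
destruct (Nat.odd n), (in_class m n), (Nat.odd (Nat.div2 n / m)); reflexivity.
Qed.

Lemma off_pairing : pairing (off_class m) (xbar P) = IZR (off_num c) / S.
Proof.
apply pairing_num. intros n. unfold off_class, repart. fold m.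
destruct (Nat.odd n), (in_class m n); reflexivity.
Qed.

Let X := IZR (znorm x) / S.
Let al := IZR (c_al c) / 1000.
Let th0 := IZR (c_th0 c) / 1000.
Let th := IZR (c_th c) / 1000.
Let e0 := IZR (c_e0 c) / 1000000000.
Let r := IZR (c_r c) / 1000000000.

Lemma l1_le_xbar : l1_le (xbar P) X.
Proof.
pose proof S_pos. rewrite xbar_val. eapply l1_le_le; [apply l1_le_scal, l1_le_val|].
rewrite Rabs_pos_eq; [right; unfold X; field; lra|]. left; apply Rinv_0_lt_compat; auto.
Qed.

Lemma frac_le a b k : 0 < b -> a <= k * b -> a / b <= k.
Proof. intros Hb H. apply (Rmult_le_reg_r b); auto. unfold Rdiv. rewrite Rmult_assoc, Rinv_l; lra. Qed.

Let K := IZR (Z.of_nat (c_wave c) ^ 2 * Z.of_nat (Nat.div2 (length (c_cols c))) ^ 2).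

Lemma xtail_abs n : (length (c_cols c) <= n)%nat -> 0 < K /\ Rabs (xtail P n) <= 10 / K.
Proof.
intros Hn. destruct const_split as [[_ [Hp Hd]] _].
assert (H1 : 0 < IZR (Z.of_nat (c_wave c) ^ 2)).
{ apply IZR_lt. nia. }
assert (HD2 : (1 <= Nat.div2 (length (c_cols c)))%nat).
{ rewrite Nat.div2_div. apply Nat.div_le_lower_bound; lia. }
assert (Hle : (Nat.div2 (length (c_cols c)) <= Nat.div2 n)%nat).
{ rewrite !Nat.div2_div. apply Nat.Div0.div_le_mono; auto. }
set (F := IZR (Z.of_nat (Nat.div2 (length (c_cols c))))).
assert (HF : 1 <= F) by (apply IZR_le; lia).
assert (HFn : F <= freq n) by (unfold freq, F; rewrite INR_IZR_INZ; apply IZR_le; lia).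
assert (EK : K = IZR (Z.of_nat (c_wave c) ^ 2) * F ^ 2).
{ unfold K, F. rewrite mult_IZR, pow_IZR. reflexivity. }
assert (HF2 : 0 < F ^ 2) by (apply pow_lt; lra).
assert (HFF : F ^ 2 <= freq n ^ 2) by (apply pow_incr; lra).
split; [rewrite EK; apply Rmult_lt_0_compat; auto|].
unfold xtail. change (dim P) with (length (c_cols c)).
rewrite (proj2 (Nat.ltb_ge _ _) Hn), Rabs_Ropp, disp_num, EK.
set (w := IZR (Z.of_nat (c_wave c) ^ 2)) in *.
rewrite Rabs_pos_eq.
- replace (10 / (w * F ^ 2)) with (/ (w / 10 * F ^ 2)) by (field; lra).
  apply Rinv_le_contravar; [apply Rmult_lt_0_compat; lra|]. apply Rmult_le_compat_l; lra.
- left. apply Rinv_0_lt_compat, Rmult_lt_0_compat; lra.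
Qed.

(** The second derivative cancels, and what remains of the derivative of the residual is a bounded operator
    applied to a vector of size 1 / (d p^2 k^2). *)
Lemma defect_tail k : (length (c_cols c) <= k)%nat ->
  l1_le (defect P (delta k)) (Rabs (xtail P k) * (1 + Rabs (zbar P) + 3 * X ^ 2)).
Proof.
intros Hk. assert (H0 : 0 <= 0 <= 1) by lra.
destruct const_split as [[Hm [Hp Hd]] _].
set (t := xtail P k).
assert (EX : xop P (delta k) = sscal t (delta k)).
{ extensionality i. rewrite xop_delta. change (dim P) with (length (c_cols c)).
  rewrite (proj2 (Nat.ltb_ge _ _) Hk). reflexivity. }
assert (EZ : zop P (delta k) = 0).
{ unfold zop. rewrite (psum_delta k (zcol P)). change (dim P) with (length (c_cols c)).
  rewrite (proj2 (Nat.ltb_ge _ _) Hk). reflexivity. }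
assert (ET : lap_defect P (delta k) = fun _ => 0).
{ extensionality n. unfold lap_defect. rewrite EX. unfold sscal.
  destruct (Nat.eq_dec k n) as [<-|Hn]; [|rewrite delta_neq by auto; ring].
  unfold t, xtail. change (dim P) with (length (c_cols c)).
  rewrite (proj2 (Nat.ltb_ge _ _) Hk), delta_same.
  assert (0 < disp P).
  { change (disp P) with (0.1 * INR (c_wave c) ^ 2). assert (0 < INR (c_wave c)) by (apply lt_0_INR; lia).
    apply Rmult_lt_0_compat; [lra|apply pow_lt; auto]. }
  assert (0 < freq k).
  { apply lt_0_INR. rewrite Nat.div2_div. apply Nat.div_str_pos; lia. }
  field. split; apply Rgt_not_eq; assumption. }
assert (Ht : l1_le (sscal t (delta k)) (Rabs t)).
{ eapply l1_le_le; [apply l1_le_scal, l1_le_delta|lra]. }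
set (xb := xbar P). assert (Hx : l1_le xb X) by apply l1_le_xbar.
apply (l1_le_ext _ (sadd (ssub (sscal (zbar P) (sscal t (delta k))) (dprod m 0 (delta 1) (sscal t (delta k))))
  (sscal (-1) (dcubic P (sscal t (delta k)))))).
- intros n. unfold defect. rewrite EX, EZ, ET. unfold sadd, ssub, sscal. change (ord P) with m. ring.
- apply l1_le_le with ((Rabs (zbar P) * Rabs t + 1 * Rabs t) + (Rabs t * X * X + X * Rabs t * X + X * X * Rabs t));
    [|right; ring].
  apply l1_le_add; [apply l1_le_sub; [apply l1_le_scal; auto|apply dprod_l1_le; auto using l1_le_delta]|].
  apply l1_le_opp. unfold dcubic. fold xb. repeat apply l1_le_add; apply cubic_l1_le; auto.
Qed.

Lemma certificate_bounds : newton_bounds P X al th0 th e0 r.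
Proof.
destruct const_split as [[Hm [Hp Hd]] (K1 & K2 & K3 & K4 & K5 & K6 & K7 & K8 & K9 & _)].
pose proof S_pos as HS. pose proof SA_pos as HSA.
assert (HX : 0 <= X) by (eapply l1_le_pos; apply l1_le_xbar).
assert (HKA : 0 < K -> 10 / K <= al).
{ intros HK0. apply frac_le; auto. apply IZR_le in K3. rewrite mult_IZR in K3. fold K in K3. unfold al. lra. }
assert (Hal : 0 <= al).
{ destruct (xtail_abs _ (le_n _)) as [HK0 H]. pose proof (Rabs_pos (xtail P (length (c_cols c)))).
  specialize (HKA HK0). lra. }
constructor.
- exact Hm.
- rewrite disp_num. assert (0 < IZR (Z.of_nat (c_wave c) ^ 2)) by (apply IZR_lt; nia). lra.
- exact Hd.
- exists (Nat.max (length x) (length (c_cols c))). intros n Hn. split.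
  + rewrite xbar_val. unfold sscal. rewrite val_out by lia. ring.
  + intros k. change (xcol P k n) with (/ SA * val (snd (nth k (c_cols c) (0%Z, []))) n).
    rewrite val_out; [ring|].
    destruct (Nat.lt_ge_cases k (length (c_cols c))) as [Hk|Hk].
    * unfold check_columns in HC. rewrite forallb_forall in HC.
      specialize (HC (nth k (c_cols c) (0%Z, [])) (nth_In _ _ Hk)).
      rewrite !andb_true_iff, Nat.leb_le in HC. lia.
    * rewrite nth_overflow by auto. simpl. lia.
- apply l1_le_xbar.
- intros k Hk. unfold check_columns in HC. rewrite forallb_forall in HC.
  specialize (HC (nth k (c_cols c) (0%Z, [])) (nth_In _ _ Hk)).
  rewrite !andb_true_iff, Nat.leb_le, !Z.leb_le in HC. destruct HC as [[_ C1] C2].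
  apply IZR_le in C1, C2. rewrite !mult_IZR in C1, C2. fold SA in C1, C2.
  change (zcol P k) with (IZR (fst (nth k (c_cols c) (0%Z, []))) / SA).
  change (xcol P k) with (sscal (/ SA) (val (snd (nth k (c_cols c) (0%Z, []))))).
  split.
  + eapply l1_le_le; [apply l1_le_scal, l1_le_val|]. rewrite Rabs_pos_eq by (left; apply Rinv_0_lt_compat; auto).
    rewrite Rmult_comm. apply frac_le; auto. unfold al. lra.
  + unfold Rdiv. rewrite Rabs_mult, (Rabs_pos_eq (/ SA)) by (left; apply Rinv_0_lt_compat; auto).
    apply frac_le; auto. rewrite <- abs_IZR. unfold al. lra.
- intros n. destruct (Nat.lt_ge_cases n (length (c_cols c))) as [Hn|Hn].
  + unfold xtail. change (dim P) with (length (c_cols c)).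
    rewrite (proj2 (Nat.ltb_lt _ _) Hn), Rabs_R0. auto.
  + destruct (xtail_abs _ Hn) as [HK0 H]. specialize (HKA HK0). lra.
- intros k. destruct (Nat.lt_ge_cases k (length (c_cols c))) as [Hk|Hk].
  + unfold check_linear in HL. rewrite forallb_forall in HL.
    specialize (HL k (proj2 (in_seq _ _ _) (conj (Nat.le_0_l k) Hk))).
    rewrite Z.leb_le in HL. fold x m in HL. apply IZR_le in HL. rewrite !mult_IZR in HL. fold S SA in HL.
    set (rows := map (lin_num c (zmul m x x) (zconj x)) (seq 0 (length (c_cols c)))) in HL.
    assert (HQ : 0 < 20 * S ^ 2 * SA).
    { assert (0 < S ^ 2) by (apply pow_lt; auto). repeat apply Rmult_lt_0_compat; lra. }
    apply (l1_le_ext _ (sscal (/ (20 * S ^ 2 * SA)) (val (defect_num c rows k)))).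
    { intros n; apply defect_col; auto. }
    eapply l1_le_le; [apply l1_le_scal, l1_le_val|].
    rewrite Rabs_pos_eq by (left; apply Rinv_0_lt_compat; auto).
    rewrite Rmult_comm. apply frac_le; auto. unfold th0.
    replace (S ^ 2) with (S * S) by ring. lra.
  + destruct (xtail_abs _ Hk) as [HK0 H].
    eapply l1_le_le; [apply defect_tail; auto|].
    set (Y := 1 + Rabs (zbar P) + 3 * X ^ 2).
    assert (HY : 0 <= Y) by (unfold Y; pose proof (Rabs_pos (zbar P)); pose proof (pow2_ge_0 X); lra).
    apply Rle_trans with (10 / K * Y); [apply Rmult_le_compat_r; auto|].
    replace (10 / K * Y) with (10 * Y / K) by (field; lra). apply frac_le; auto.
    assert (EY : Y = (S * S + IZR (Z.abs (c_zeta c)) * S + 3 * (IZR (znorm x) * IZR (znorm x))) / (S * S)).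
    { unfold Y, X. change (zbar P) with (IZR (c_zeta c) / S).
      unfold Rdiv at 1. rewrite Rabs_mult, (Rabs_pos_eq (/ S)), <- abs_IZR by (left; apply Rinv_0_lt_compat; auto).
      field. lra. }
    apply IZR_le in K4. rewrite (mult_IZR _ 10000), (mult_IZR (c_th0 c)), (mult_IZR _ (c_unit c * c_unit c)) in K4.
    fold K in K4. rewrite !plus_IZR, !mult_IZR in K4. fold S x in K4.
    rewrite EY. unfold th0.
    set (N := S * S + IZR (Z.abs (c_zeta c)) * S + 3 * (IZR (znorm x) * IZR (znorm x))) in *.
    replace (10 * (N / (S * S))) with (10 * N / (S * S)) by (field; lra).
    assert (0 < S * S) by (apply Rmult_lt_0_compat; auto).
    apply frac_le; auto. lra.
- eapply l1_le_le; [apply residual_num|].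
  assert (0 < S ^ 3) by (apply pow_lt; auto). apply frac_le; [lra|].
  apply IZR_le in K5. rewrite !mult_IZR in K5. fold S in K5.
  change (IZR (10 ^ 9)) with 1000000000 in K5. unfold e0.
  replace (S ^ 3) with (S * S * S) by ring. lra.
- unfold r. apply IZR_lt in K8. lra.
- apply IZR_lt in K6. rewrite !plus_IZR, !mult_IZR, !plus_IZR, !mult_IZR in K6. fold S x in K6.
  change (IZR (10 ^ 24)) with 1000000000000000000000000 in K6.
  change (IZR (10 ^ 12)) with 1000000000000 in K6.
  unfold th0, al, r, th, X.
  apply (Rmult_lt_reg_r (10 ^ 27 * S)); [apply Rmult_lt_0_compat; [apply pow_lt; lra|auto]|].
  match goal with |- ?l < ?r => replace l with (IZR (c_th0 c) * 1000000000000000000000000 * S +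
     2 * (IZR (c_al c) * IZR (c_al c) * IZR (c_r c)) * 1000000000000 * S +
     6 * (IZR (c_al c) * IZR (c_al c) * IZR (c_r c)) *
     (IZR (znorm x) * 1000000000000 + IZR (c_al c) * IZR (c_r c) * S)) by (field; lra);
     replace r with (IZR (c_th c) * 1000000000000000000000000 * S) by (field; lra) end.
  lra.
- apply IZR_lt in K7. unfold th. lra.
- apply IZR_lt in K9. rewrite !mult_IZR, minus_IZR in K9. unfold e0, th, r. lra.
Qed.

Theorem certified_bifurcation :
  exists (a : R -> C) (zeta : R),
    lle_solution 0.1 1.6 a zeta /\
    nonconstant a /\
    periodic (2 * PI / INR (c_ord c * c_wave c)) a /\
    exists (a_ : nat -> R -> C) (zeta_ : nat -> R),
      (forall n : nat,
        lle_solution 0.1 1.6 (a_ n) (zeta_ n) /\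
        periodic (2 * PI / INR (c_wave c)) (a_ n) /\
        ~ periodic (2 * PI / INR (c_ord c * c_wave c)) (a_ n)) /\
      H1_converges a_ a /\
      is_lim_seq zeta_ zeta.
Proof.
destruct const_split as [[Hm [Hp Hd]] (_ & _ & _ & _ & _ & _ & _ & _ & _ & J1 & J2)].
pose proof S_pos as HS.
assert (HF : forall u v, v * S < Rabs (IZR u) * 1000000000000 -> v / 1000000000000 < Rabs (IZR u / S)).
{ intros u v H. unfold Rdiv. rewrite Rabs_mult, (Rabs_pos_eq (/ S)) by (left; apply Rinv_0_lt_compat; auto).
  apply (Rmult_lt_reg_r S); auto. rewrite (Rmult_assoc (Rabs _)), Rinv_l by lra. lra. }
apply (secondary_bifurcation P X al th0 th e0 r (c_wave c) certificate_bounds Hp eq_refl).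
- change (ord P) with m. rewrite jump_pairing. apply IZR_lt in J1.
  rewrite !mult_IZR, abs_IZR in J1. fold S in J1.
  replace (2 * (al * r)) with (2 * (IZR (c_al c) * IZR (c_r c)) / 1000000000000) by (unfold al, r; field).
  apply HF. exact J1.
- change (ord P) with m. rewrite off_pairing. apply IZR_lt in J2.
  rewrite !mult_IZR, abs_IZR in J2. fold S in J2.
  replace (al * r) with (IZR (c_al c) * IZR (c_r c) / 1000000000000) by (unfold al, r; field).
  apply HF. exact J2.
Qed.
End Soundness.

(** * The four bifurcations *)

(** Near zeta = 2.297, where w has the frequencies congruent to 2 and 5 modulo 7. *)
Definition cert_7_1 : certificate := (Certificate 7 1
  268435456 616567513
 [414334798;76355172;0;0;2001823;80530637;0;0;0;0;-3330883;4515646;0;0;27792382;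
11458939;0;0;2652620;2710205;0;0;0;0;-92905;71548;0;0;502409;176313;0;0;91692;
62159;0;0;0;0;-2271;1080;0;0;8958;3093;0;0;2423;1373;0;0;0;0;-52;15;0;0;159;
55;0;0;57;29;0;0;0;0;-1;0;0;0;3;1;0;0;1;1]
  8192
[(0,[1456;-7903;0;0;1537;0;0;0;0;0;85;66;0;0;219;-530;0;0;53;-49;0;0;0;0;1;2;0;0;3;
-10;0;0;1;-2]);
(53486,[3121;-12203;0;0;967;0;0;0;0;0;-14546;20054;0;0;123670;49939;0;0;11692;11929;0;0;
0;0;-821;637;0;0;4467;1550;0;0;811;548;0;0;0;0;-30;14;0;0;119;41;0;0;32;18]);
(0,[0;0;1445;-10779;0;0;0;0;0;0;0;0;196;-495;0;0;-190;-386;0;0;0;0;0;0;0;0;3;-9;0;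
0;-8;-8]);
(0,[0;0;661;27861;0;0;0;0;0;0;0;0;-2175;444;0;0;1934;1514;0;0;0;0;0;0;0;0;-76;-3;
0;0;69;37;0;0;0;0;0;0;0;0;-2;0;0;0;2;1]);
(25287,[5142;-17982;0;0;5010;0;0;0;0;0;-2718;3282;0;0;21845;7499;0;0;2398;2043;0;0;0;0;
-159;105;0;0;781;249;0;0;151;94;0;0;0;0;-6;2;0;0;21;7;0;0;6;3]);
(-61354,[-12476;43629;0;0;-7753;0;0;0;0;0;5686;-8561;0;0;-53002;-18196;0;0;-5141;-4739;0;
0;0;0;342;-273;0;0;-1896;-603;0;0;-346;-221;0;0;0;0;13;-6;0;0;-51;-16;0;0;-14;-7]);
(0,[0;0;0;0;0;0;2250;7780;-531;590;0;0;0;0;0;0;0;0;0;0;360;251;-19;8;0;0;0;0;0;0;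
0;0;0;0;11;6;-1]);
(0,[0;0;0;0;0;0;-448;-16833;481;-1943;0;0;0;0;0;0;0;0;0;0;-353;-417;-2;-40;0;0;0;0;
0;0;0;0;0;0;-12;-9;0;-1]);
(0,[0;0;0;0;0;0;-392;506;2591;3946;0;0;0;0;0;0;0;0;0;0;-17;7;229;124;0;0;0;0;0;0;
0;0;0;0;0;0;7;3]);
(0,[0;0;0;0;0;0;136;-2082;-190;-7110;0;0;0;0;0;0;0;0;0;0;-31;-53;-107;-139;0;0;0;0;
0;0;0;0;0;0;-1;-1;-3;-3]);
(770,[157;-548;0;0;-345;0;0;0;0;0;3465;3183;0;0;666;228;0;0;19;48;0;0;0;0;209;99;0;
0;24;8;0;0;3;2;0;0;0;0;6;3;0;0;1]);
(-4505,[-916;3203;0;0;-466;0;0;0;0;0;219;-4591;0;0;-3892;-1336;0;0;-367;-348;0;0;0;0;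
-24;-83;0;0;-139;-44;0;0;-25;-16;0;0;0;0;-1;-2;0;0;-4;-1;0;0;-1;-1]);
(0,[0;0;-722;63;0;0;0;0;0;0;0;0;6549;3775;0;0;-150;-47;0;0;0;0;0;0;0;0;298;116;0;
0;-5;-2;0;0;0;0;0;0;0;0;8;3]);
(0,[0;0;108;1362;0;0;0;0;0;0;0;0;-351;-2631;0;0;110;77;0;0;0;0;0;0;0;0;-35;-37;0;
0;4;2;0;0;0;0;0;0;0;0;-1;-1]);
(-50500,[5686;26014;0;0;-3507;0;0;0;0;0;23119;-31019;0;0;-194131;-77669;0;0;-18138;-18545;
0;0;0;0;1304;-987;0;0;-6984;-2415;0;0;-1263;-854;0;0;0;0;48;-22;0;0;-187;-64;0;0;
-50;-28]);
(3011,[-75;-954;0;0;114;0;0;0;0;0;-791;1616;0;0;9568;2061;0;0;640;795;0;0;0;0;-54;51;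
0;0;333;100;0;0;52;36;0;0;0;0;-2;1;0;0;9;3;0;0;2;1]);
(0,[0;0;574;-850;0;0;0;0;0;0;0;0;-81;-92;0;0;-5426;-1707;0;0;0;0;0;0;0;0;-4;-2;0;
0;-161;-52;0;0;0;0;0;0;0;0;0;0;0;0;-4;-1]);
(0,[0;0;33;751;0;0;0;0;0;0;0;0;-62;7;0;0;162;-1276;0;0;0;0;0;0;0;0;-2;0;0;0;-2;
-11]);
(1337,[272;-951;0;0;462;0;0;0;0;0;-165;157;0;0;1155;396;0;0;-2429;-511;0;0;0;0;-9;5;
0;0;41;13;0;0;-56;-14;0;0;0;0;0;0;0;0;1;0;0;0;-1]);
(-1265,[-257;900;0;0;-142;0;0;0;0;0;115;-182;0;0;-1093;-375;0;0;-65;-1143;0;0;0;0;7;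
-6;0;0;-39;-12;0;0;-11;-13;0;0;0;0;0;0;0;0;-1]);
(0,[0;0;0;0;0;0;214;340;-32;15;0;0;0;0;0;0;0;0;0;0;-1591;-301;-1;0;0;0;0;0;0;0;
0;0;0;0;-34;-9;0;0;0;0;0;0;0;0;0;0;0;0;-1]);
(0,[0;0;0;0;0;0;11;-271;6;-38;0;0;0;0;0;0;0;0;0;0;15;-850;0;-1;0;0;0;0;0;0;0;0;
0;0;-3;-6]);
(0,[0;0;0;0;0;0;-20;7;179;154;0;0;0;0;0;0;0;0;0;0;-1;0;-1130;-177;0;0;0;0;0;0;0;
0;0;0;0;0;-21;-6]);
(0,[0;0;0;0;0;0;0;-39;16;-89;0;0;0;0;0;0;0;0;0;0;-1;-1;11;-696;0;0;0;0;0;0;0;0;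
0;0;0;0;-2;-4]);
(0,[0;0;0;0;-19;0;0;0;0;0;186;113;0;0;0;0;0;0;-2;-1;0;0;0;0;-855;-112;0;0;0;0;0;
0;0;0;0;0;0;0;-14;-4]);
(-84,[-17;59;0;0;-11;0;0;0;0;0;27;-47;0;0;-72;-25;0;0;-7;-7;0;0;0;0;8;-582;0;0;-3;
-1;0;0;0;0;0;0;0;0;-2;-3]);
(0,[0;0;-27;11;0;0;0;0;0;0;0;0;271;132;0;0;-5;-1;0;0;0;0;0;0;0;0;-673;-73;0;0;0;
0;0;0;0;0;0;0;0;0;-9;-2]);
(0,[0;0;-2;27;0;0;0;0;0;0;0;0;31;-10;0;0;1;1;0;0;0;0;0;0;0;0;6;-494;0;0;0;0;0;
0;0;0;0;0;0;0;-1;-2]);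
(-1719,[191;891;0;0;-123;0;0;0;0;0;801;-1045;0;0;-6561;-2638;0;0;-609;-629;0;0;0;0;35;
-54;0;0;-795;-136;0;0;-47;-40;0;0;0;0;2;-2;0;0;-13;-4;0;0;-2;-2]);
(-201,[25;117;0;0;-16;0;0;0;0;0;108;-126;0;0;-789;-333;0;0;-83;-79;0;0;0;0;-15;-15;
0;0;-25;-435;0;0;-15;-9;0;0;0;0;-1;0;0;0;-2;-2;0;0;-1;-1]);
(0,[0;0;18;-23;0;0;0;0;0;0;0;0;-3;-3;0;0;-153;-57;0;0;0;0;0;0;0;0;0;0;0;0;-471;
-41;0;0;0;0;0;0;0;0;0;0;0;0;-5;-1]);
(0,[0;0;3;11;0;0;0;0;0;0;0;0;-2;0;0;0;-21;-18;0;0;0;0;0;0;0;0;0;0;0;0;2;-370;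
0;0;0;0;0;0;0;0;0;0;0;0;-1;-2]);
(34,[7;-24;0;0;13;0;0;0;0;0;-4;4;0;0;30;10;0;0;-58;-18;0;0;0;0;0;0;0;0;1;0;0;0;
-398;-30;0;0;0;0;0;0;0;0;0;0;0;0;-4;-1]);
(-19,[-4;14;0;0;-1;0;0;0;0;0;2;-3;0;0;-17;-6;0;0;-11;-12;0;0;0;0;0;0;0;0;-1;0;0;
0;1;-324;0;0;0;0;0;0;0;0;0;0;0;0;-1;-1]);
(0,[0;0;0;0;0;0;6;9;-1;0;0;0;0;0;0;0;0;0;0;0;-33;-10;0;0;0;0;0;0;0;0;0;0;0;0;
-343;-23;0;0;0;0;0;0;0;0;0;0;0;0;-3;-1]);
(0,[0;0;0;0;0;0;1;-4;0;-1;0;0;0;0;0;0;0;0;0;0;-5;-7;0;0;0;0;0;0;0;0;0;0;0;0;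
1;-287;0;0;0;0;0;0;0;0;0;0;0;0;-1;-1]);
(0,[0;0;0;0;0;0;-1;0;5;4;0;0;0;0;0;0;0;0;0;0;0;0;-20;-6;0;0;0;0;0;0;0;0;0;0;
0;0;-299;-18]);
(0,[0;0;0;0;0;0;0;-1;1;-1;0;0;0;0;0;0;0;0;0;0;0;0;-3;-5;0;0;0;0;0;0;0;0;0;0;
0;0;1;-255]);
(0,[0;0;0;0;-1;0;0;0;0;0;5;3;0;0;0;0;0;0;0;0;0;0;0;0;-13;-4;0;0;0;0;0;0;0;0;
0;0;0;0;-263;-14]);
(-2,[0;1;0;0;0;0;0;0;0;0;1;-1;0;0;-1;0;0;0;0;0;0;0;0;0;-2;-3;0;0;0;0;0;0;0;0;
0;0;0;0;1;-229]);
(0,[0;0;-1;0;0;0;0;0;0;0;0;0;7;3;0;0;0;0;0;0;0;0;0;0;0;0;-9;-2;0;0;0;0;0;0;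
0;0;0;0;0;0;-234;-11]);
(0,[0;0;0;1;0;0;0;0;0;0;0;0;1;0;0;0;0;0;0;0;0;0;0;0;0;0;-2;-3;0;0;0;0;0;0;0;
0;0;0;0;0;1;-207]);
(-45,[5;23;0;0;-3;0;0;0;0;0;21;-27;0;0;-171;-69;0;0;-16;-16;0;0;0;0;0;-2;0;0;-13;
-4;0;0;-1;-1;0;0;0;0;-1;-3;0;0;-209;-9;0;0;-1;-2]);
(-8,[1;5;0;0;-1;0;0;0;0;0;4;-5;0;0;-32;-13;0;0;-3;-3;0;0;0;0;-1;-1;0;0;-2;-2;0;
0;-1;0;0;0;0;0;-3;-2;0;0;1;-187;0;0;-2;-1]);
(0,[0;0;0;-1;0;0;0;0;0;0;0;0;0;0;0;0;-4;-1;0;0;0;0;0;0;0;0;0;0;0;0;-5;-1;0;0;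
0;0;0;0;0;0;0;0;0;0;-189;-7]);
(0,[0;0;0;0;0;0;0;0;0;0;0;0;0;0;0;0;-1;-1;0;0;0;0;0;0;0;0;0;0;0;0;-1;-2;0;0;
0;0;0;0;0;0;0;0;0;0;0;-170]);
(1,[0;-1;0;0;0;0;0;0;0;0;0;0;0;0;1;0;0;0;-2;0;0;0;0;0;0;0;0;0;0;0;0;0;-4;-1;
0;0;0;0;0;0;0;0;0;0;0;0;-171;-6]);
(0,[0;0;0;0;0;0;0;0;0;0;0;0;0;0;0;0;0;0;0;0;0;0;0;0;0;0;0;0;0;0;0;0;-1;-1;0;
0;0;0;0;0;0;0;0;0;0;0;0;-156]);
(0,[0;0;0;0;0;0;0;0;0;0;0;0;0;0;0;0;0;0;0;0;-1;0;0;0;0;0;0;0;0;0;0;0;0;0;-3;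
-1;0;0;0;0;0;0;0;0;0;0;0;0;-156;-5]);
(0,[0;0;0;0;0;0;0;0;0;0;0;0;0;0;0;0;0;0;0;0;0;0;0;0;0;0;0;0;0;0;0;0;0;0;-1;
-1;0;0;0;0;0;0;0;0;0;0;0;0;0;-143])]
  50299 316 1461 8191 658)%Z.

(** Period doubling near zeta = 0.897. *)
Definition cert_6_3 : certificate := (Certificate 2 3
  100000000 89708207
 [101087822;75738384;-6963853;30000000;-11648023;-17371630;-1059860;-2449594;468657;575828;
78962;138909;-17534;-21465;-4436;-6977;654;797;221;327;-24;-30;-10;-15;1;1]
  1000
[(0,[473;-632;198;0;-109;73;-14;10;4;-3;1;-1]);
(-1254,[-844;693;-57;0;-673;-1372;-72;-193;62;87;11;21;-4;-5;-1;-2]);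
(2436,[506;-506;883;0;-1585;-2114;-207;-334;123;143;24;37;-7;-8;-2;-3]);
(-1508,[-313;313;-121;0;981;1309;89;174;-76;-89;-13;-21;4;5;1;2]);
(-3450,[-1767;175;297;0;-1479;-2262;-129;-310;112;146;19;35;-6;-8;-2;-3]);
(-964,[-477;-32;149;0;-245;-933;-57;-114;31;49;7;13;-2;-3;-1;-1]);
(-134,[-28;28;-86;0;87;116;-182;-60;-7;-8;5;3]);
(6,[1;-1;-34;0;-4;-5;-15;-167;0;0;3;5]);
(186,[97;-7;-24;0;79;139;7;14;-93;-26;-1;-3;2;2]);
(123,[61;-2;-18;0;39;84;1;2;-7;-86;-1;-3;1;2]);
(6,[1;-1;4;0;-4;-5;5;4;0;0;-51;-6;0;0;1]);
(1,[0;0;3;0;-1;-1;3;5;0;0;-2;-49;0;0;0;1]);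
(-9,[-5;0;2;0;-4;-7;0;0;2;2;0;0;-34;-3]);
(-7,[-4;0;1;0;-3;-5;0;0;1;2;0;-1;-1;-33]);
(0,[0;0;0;0;0;0;0;0;0;0;1;0;0;0;-24;-1]);
(0,[0;0;0;0;0;0;0;0;0;0;0;1;0;0;0;-24]);
(0,[0;0;0;0;0;0;0;0;0;0;0;0;0;0;0;0;-18;-1]);
(0,[0;0;0;0;0;0;0;0;0;0;0;0;0;0;0;0;0;-18])]
  6751 280 4731 454496 640)%Z.

(** Period tripling near zeta = 2.831. *)
Definition cert_6_2 : certificate := (Certificate 3 2
  67108864 189996922
 [92811086;-1718536;4420344;26843546;5423408;-13007981;-49869789;-12232131;-6853716;
-6072191;-1400478;1978539;7583868;1374651;1878217;1013048;290908;-278882;-1112093;-191381;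
-400629;-168263;-55370;38778;162758;27626;76962;27631;9986;-5364;-23815;-4022;-13942;
-4488;-1738;739;3485;587;2432;722;295;-101;-510;-86;-413;-115;-49;14;75;13;69;18;
8;-2;-11;-2;-11;-3]
  4096
[(0,[-66;-3540;1052;0;-462;-289;-467;1902;-275;223;67;66;52;-289;50;-65;-9;-13;-7;42;-9;
14;1;2;1;-6;2;-3;0;0;0;1;0;1]);
(19369,[28;-2134;-112;0;120;-1508;-7023;-258;-429;-686;-282;545;2163;196;385;231;102;-119;
-474;-52;-138;-58;-28;22;92;11;37;13;6;-4;-17;-2;-9;-3]);
(1509,[272;-2370;2924;0;2446;1336;203;1481;-2276;-96;-1161;-315;-105;-228;547;11;277;63;26;
35;-109;-2;-56;-12;-5;-5;20;0;10;2;1;1;-3]);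
(-6438,[-1159;10109;-3852;0;587;-689;-868;-6315;1203;-923;175;148;449;972;-172;264;-55;-29;
-111;-150;14;-59;11;5;23;23;1;12;-2;-1;-4;-3;-1;-2]);
(-57,[-10;90;2799;0;4598;2318;-8;-56;-2253;-307;-2167;-552;4;9;580;79;508;108;-1;-1;-121;
-17;-102;-20;0;0;23;3;19;4;0;0;-4;-1]);
(3414,[614;-5360;571;0;-2553;-2755;460;3349;550;556;1009;399;-238;-515;-212;-168;-235;-72;
59;79;55;39;47;12;-12;-12;-12;-8;-9;-2;2;2;3;1]);
(1890,[-914;140;562;0;1131;281;-1763;-462;-494;-233;-509;-19;428;93;187;75;127;1;-97;-19;
-52;-18;-27;0;19;4;12;4;5;0;-3;-1;-3;-1]);
(-5667,[234;345;-118;0;-58;450;2462;-747;87;220;140;-171;-715;-17;-108;-66;-46;37;156;9;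
41;16;12;-7;-30;-2;-11;-4;-3;1;5;1;3;1]);
(-847,[-152;1330;-2570;0;-2067;-1118;-114;-831;448;-77;943;257;59;128;-175;17;-225;-51;-15;
-20;32;-4;45;9;3;3;-6;1;-8;-2;-1;0;1]);
(1222,[220;-1919;885;0;21;99;165;1199;-165;-412;-84;-28;-85;-185;35;-19;22;6;21;28;-4;6;
-5;-1;-4;-4;0;-1;1;0;1;1]);
(-72,[-13;113;-1188;0;-2018;-923;-10;-71;915;110;269;162;5;11;-234;-28;-120;-32;-1;-2;49;
6;23;6;0;0;-9;-1;-4;-1;0;0;2]);
(-535,[-96;840;-122;0;361;294;-72;-524;-60;-85;-78;-428;37;81;27;26;27;23;-9;-12;-7;-6;
-6;-4;2;2;2;1;1;1]);
(-575,[236;157;-425;0;-595;-204;343;3;275;77;253;18;-465;-31;-91;-32;-66;1;61;7;27;9;14;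
0;-13;-2;-7;-2;-3;0;2;0;1]);
(780,[-29;14;8;0;-5;-44;-343;-4;17;-34;-35;19;128;-259;1;9;14;-5;-23;6;-2;-1;-3;1;4;
-1;1;0;1;0;-1]);
(192,[35;-301;634;0;529;283;26;188;-188;16;-240;-65;-13;-29;-203;-16;57;13;3;4;12;3;-11;
-2;-1;-1;-3;-1;2;0;0;0;1]);
(-172,[-31;271;-96;0;27;-1;-23;-169;21;5;-1;1;12;26;9;-197;0;0;-3;-4;0;4;0;0;1;1;0;
-1]);
(26,[5;-40;278;0;459;208;3;25;-212;-24;-115;-37;-2;-4;54;6;-154;0;0;1;-11;-1;7;0;0;0;
2;0;-2]);
(81,[15;-127;33;0;-30;-35;11;79;-2;11;10;20;-6;-12;-1;-4;4;-158;1;2;1;1;1;4;0;0;0;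
0;0;-1]);
(128,[-48;-56;141;0;191;73;-71;12;-88;-18;-72;-8;59;4;24;9;17;-2;-152;-5;-8;-4;-4;1;
10;1;3;1;1;0;-2;0;-1]);
(-103,[3;-15;6;0;10;6;48;6;-10;4;4;0;-14;6;4;-1;-5;0;7;-124;-2;0;2;0;0;2;1]);
(-38,[-7;59;-130;0;-110;-59;-5;-37;37;-4;50;13;3;6;12;3;-12;-3;-1;-1;-113;-3;2;0;0;0;
6;1;0;0;0;0;-1]);
(24,[4;-37;8;0;-9;-3;3;23;-1;-2;2;0;-2;-4;1;5;-1;0;0;1;3;-101;0;0;0;0;0;2]);
(-6,[-1;9;-56;0;-91;-41;-1;-6;42;5;22;7;0;1;-11;-1;7;0;0;0;2;0;-92;-2;0;0;0;0;4]);
(-12,[-2;19;-7;0;0;4;-2;-12;2;-1;-1;-3;1;2;0;0;1;4;0;0;0;0;2;-84;0;0;0;0;0;1]);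
(-26,[9;14;-36;0;-49;-20;13;-4;23;4;17;2;-12;-1;-6;-2;-2;1;10;1;1;1;0;-1;-77;-2;-1;
-1;0;0;3;0;1]);
(13,[0;4;-3;0;-4;-1;-7;-2;3;-1;0;0;2;-1;-1;0;1;1;0;2;1;0;-1;0;1;-70;-1;0;0;0;0;
1]);
(7,[1;-11;25;0;21;11;1;7;-7;1;-9;-3;0;-1;-3;-1;2;1;0;0;6;1;0;0;0;0;-65;-1;0;0;0;
0;2]);
(-3,[-1;5;0;0;2;1;0;-3;0;0;-1;0;0;0;0;-1;0;0;0;0;0;2;0;0;0;0;1;-60;0;0;0;0;0;
1]);
(1,[0;-2;10;0;17;8;0;1;-8;-1;-4;-1;0;0;2;0;-2;0;0;0;0;0;4;0;0;0;0;0;-55;-1]);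
(2,[0;-3;1;0;1;0;0;2;-1;0;0;0;0;0;0;0;0;-1;0;0;0;0;0;1;0;0;0;0;1;-52]);
(5,[-2;-3;8;0;11;5;-2;1;-5;-1;-4;-1;2;0;1;0;0;0;-2;0;0;0;0;0;3;0;0;0;0;0;-48;
-1]);
(-2,[0;-1;1;0;1;0;1;0;-1;0;0;0;0;0;0;0;0;0;0;0;0;0;0;0;0;1;0;0;0;0;0;-45]);
(-1,[0;2;-4;0;-4;-2;0;-1;1;0;2;0;0;0;1;0;0;0;0;0;-1;0;0;0;0;0;2;0;0;0;0;0;
-42]);
(0,[0;-1;0;0;0;0;0;0;0;0;0;0;0;0;0;0;0;0;0;0;0;0;0;0;0;0;0;1;0;0;0;0;0;-40])]
  6933 389 56606 265028 694)%Z.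

(** Period doubling near zeta = 3.132. *)
Definition cert_4_2 : certificate := (Certificate 2 2
  67108864 210184694
 [65583860;-17882514;1608166;26843546;64515336;11460206;4261828;10657107;22165781;2104063;
2526060;3387535;6889334;487540;1126205;1055149;2115319;133786;450742;328519;648483;39193;
170271;102358;198763;11765;62006;31904;60921;3568;22011;9945;18672;1087;7667;3100;
5723;332;2632;966;1754;101;893;301;538;31;300;94;165;10;100;29;51;3;33;9;15;1;
11;3;5;0;4;1;1]
  4096
[(0,[-682;-2502;1028;0;437;-2461;416;-138;80;-846;135;-89;19;-263;43;-41;5;-81;14;-16;1;
-25;4;-6;0;-8;1;-2;0;-2;0;-1;0;-1]);
(16541,[-460;-19;-264;0;3340;-117;-382;651;2492;121;-51;404;1178;47;46;183;483;19;45;74;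
185;8;27;29;68;3;13;11;24;1;6;4;8;0;2;1]);
(17,[3;-320;64;0;-80;-370;736;54;-71;-124;343;0;-35;-39;142;-3;-15;-12;54;-1;-6;-4;20;
-1;-2;-1;7;0;-1;0;2;0;0;0;1]);
(-409,[-74;7934;-3723;0;1983;9154;-1747;1222;1754;3070;-506;671;866;960;-111;298;362;299;
-11;120;140;93;6;46;52;29;6;17;19;9;3;6;6;3;1;2]);
(-987,[583;-1258;587;0;-874;-1566;304;-156;-259;-494;92;-103;-146;-158;21;-48;-62;-49;3;
-19;-24;-15;-1;-7;-9;-5;-1;-3;-3;-1;-1;-1;-1]);
(9397,[-633;764;-74;0;2273;-1042;-277;429;1536;33;-62;251;725;9;14;111;297;5;21;45;114;2;
14;17;42;1;7;6;15;0;3;2;5;0;1;1]);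
(27,[5;-531;916;0;-133;-613;-418;-161;-117;-206;2;-50;-58;-64;-15;-23;-24;-20;-9;-9;-9;
-6;-4;-3;-3;-2;-2;-1;-1;-1;-1]);
(-161,[-29;3113;-1665;0;778;3592;-530;-392;688;1205;-174;175;340;377;-34;85;142;117;-1;37;
55;37;4;15;20;11;3;6;7;4;1;2;3;1;1;1]);
(-687,[347;-440;205;0;-71;-484;141;-103;-733;-216;47;-76;-179;-58;6;-37;-79;-19;-3;-15;
-31;-6;-3;-6;-11;-2;-2;-2;-4;-1;-1;-1;-1]);
(3133,[-218;327;-16;0;722;32;-136;166;635;-439;-57;103;276;-6;-11;43;113;-4;1;17;43;-1;
3;6;16;0;2;2;6;0;1;1;2]);
(13,[2;-253;442;0;-63;-292;24;-48;-56;-98;-410;-45;-28;-31;-64;-12;-12;-10;-30;-5;-4;-3;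
-12;-2;-2;-1;-4;-1;-1;0;-2;0;0;0;-1]);
(-51,[-9;984;-524;0;246;1136;-192;65;218;381;-7;-285;107;119;-2;16;45;37;3;7;17;12;2;3;
6;4;1;1;2;1;1;0;1]);
(-291,[157;-143;79;0;-27;-163;51;-48;-158;-64;17;-41;-358;-31;1;-23;-62;-7;-3;-10;-26;-3;
-3;-4;-10;-1;-2;-2;-4;0;-1;-1;-1]);
(969,[-67;139;-8;0;235;45;-53;49;191;7;-32;35;113;-248;-14;16;40;-6;-4;5;15;-3;-1;2;6;
-1;0;1;2;0;0;0;1]);
(5,[1;-100;184;0;-25;-115;0;-23;-22;-39;-62;-12;-11;-12;-236;-11;-5;-4;-29;-2;-2;-1;-13;
-1;-1;0;-5;0;0;0;-2;0;0;0;-1]);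
(-16,[-3;303;-160;0;76;349;-59;15;67;117;-10;5;33;37;12;-186;14;11;2;-2;5;4;1;-1;2;1;
1;0;1]);
(-112,[63;-48;34;0;-8;-56;17;-20;-66;-24;3;-18;-60;-8;-1;-12;-184;-6;-2;-7;-21;-1;-2;
-3;-9;0;-1;-1;-3;0;-1;0;-1]);
(296,[-20;54;-3;0;75;27;-20;14;61;4;-14;9;31;-5;-9;6;20;-151;-5;2;6;-3;-2;0;2;-2;-1;
0;1;-1]);
(2,[0;-37;71;0;-9;-43;-1;-9;-8;-14;-28;-6;-4;-5;-29;-2;-2;-1;-138;-3;-1;0;-12;0;0;0;
-5;0;0;0;-2;0;0;0;-1]);
(-5,[-1;93;-48;0;23;107;-18;4;20;36;-3;0;10;11;1;-3;4;3;6;-120;2;1;1;-2;1;0;0;-1]);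
(-41,[24;-17;15;0;-2;-20;6;-8;-25;-9;-1;-7;-25;-3;-2;-5;-21;-1;-2;-4;-110;-2;-1;-2;-8;
0;-1;-1;-3;0;-1;0;-1]);
(90,[-6;20;-1;0;24;12;-7;4;19;2;-5;2;10;-2;-4;1;5;-3;-3;1;5;-99;-2;0;1;-2;-1;0;0;
-1]);
(1,[0;-14;26;0;-3;-16;-1;-3;-3;-5;-11;-2;-1;-2;-12;-1;-1;-1;-12;0;0;0;-89;-1;0;0;-5;
0;0;0;-2;0;0;0;-1]);
(-1,[0;28;-15;0;7;33;-6;1;6;11;-1;0;3;3;0;-2;1;1;1;-2;0;0;2;-82;0;0;0;-1;0;0;0;
-1]);
(-15,[9;-6;6;0;-1;-7;2;-3;-9;-3;-1;-3;-9;-1;-2;-2;-9;-1;-1;-2;-8;0;-1;-1;-74;-1;0;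
-1;-4;0;0;0;-2]);
(27,[-2;7;0;0;8;5;-2;1;6;1;-2;1;3;-1;-2;0;1;-1;-1;0;1;-2;-1;0;2;-69;-1;0;0;-1]);
(0,[0;-5;10;0;-1;-6;0;-1;-1;-2;-4;-1;-1;-1;-5;0;0;0;-5;0;0;0;-5;0;0;0;-62;-1;0;0;
-3;0;0;0;-1]);
(0,[0;9;-4;0;2;10;-2;0;2;3;0;0;1;1;0;-1;0;0;0;-1;0;0;0;-1;0;0;1;-59;0;0;0;-1]);
(-5,[3;-2;3;0;0;-3;1;-1;-3;-1;-1;-1;-3;0;-1;-1;-3;0;-1;-1;-3;0;-1;-1;-4;0;0;-1;
-54;0;0;0;-2]);
(8,[-1;3;0;0;2;2;-1;0;2;0;-1;0;1;0;-1;0;0;-1;-1;0;0;-1;-1;0;0;-1;-1;0;1;-51]);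
(0,[0;-2;3;0;0;-2;0;0;0;-1;-1;0;0;0;-2;0;0;0;-2;0;0;0;-2;0;0;0;-3;0;0;0;-46;0;
0;0;-1]);
(0,[0;3;-1;0;1;3;-1;0;1;1;0;0;0;0;0;0;0;0;0;0;0;0;0;-1;0;0;0;-1;0;0;1;-45]);
(-2,[1;-1;1;0;0;-1;0;0;-1;0;0;0;-1;0;0;0;-1;0;0;0;-1;0;0;0;-2;0;0;0;-2;0;0;0;
-41]);
(3,[0;1;0;0;1;1;0;0;1;0;0;0;0;0;0;0;0;0;0;0;0;0;0;0;0;0;0;0;0;0;0;0;1;-39]);
(0,[0;-1;1;0;0;-1;0;0;0;0;0;0;0;0;-1;0;0;0;-1;0;0;0;-1;0;0;0;-1;0;0;0;-1;0;0;
0;-36]);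
(0,[0;1;0;0;0;1;0;0;0;0;0;0;0;0;0;0;0;0;0;0;0;0;0;0;0;0;0;0;0;0;0;0;0;0;0;
-35])]
  8620 347 50504 176715 673)%Z.

Lemma cert_7_1_linear : check_linear cert_7_1 = true.
Proof. vm_compute. reflexivity. Qed.

Lemma cert_7_1_columns : check_columns cert_7_1 = true.
Proof. vm_compute. reflexivity. Qed.

Lemma cert_7_1_constants : check_constants cert_7_1 = true.
Proof. vm_compute. reflexivity. Qed.

Lemma cert_6_3_linear : check_linear cert_6_3 = true.
Proof. vm_compute. reflexivity. Qed.

Lemma cert_6_3_columns : check_columns cert_6_3 = true.
Proof. vm_compute. reflexivity. Qed.

Lemma cert_6_3_constants : check_constants cert_6_3 = true.
Proof. vm_compute. reflexivity. Qed.

Lemma cert_6_2_linear : check_linear cert_6_2 = true.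
Proof. vm_compute. reflexivity. Qed.

Lemma cert_6_2_columns : check_columns cert_6_2 = true.
Proof. vm_compute. reflexivity. Qed.

Lemma cert_6_2_constants : check_constants cert_6_2 = true.
Proof. vm_compute. reflexivity. Qed.

Lemma cert_4_2_linear : check_linear cert_4_2 = true.
Proof. vm_compute. reflexivity. Qed.

Lemma cert_4_2_columns : check_columns cert_4_2 = true.
Proof. vm_compute. reflexivity. Qed.

Lemma cert_4_2_constants : check_constants cert_4_2 = true.
Proof. vm_compute. reflexivity. Qed.

Theorem mainTheorem2 :
  forall q p : nat,
    In (q, p) [(7, 1); (6, 3); (6, 2); (4, 2)]%nat ->
    exists (a : R -> C) (zeta : R),
      lle_solution 0.1 1.6 a zeta /\
      nonconstant a /\
      periodic (2 * PI / INR q) a /\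
      exists (a_ : nat -> R -> C) (zeta_ : nat -> R),
        (forall n : nat,
          lle_solution 0.1 1.6 (a_ n) (zeta_ n) /\
          periodic (2 * PI / INR p) (a_ n) /\
          ~ periodic (2 * PI / INR q) (a_ n)) /\
        H1_converges a_ a /\
        is_lim_seq zeta_ zeta.
Proof.
intros q p [H|[H|[H|[H|[]]]]]; injection H as <- <-.
- exact (certified_bifurcation cert_7_1 cert_7_1_linear
    cert_7_1_columns cert_7_1_constants).
- exact (certified_bifurcation cert_6_3 cert_6_3_linear
    cert_6_3_columns cert_6_3_constants).
- exact (certified_bifurcation cert_6_2 cert_6_2_linear
    cert_6_2_columns cert_6_2_constants).
- exact (certified_bifurcation cert_4_2 cert_4_2_linear
    cert_4_2_columns cert_4_2_constants).
Qed.
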